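(* Let $2\mu\in[0,1]$, and let $n,m$ be sufficiently large, with $n/m=2\mu$. Let $\rho\in(0,1)$. Let $p$ be prime, and fix an MDS generator matrix $B\in\mathbb{F}_p^{m\times n}$. Then for any sets $S_1,\dots,S_m\subseteq\mathbb{F}_p$ with $|S_i|=\rho p$ for every $i$, there exists $x\in\mathbb{F}_p^n$ with $$s(x)\ge\mathrm{SCL}_\rho(\mu+\delta)-o(1),$$ for any $\delta\in[0,1-\rho-\mu]$ such that $E_\rho(\mu,\delta)+F_\rho(\mu)<0$, where $$E_\rho(\mu,\delta)=2\mu\log2-H(\mu+\delta)+\max_\gamma\left\{\gamma\log\!\left(\frac{|1-2\rho|}{2\sqrt{\rho(1-\rho)}}\right)+2\mu H\!\left(\frac{\gamma}{2\mu}\right)+(1-2\mu)H\!\left(\frac{\delta-\gamma/2}{1-2\mu}\right)\right\},$$ $$F_\rho(\mu)=(2\mu-1)\log\rho+\mu\log\!\left(\frac{\rho}{1-\rho}\right)+2\mu(4\mu-1)\log\!\left(\frac{|\sin(\rho\pi)|}{\rho\pi}\right),$$ the maximum being over all real $\gamma$ for which the arguments of $H$ lie in $[0,1]$.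
   Context: The $o(1)$ term is with respect to $m,n\to\infty$ with the ratio $n/m=2\mu$ fixed. A matrix $B\in\mathbb{F}_p^{m\times n}$ with $n\le m$ is an MDS generator matrix if any $n$ of its rows are linearly independent. Given $B$ and sets $S_1,\dots,S_m\subseteq\mathbb{F}_p$, the satisfaction ratio of $x\in\mathbb{F}_p^n$ is $s(x)=\frac1m\left|\{i\in\{1,\dots,m\}:(Bx)_i\in S_i\}\right|$. $H(x)=-x\log x-(1-x)\log(1-x)$ for $x\in[0,1]$ with $H(0)=H(1)=0$, natural logarithm, undefined outside $[0,1]$. Degenerate terms: $0\cdot H(0/0)$ is read as $0$, and for $\rho=1/2$ the term $\gamma\log 0$ is $0$ if $\gamma=0$ and $-\infty$ if $\gamma>0$. For $\rho\in(0,1)$ and $\alpha\ge0$, $\mathrm{SCL}_\rho(\alpha)=\left(\sqrt{\alpha(1-\rho)}+\sqrt{\rho(1-\alpha)}\right)^2$ if $\alpha+\rho\le1$ and $\mathrm{SCL}_\rho(\alpha)=1$ if $\alpha+\rho\ge1$. *)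

(* Defs.v *)
From HB Require Import structures.
From mathcomp Require Import all_boot all_order all_algebra.
From mathcomp Require Import all_classical all_reals all_analysis.

Set Implicit Arguments.
Unset Strict Implicit.
Unset Printing Implicit Defensive.

Import Order.TTheory GRing.Theory Num.Theory.

Local Open Scope classical_set_scope.
Local Open Scope ring_scope.

Definition is_MDS (F : fieldType) (m n : nat) (B : 'M[F]_(m, n)) : Prop :=
  (n <= m)%N /\
  forall f : 'I_n -> 'I_m, injective f -> row_free (rowsub f B).

Definition sat_ratio (R : realType) (p m n : nat) (B : 'M['F_p]_(m, n))
    (S : 'I_m -> {set 'F_p}) (x : 'cV['F_p]_n) : R :=
  #|[set i : 'I_m | (B *m x) i ord0 \in S i]%SET|%:R / m%:R.

(* [ln 0 = 0], so that [entropy 0 = entropy 1 = 0]; values outside [0, 1] are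
   never used below. *)
Definition entropy (R : realType) (x : R) : R :=
  - x * ln x - (1 - x) * ln (1 - x).

(* "a / b is in [0, 1]", where 0 / 0 is allowed but a / 0 with a != 0 is not
   (in MathComp a / 0 = 0). *)
Definition ratio01 (R : realType) (a b : R) : bool :=
  if b == 0 then a == 0 else 0 <= a / b <= 1.

Definition SCL (R : realType) (rho alpha : R) : R :=
  if alpha + rho <= 1
  then (Num.sqrt (alpha * (1 - rho)) + Num.sqrt (rho * (1 - alpha))) ^+ 2
  else 1.

Definition gamma_range (R : realType) (mu delta : R) : set R :=
  [set g | ratio01 g (2 * mu) /\ ratio01 (delta - g / 2) (1 - 2 * mu)].

(* The logarithm is the extended one, [lne 0 = -oo]: for rho = 1/2 the first
   term is 0 when g = 0 (as 0 * -oo = 0) and -oo when g > 0. *)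
Definition E_objective (R : realType) (rho mu delta g : R) : \bar R :=
  (g%:E * lne (`|1 - 2 * rho| / (2 * Num.sqrt (rho * (1 - rho))))%:E
   + (2 * mu * entropy (g / (2 * mu))
      + (1 - 2 * mu) * entropy ((delta - g / 2) / (1 - 2 * mu)))%:E)%E.

(* For 0 < rho < 1, 0 <= 2 mu <= 1 and 0 <= delta <= 1 - rho - mu, the range of
   gamma is compact and nonempty and the objective is upper semicontinuous, so
   this supremum is a maximum. *)
Definition E_term (R : realType) (rho mu delta : R) : \bar R :=
  ((2 * mu * ln 2 - entropy (mu + delta))%:E
   + ereal_sup [set E_objective rho mu delta g | g in gamma_range mu delta])%E.

Definition F_term (R : realType) (rho mu : R) : R :=
  (2 * mu - 1) * ln rho + mu * ln (rho / (1 - rho))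
  + 2 * mu * (4 * mu - 1) * ln (`|sin (rho * pi)| / (rho * pi)).

(* Main.v *)
(* Let g_i = (1_{S_i} - rho) / sqrt(rho (1 - rho)) be the normalized indicator of
   the i-th constraint. For y uniform on F_p^m the normalized elementary symmetric
   polynomials P_k of the g_i(y_i) are orthonormal, and multiplication by sum_i g_i
   is tridiagonal in them, with coefficients making the quadratic form of a block
   of K consecutive P_k just below k = (mu + delta) m close to m SCL(mu + delta).
   If the P_k are still almost orthonormal for y uniform on the code, testing
   against (sum of the P_k over the block)^2 yields the codeword B x.

   By Poisson summation the error in the Gram matrix is a sum over the nonzero
   dual codewords c. Weighting P_j P_k with w^(j + k) turns it into a sum of
   products over the coordinates: a factor 1 + w^2 where c_i = 0 and a multiple of
   the Fourier coefficient of g_i at c_i elsewhere. Since the dual code is MDS of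
   dimension m - n, a cyclic window of 2n - m coordinates can be bounded in sup
   norm (an arc maximizes the Fourier coefficients of a set of residues, whence
   sin(rho pi) / (rho pi)) and the rest consists of two information sets, on
   which Parseval's identity applies. The optimal w is dual to the maximization
   over gamma, and the error exponent is E + F.

   As E + F may be negative but arbitrarily small, a small proportion of the
   constraints is dropped: this gains an exponential factor and costs only o(1) in
   the satisfaction ratio. The argument needs 4 mu >= 1; for smaller mu the
   hypothesis E + F < 0 never holds. *)

Require Import Defs.
From HB Require Import structures.
From mathcomp Require Import all_boot all_order all_algebra.
From mathcomp Require Import all_classical all_reals all_analysis.
From mathcomp Require Import complex.
From mathcomp Require Import ring lra zify.

Set Implicit Arguments.
Unset Strict Implicit.
Unset Printing Implicit Defensive.

Import Order.TTheory GRing.Theory Num.Theory.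
Import numFieldNormedType.Exports.

Local Open Scope ring_scope.

(** * MDS codes and sums over the dual code *)

(** The threshold on [m] must be uniform in [rho], [p], [B], [S] and [delta], which two quantities
    obstruct. The arc bound contains [p * sin (pi / p)] instead of [pi], and the quotient enters to
    the power [m]; it stays bounded because an MDS code over a small field cannot be long:
    [m - n <= p], so [p] grows linearly with [m] when [2 * mu < 1]. Next, comparing [w ^+ (j + k)]
    with the power of [w] in the exponent costs a power of [1 / rho]; each dropped row gains
    [min(rho, 1/2)], so a bounded number of them pays this cost and the others give a decay
    independent of [rho].

    [E] enters only through a lower bound: the supremum is at least the objective at the stationary
    point attached to [w], and as [w ^+ 2] runs over [[0, (1 - rho) / rho]] these points reach every
    admissible [delta]. *)

Lemma MDS_dual_eq0 (F : fieldType) m n (B : 'M[F]_(m, n)) (c : 'rV[F]_m)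
    (J : {set 'I_m}) :
  is_MDS B -> (m - n <= #|J|)%N -> c *m B = 0 ->
  (forall i, i \in J -> c 0 i = 0) -> c = 0.
Proof.
case=> le_nm mdsB leJ cB0 cJ.
case: m => [|m] in B c J le_nm mdsB leJ cB0 cJ *; first exact: thinmx0.
(* Listing the complement of [J] first, the first [n] entries of [s] contain it, since
   [#|~: J| <= n]. The rows of [B] at these entries are independent, and [c] is supported on
   them. *)
pose s := enum (~: J) ++ enum J.
have us : uniq s.
  rewrite cat_uniq !enum_uniq /= andbT; apply/hasPn=> i /=.
  by rewrite !mem_enum inE => ->.
have sz_s : size s = m.+1.
  by rewrite size_cat -!cardE addnC cardsC card_ord.
pose f (j : 'I_n) := nth ord0 s j.
have f_inj : injective f.
  move=> j k /eqP; rewrite nth_uniq ?sz_s ?(leq_trans (ltn_ord _)) //.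
  by move/eqP/val_inj.
have fJ i : i \notin f @: 'I_n -> i \in J.
  apply: contraR => iJ.
  have is_ : i \in enum (~: J) by rewrite mem_enum inE.
  have lt_in : (index i (enum (~: J)) < n)%N.
    apply: (leq_trans (n := #|~: J|)); first by rewrite cardE index_mem.
    by have := cardsC J; rewrite card_ord; lia.
  apply/imsetP; exists (Ordinal lt_in) => //=.
  by rewrite /f /= nth_cat index_mem is_ nth_index.
pose c' := \row_j c 0 (f j).
have c'0 : c' = 0.
  apply: (row_free_inj (mdsB _ f_inj)); rewrite mul0mx -cB0.
  apply/matrixP=> i k; rewrite !mxE ord1.
  rewrite [RHS](bigID [in f @: 'I_n]) /= [X in _ + X]big1 ?addr0; last first.
    by move=> l /fJ/cJ ->; rewrite mul0r.
  rewrite big_imset /=; last by move=> x y _ _; exact: f_inj.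
  by apply: eq_bigr => l _; rewrite !mxE.
apply/rowP=> i; rewrite mxE; case: (boolP (i \in f @: 'I_n)) => [|/fJ/cJ //].
by case/imsetP => j _ ->; have /rowP/(_ j) := c'0; rewrite !mxE.
Qed.

Lemma MDS_rowsub (F : fieldType) m N n (B : 'M[F]_(m, n)) (g : 'I_N -> 'I_m) :
  injective g -> (n <= N)%N -> is_MDS B -> is_MDS (rowsub g B).
Proof.
move=> g_inj le_nN [_ mdsB]; split=> // f f_inj.
rewrite -rowsub_comp; apply: mdsB; exact: inj_comp.
Qed.

(** By [MDS_dual_eq0] a dual codeword is determined by its coordinates in [J], so the left side is a
    subsum of the expanded product. *)
Lemma sum_dual_info (R : realFieldType) (F : finFieldType) m n (B : 'M[F]_(m, n))
    (J : {set 'I_m}) (b : 'I_m -> F -> R) :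
  is_MDS B -> (m - n <= #|J|)%N -> (forall i v, 0 <= b i v) ->
  \sum_(c : 'rV[F]_m | c *m B == 0) \prod_(i in J) b i (c 0 i)
    <= \prod_(i in J) \sum_v b i v.
Proof.
move=> mdsB leJ b0.
rewrite (big_distr_big_dep 0) /=.
pose h (c : 'rV[F]_m) : {ffun 'I_m -> F} := [ffun i => if i \in J then c 0 i else 0].
have h_inj : {in [pred c : 'rV[F]_m | c *m B == 0] &, injective h}.
  move=> c d; rewrite !inE => /eqP cB /eqP dB /ffunP hcd.
  apply/eqP; rewrite -subr_eq0; apply/eqP/(MDS_dual_eq0 mdsB leJ).
    by rewrite mulmxBl cB dB subr0.
  by move=> i iJ; have := hcd i; rewrite !ffunE iJ !mxE => ->; rewrite subrr.
rewrite (eq_bigr (fun c => \prod_(i in J) b i (h c i))); last first.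
  by move=> c _; apply: eq_bigr => i iJ; rewrite ffunE iJ.
rewrite -(big_imset (fun f : {ffun 'I_m -> F} => \prod_(i in J) b i (f i)) h_inj) /=.
rewrite [leRHS](bigID [in h @: [pred c : 'rV[F]_m | c *m B == 0]]) /=.
rewrite -[leLHS]addr0 lerD ?sumr_ge0 //; last first.
  by move=> *; rewrite prodr_ge0.
rewrite le_eqVlt; apply/orP; left; apply/eqP; apply: eq_bigl => f.
rewrite andb_idl // => /imsetP [c _ ->].
apply/pfamilyP; split=> [|i _]; last by [].
apply/supportP=> i iJ; by rewrite ffunE (negbTE iJ).
Qed.

Section cyclic_windows.
Variable N : nat.
Implicit Types (i s : 'I_N.+1) (a b : nat).

(** The subtraction is modulo [N.+1], so the window is cyclic with origin [s]. *)
Definition window a b s := [set i | (a <= nat_of_ord (i - s)%R < b)%N].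

Lemma sum_interval_indicator a b : (b <= N.+1)%N ->
  \sum_(i < N.+1) ((a <= i < b)%N : nat) = (b - a)%N.
Proof.
have H M : \sum_(i < M) ((a <= i < b)%N : nat) = (minn b M - a)%N.
  by elim: M => [|M IH]; rewrite ?big_ord0 ?big_ord_recr /= ?IH; lia.
by move=> leb; rewrite H (minn_idPl leb).
Qed.

Lemma card_window a b s : (b <= N.+1)%N -> #|window a b s| = (b - a)%N.
Proof.
move=> leb; rewrite -(sum_interval_indicator a leb) -sum1_card big_mkcond /=.
rewrite (reindex_inj (addIr s)) /=; apply: eq_bigr => i _.
by rewrite inE addrK; case: ifP.
Qed.

Lemma card_window_shift a b i : (b <= N.+1)%N ->
  \sum_s (i \in window a b s : nat) = (b - a)%N.
Proof.
move=> leb; rewrite -(sum_interval_indicator a leb).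
rewrite (reindex_inj (inj_comp (addrI i) oppr_inj)) /=; apply: eq_bigr => s _.
by rewrite inE opprD opprK addrA subrr add0r.
Qed.

(* Every point of V lies in b of the N.+1 cyclic windows of length b. *)
Lemma window_pigeonhole b (V : {set 'I_N.+1}) : (b <= N.+1)%N ->
  exists s, (#|V| * b <= N.+1 * #|V :&: window 0 b s|)%N.
Proof.
move=> leb; apply/existsP; apply: contraT; rewrite negb_exists => /forallP H.
have : (\sum_(s < N.+1) N.+1 * #|V :&: window 0 b s| < \sum_(s < N.+1) #|V| * b)%N.
  have H' s : (N.+1 * #|V :&: window 0 b s| < #|V| * b)%N by rewrite ltnNge; exact: H.
  rewrite (bigD1 ord0) //= [ltnRHS](bigD1 ord0) //= -addSn leq_add //.
  by apply: leq_sum => s _; exact: ltnW.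
rewrite -big_distrr /= big_const_ord iter_addn_0 [ltnRHS]mulnC ltn_mul2l /= ltnNge =>
    /negP[].
have -> : (\sum_(s < N.+1) #|V :&: window 0 b s| = #|V| * b)%N; last by [].
under eq_bigr => s _.
  rewrite -sum1_card (eq_bigl (fun i => (i \in V) && (i \in window 0 b s)));
      last by move=> i; rewrite inE.
  rewrite big_mkcondr /=; over.
rewrite exchange_big /= -sum_nat_const; apply: eq_bigr => i _.
rewrite -[RHS]subn0 -(card_window_shift 0 i leb); apply: eq_bigr => s _.
by case: (i \in _).
Qed.

End cyclic_windows.

(* A dual codeword is cut into a cyclic window where it is bounded in sup norm,
   and two information sets of the dual code, where it is summed in l2. *)
Lemma sum_dual_le (R : realFieldType) (F : finFieldType) N n
    (B : 'M[F]_(N.+1, n)) (G : 'I_N.+1 -> F -> R) (A beta t r K : R) :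
  is_MDS B -> (N.+1 <= n.*2)%N ->
  (forall i v, 0 <= G i v) -> (forall i, \sum_(v | v != 0) G i v ^+ 2 <= 1) ->
  (forall i v, v != 0 -> G i v <= t * r) ->
  0 <= r <= 1 -> 0 < t -> 0 < beta -> beta * t <= A ->
  (forall e : nat, (n * (n.*2 - N.+1) <= N.+1 * e)%N -> r ^+ e <= K) ->
  \sum_(c : 'rV[F]_N.+1 | (c *m B == 0) && (c != 0))
     \prod_i (if c 0 i == 0 then A else beta * G i (c 0 i))
  <= N.+1%:R * ((A / (beta * t)) ^+ (N.+1 - n) *
       ((beta * t) ^+ (n.*2 - N.+1) * K *
        ((beta * t) ^+ 2 + beta ^+ 2) ^+ (N.+1 - n))).
Proof.
move=> mdsB le_m2n G0 Gl2 Gsup /andP[r0 r1] t0 b0 btA HK.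
have [le_nm _] := mdsB.
set L := (n.*2 - N.+1)%N in HK *.
have leLn : (L <= n)%N by rewrite /L; lia.
have leLm : (L <= N.+1)%N by lia.
set A0 := beta * t; have A0_gt0 : 0 < A0 by rewrite mulr_gt0.
(* Zero coordinates get [A0 = beta * t] instead of [A], so that on the first window [A0] bounds
   every factor, with a further [r] on the support. Going back to [A] costs [A / A0] per zero
   coordinate, at most [N.+1 - n] times by [cardV]. *)
pose a i v := if v == 0 then A0 else beta * G i v.
have a0 i v : 0 <= a i v.
  by rewrite /a; case: ifP => _; [exact: ltW | rewrite mulr_ge0 // ltW].
have K0 : 0 <= K.
  by apply: le_trans (HK (n * L)%N _); [exact: exprn_ge0 | rewrite leq_pmull].
pose P b1 b2 s (c : 'rV[F]_N.+1) := \prod_(i in window b1 b2 s) a i (c 0 i).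
have P0 b1 b2 s c : 0 <= P b1 b2 s c by rewrite prodr_ge0.
have prodP s (c : 'rV[F]_N.+1) : \prod_i a i (c 0 i) =
    P 0 L s c * (P L n s c * P n N.+1 s c).
  rewrite (bigID [in window 0 L s]) /=; congr (_ * _).
  rewrite (bigID [in window L n s]) /=; congr (_ * _); apply: eq_bigl => i;
    by rewrite !inE; have := ltn_ord (i - s); move: (nat_of_ord (i - s)) => x ?;
    apply/idP/idP; lia.
set D2 := (A0 ^+ 2 + beta ^+ 2) ^+ (N.+1 - n).
(* Since [L = 2n - N.+1], the windows [[L, n)] and [[n, N.+1)] both have the size [N.+1 - n] of an
   information set of the dual code. *)
have l2 b1 b2 s : (b2 <= N.+1)%N -> (b2 - b1 = N.+1 - n)%N ->
    \sum_(c : 'rV[F]_N.+1 | c *m B == 0) (P b1 b2 s c) ^+ 2 <= D2.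
  move=> le2 def; under eq_bigr do rewrite /P -prodrXl.
  apply: le_trans (sum_dual_info (J := window b1 b2 s) (b :=
      fun i v => a i v ^+ 2) mdsB _ _) _.
  - by rewrite card_window // def.
  - by move=> i v; exact: exprn_ge0.
  rewrite /D2 -def -(card_window b1 s le2) -prodr_const.
  apply: ler_prod => i _; rewrite sumr_ge0 /=; last by move=> *; exact: exprn_ge0.
  rewrite (bigD1 0) //= /a eqxx lerD2l.
  rewrite (eq_bigr (fun v => beta ^+ 2 * G i v ^+ 2)); last first.
    by move=> v /negbTE ->; rewrite exprMn.
  by rewrite -mulr_sumr ler_piMr // sqr_ge0.
have key (c : 'rV[F]_N.+1) : c *m B == 0 -> c != 0 ->
   \prod_i (if c 0 i == 0 then A else beta * G i (c 0 i)) <=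
   \sum_s (A / A0) ^+ (N.+1 - n) * (A0 ^+ L * K * (P L n s c * P n N.+1 s c)).
  move=> /eqP cB c0.
  pose V := [set i | c 0 i != 0].
  have cardV : (n <= #|V|)%N.
    rewrite leqNgt; apply/negP => ltV; move/eqP: c0; apply.
    apply: (MDS_dual_eq0 (J := ~: V) mdsB _ cB).
      have := cardsC V; rewrite card_ord; move: ltV le_nm.
      by move: #|V| #|~: V| => x y; clear; lia.
    by move=> i; rewrite !inE negbK => /eqP.
  (* The good window depends on [c]; replacing its term by the sum over all [s] costs the factor
     [N.+1]. *)
  have [s Hs] := window_pigeonhole V leLm.
  have ge1 : 1 <= A / A0 by rewrite ler_pdivlMr // mul1r.
  have ge0 : 0 <= A / A0 by exact: le_trans ge1.
  rewrite [leRHS](bigD1 s) //= -[leLHS]addr0; apply: lerD; last first.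
    by rewrite sumr_ge0 // => *; rewrite !mulr_ge0 // ?exprn_ge0 // ltW.
  apply: (@le_trans _ _ ((A / A0) ^+ (N.+1 - n) * \prod_i a i (c 0 i))).
    rewrite [leLHS](eq_bigr (fun i => (if i \in V then 1 else A / A0) * a i (c 0 i)));
        last first.
      move=> i _; rewrite inE /a; case: (c 0 i =P 0) => [|] //= _; last by rewrite mul1r.
      by rewrite divfK // gt_eqF.
    rewrite big_split /= ler_wpM2r ?prodr_ge0 //.
    rewrite (bigID [in V]) /= big1 ?mul1r; last by move=> i ->.
    rewrite (eq_bigr (fun=> A / A0)); last by move=> i /negbTE ->.
    rewrite (eq_bigl [in ~: V]); last by move=> i; rewrite !inE.
    rewrite prodr_const; apply: ler_weXn2l => //.
    have := cardsC V; rewrite card_ord; move: cardV le_nm.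
    by move: #|V| #|~: V| => x y; clear; lia.
  rewrite ler_wpM2l ?exprn_ge0 // (prodP s) ler_wpM2r ?mulr_ge0 //.
  have -> : A0 ^+ L = \prod_(i in window 0 L s) A0.
    by rewrite prodr_const card_window // subn0.
  apply: (@le_trans _ _ (\prod_(i in window 0 L s) (A0 * (if i \in V then r else 1)))).
    apply: ler_prod => i _; rewrite a0 /= /a inE.
    case: (c 0 i =P 0) => [|/eqP ci] /=; first by rewrite mulr1.
    by rewrite /A0 -mulrA ler_wpM2l ?Gsup // ltW.
  rewrite big_split /= ler_wpM2l ?prodr_ge0 //; first by move=> *; exact: ltW.
  rewrite -big_mkcondr /= (eq_bigl [in V :&: window 0 L s]); last first.
    by move=> i; rewrite [in RHS]inE andbC.
  rewrite prodr_const; apply: HK; apply: leq_trans Hs.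
  by rewrite leq_mul2r cardV orbT.
apply: (@le_trans _ _ (\sum_(c : 'rV[F]_N.+1 | (c *m B == 0) && (c != 0))
   \sum_s (A / A0) ^+ (N.+1 - n) * (A0 ^+ L * K * (P L n s c * P n N.+1 s c)))).
  by apply: ler_sum => c /andP[cB c0]; exact: key.
rewrite exchange_big /=.
set E := (X in _ <= N.+1%:R * X).
have -> : N.+1%:R * E = \sum_(s < N.+1) E by rewrite sumr_const card_ord mulr_natl.
apply: ler_sum => s _.
rewrite -mulr_sumr /E ler_wpM2l ?exprn_ge0 ?divr_ge0 ?(ltW A0_gt0) //.
  exact: le_trans (ltW A0_gt0) btA.
rewrite -mulr_sumr ler_wpM2l ?mulr_ge0 ?exprn_ge0 ?(ltW A0_gt0) //.
(* The inequality between product and mean of squares decouples the two information sets. *)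
apply: (@le_trans _ _ (\sum_(c : 'rV[F]_N.+1 | c *m B == 0)
   (P L n s c ^+ 2 + P n N.+1 s c ^+ 2) / 2)).
  rewrite big_mkcondr /=; apply: ler_sum => c _; case: ifP => _.
    by have := sqr_ge0 (P L n s c - P n N.+1 s c); nra.
  by rewrite divr_ge0 ?addr_ge0 ?sqr_ge0.
rewrite -mulr_suml big_split /= ler_pdivrMr // [leRHS]mulr_natr mulr2n.
by apply: lerD; apply: l2 => //; rewrite /L; lia.
Qed.

Lemma MDS_eq0 (F : fieldType) m n (B : 'M[F]_(m, n)) (x : 'cV[F]_n)
    (V : {set 'I_m}) :
  is_MDS B -> (n <= #|V|)%N -> (forall i, i \in V -> (B *m x) i 0 = 0) -> x = 0.
Proof.
case=> _ mdsB leV BV0.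
pose f (j : 'I_n) := enum_val (widen_ord leV j).
have f_inj : injective f by move=> i j /enum_val_inj/(congr1 val)/= /val_inj.
have := mdsB _ f_inj; rewrite row_free_unit => uB.
rewrite -(mulKmx uB x) (_ : rowsub f B *m x = 0) ?mulmx0 //.
apply/matrixP=> j k; rewrite ord1 mul_rowsub_mx mxE [RHS]mxE; apply: BV0.
exact: enum_valP.
Qed.

(* On the plane where n - 2 fixed rows vanish, the other rows are pairwise
   independent linear forms, hence have distinct slopes. *)
Lemma MDS_card_field (F : finFieldType) m n (B : 'M[F]_(m, n)) :
  (2 <= n)%N -> is_MDS B -> (m - n <= #|F|)%N.
Proof.
case: n B => [|[|n]] // B _ mdsB; have [le_nm HB] := mdsB.
pose f (j : 'I_n.+2) := widen_ord le_nm j.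
have f_inj : injective f by move=> i j /(congr1 val)/= /val_inj.
have := HB _ f_inj; rewrite row_free_unit => uB.
pose v (j : 'I_n.+2) : 'cV[F]_n.+2 := invmx (rowsub f B) *m delta_mx j 0.
have Bv j k : (B *m v j) (f k) 0 = (k == j)%:R.
  have -> : (B *m v j) (f k) 0 = (rowsub f B *m v j) k 0.
    by rewrite mul_rowsub_mx [RHS]mxE.
  by rewrite /v mulKVmx // mxE eqxx andbT.
pose a : 'I_n.+2 := inord n; pose b : 'I_n.+2 := ord_max.
have neq_ab : (a == b) = false by apply/eqP=> /(congr1 val); rewrite /= inordK //; lia.
pose W := [set i : 'I_m | n.+2 <= i]%N.
have cardW : #|W| = (m - n.+2)%N.
  have := cardsC W; rewrite card_ord.
  have -> : ~: W = f @: 'I_n.+2.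
    apply/setP=> i; rewrite !inE -ltnNge; apply/idP/imsetP => [lt_i|[j _ ->]].
      by exists (Ordinal lt_i) => //; apply: val_inj.
    by have := ltn_ord j; rewrite ltnNge.
  by rewrite card_imset // card_ord; lia.
have fW k : f k \notin W by rewrite inE; have := ltn_ord k; rewrite ltnNge.
pose V0 := f @: [set~ a] :\ f b.
have cardV0 : #|V0| = n.
  have := cardsD1 (f b) (f @: [set~ a]).
  rewrite mem_imset // !inE eq_sym neq_ab /= card_imset // cardsC1 card_ord.
  by rewrite -/V0 add1n => -[].
have V0P i : i \in V0 -> exists k, [/\ i = f k, k != a & k != b].
  rewrite !inE => /andP[ib /imsetP[k]]; rewrite !inE => ka def.
  by exists k; split=> //; apply: contraNneq ib => <-; rewrite def.
have V0W i : i \in W -> i \notin V0.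
  by move=> iW; apply/negP=> /V0P[k [def _ _]]; move: iW; rewrite def (negbTE (fW k)).
have ai i : i \in W -> (B *m v a) i 0 != 0.
  move=> iW; apply/eqP=> va0.
  have : v a = 0.
    apply: (MDS_eq0 (V := i |: (f b |: V0)) mdsB).
      rewrite !cardsU1 cardV0 setD11 in_setU1 negb_or (V0W _ iW) andbT.
      by case: eqP iW => [->|] //; rewrite (negbTE (fW b)).
    move=> j; rewrite in_setU1 => /predU1P[-> //|]; rewrite in_setU1 => /predU1P[->|].
      by rewrite Bv eq_sym neq_ab.
    by case/V0P => k [-> /negbTE ka _]; rewrite Bv ka.
  move=> va; have := Bv a a; rewrite va mulmx0 mxE eqxx => /esym/eqP.
  by rewrite oner_eq0.
(* If [i] and [j] have equal slopes, [q i *: v a - v b] vanishes on [V0], [i] and [j], which are as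
   many rows as [B] has columns. *)
pose q i := (B *m v b) i 0 / (B *m v a) i 0.
have q_inj : {in W &, injective q}.
  move=> i j iW jW qij; apply/eqP; apply: contraT => ij.
  pose x := q i *: v a - v b.
  have Bx k : (B *m x) k 0 = q i * (B *m v a) k 0 - (B *m v b) k 0.
    by rewrite mulmxBr -scalemxAr !mxE.
  have : x = 0.
    apply: (MDS_eq0 (V := i |: (j |: V0)) mdsB).
      by rewrite !cardsU1 cardV0 in_setU1 negb_or ij (V0W _ iW) (V0W _ jW).
    move=> k; rewrite in_setU1 => /predU1P[->|]; last rewrite in_setU1 => /predU1P[->|].
    - by rewrite Bx /q divfK ?ai // subrr.
    - by rewrite Bx qij /q divfK ?ai // subrr.
    - by case/V0P => l [-> /negbTE la /negbTE lb]; rewrite Bx !Bv la lb mulr0 subrr.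
  move=> x0; have := Bx (f b); rewrite x0 mulmx0 mxE !Bv eqxx eq_sym neq_ab mulr0 sub0r.
  by move/esym/eqP; rewrite oppr_eq0 oner_eq0.
by rewrite -cardW -(card_in_imset q_inj) max_card.
Qed.

(** * Fourier analysis over a finite field *)

Section Fourier.
Variables (F : finFieldType) (C : numClosedFieldType) (chi : F -> C).

(** What the Fourier calculus uses of a nontrivial additive character; the last clause is
    orthogonality and contains the nontriviality. *)
Definition is_character :=
  [/\ chi 0 = 1, {morph chi : a b / a + b >-> a * b},
      forall a, (chi a)^* = chi (- a) &
      forall a, a != 0 -> \sum_y chi (a * y) = 0].

Definition fourier (f : F -> C) (c : F) : C :=
  #|F|%:R^-1 * \sum_y f y * chi (- (c * y)).

Hypothesis chiP : is_character.

Let cardF_neq0 : #|F|%:R != 0 :> C.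
Proof. by rewrite pnatr_eq0 -lt0n; apply/card_gt0P; exists 0. Qed.

Lemma character_sum a : \sum_y chi (a * y) = (a == 0)%:R * #|F|%:R.
Proof.
have [chi0 _ _ chis] := chiP.
have [->|/chis ->] := eqVneq a 0; last by rewrite mul0r.
by rewrite mul1r -sumr_const; apply: eq_bigr => y _; rewrite mul0r chi0.
Qed.

Lemma fourier_inversion f y : f y = \sum_c fourier f c * chi (c * y).
Proof.
have [_ chiD _ _] := chiP.
under eq_bigr => c _ do rewrite /fourier -mulrA mulr_suml.
rewrite -mulr_sumr exchange_big /=.
rewrite (eq_bigr (fun z => f z * ((y - z == 0)%:R * #|F|%:R))); last first.
  move=> z _; rewrite -character_sum mulr_sumr; apply: eq_bigr => c _.
  by rewrite -mulrA -chiD mulrBl addrC (mulrC y) (mulrC z).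
rewrite (bigD1 y) //= subrr eqxx mul1r big1 ?addr0; last first.
  by move=> z zy; rewrite subr_eq0 eq_sym (negbTE zy) mul0r mulr0.
by rewrite mulrCA mulVf ?mulr1.
Qed.

Lemma character_sum_prod m (u : 'I_m -> F) :
  \prod_i chi (u i) = chi (\sum_i u i).
Proof. by have [chi0 chiD _ _] := chiP; rewrite (big_morph chi chiD chi0). Qed.

(** After Fourier inversion in every coordinate, the character at [c *m B *m x] summed over [x]
    gives [#|F| ^ n] for dual codewords and 0 for any other [c]. *)
Lemma Poisson_summation m n (B : 'M[F]_(m, n)) (f : 'I_m -> F -> C) :
  \sum_(x : 'cV[F]_n) \prod_i f i ((B *m x) i 0) =
  #|F|%:R ^+ n * \sum_(c : 'rV[F]_m | c *m B == 0) \prod_i fourier (f i) (c 0 i).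
Proof.
have [chi0 chiD _ chis] := chiP.
have rV_sum k (h : ('I_k -> F) -> C) (hE : forall u v, u =1 v -> h u = h v) :
    \sum_(c : 'rV[F]_k) h (c 0) = \sum_(c : {ffun 'I_k -> F}) h c.
  rewrite (reindex (fun c : {ffun 'I_k -> F} => \row_i c i)) /=.
    by apply: eq_bigr => c _; apply: hE => i; rewrite mxE.
  exists (fun r : 'rV[F]_k => [ffun i => r 0 i]) => r _.
    by apply/ffunP => i; rewrite ffunE mxE.
  by apply/rowP => i; rewrite mxE ffunE.
have step x : \prod_i f i ((B *m x) i 0) =
    \sum_(c : 'rV[F]_m) \prod_i fourier (f i) (c 0 i) * chi ((c *m B *m x) 0 0).
  under eq_bigr => i _ do rewrite (fourier_inversion (f i)).
  rewrite bigA_distr_bigA /=.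
  rewrite -(rV_sum m (fun u => \prod_i (fourier (f i) (u i) * chi (u i *
      (B *m x) i 0)))); last first.
    by move=> u v uv; apply: eq_bigr => i _; rewrite uv.
  apply: eq_bigr => c _; rewrite big_split /= character_sum_prod.
  by rewrite -mulmxA [in RHS]mxE.
under eq_bigr do rewrite step.
rewrite exchange_big /= mulr_sumr [RHS]big_mkcond /=.
apply: eq_bigr => c _; rewrite -mulr_sumr.
have xE (x : 'cV[F]_n) : chi ((c *m B *m x) 0 0) = \prod_j chi ((c *m B) 0 j * x j 0).
  by rewrite character_sum_prod mxE.
rewrite (eq_bigr _ (fun x _ => xE x)).
have -> : \sum_(x : 'cV[F]_n) \prod_j chi ((c *m B) 0 j * x j 0) =
    \sum_(r : 'rV[F]_n) \prod_j chi ((c *m B) 0 j * r 0 j).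
  rewrite (reindex (@trmx F 1 n)) /=; last first.
    by apply: onW_bij; exists (@trmx F n 1); exact: trmxK.
  by apply: eq_bigr => r _; apply: eq_bigr => j _; rewrite [r^T _ _]mxE.
rewrite (rV_sum n (fun u => \prod_j chi ((c *m B) 0 j * u j))); last first.
  by move=> u v uv; apply: eq_bigr => i _; rewrite uv.
rewrite -(bigA_distr_bigA (fun j y => chi ((c *m B) 0 j * y))) /=.
rewrite (eq_bigr (fun j => ((c *m B) 0 j == 0)%:R * #|F|%:R)); last first.
  by move=> j _; rewrite -character_sum.
case: (c *m B =P 0) => [->|/eqP cB].
  rewrite mulrC; congr (_ * _); under eq_bigr do rewrite mxE eqxx mul1r.
  by rewrite prodr_const card_ord.
have [j cj] : exists j, (c *m B) 0 j != 0.
  apply/existsP; apply: contraNT cB; rewrite negb_exists => /forallP H.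
  by apply/eqP/rowP => j; rewrite [RHS]mxE; apply/eqP; have := H j; rewrite negbK.
by rewrite [X in _ * X](bigD1 j) //= (negbTE cj) !mul0r mulr0.
Qed.

Lemma Parseval f : \sum_c `|fourier f c| ^+ 2 = #|F|%:R^-1 * \sum_y `|f y| ^+ 2.
Proof.
have [chi0 chiD chiJ chis] := chiP.
have step c : `|fourier f c| ^+ 2 =
    #|F|%:R^-1 * (\sum_y (f y)^* * (fourier f c * chi (c * y))).
  rewrite normCK {2}/fourier rmorphM /= fmorphV rmorph_nat rmorph_sum mulrCA mulr_sumr.
  congr (_ * _); apply: eq_bigr => y _.
  by rewrite rmorphM /= chiJ opprK mulrCA.
under eq_bigr do rewrite step.
rewrite -mulr_sumr exchange_big /=; congr (_ * _); apply: eq_bigr => y _.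
by rewrite -mulr_sumr -fourier_inversion mulrC -normCK.
Qed.

Lemma fourierD f1 f2 a c :
  fourier (fun y => f1 y + a * f2 y) c = fourier f1 c + a * fourier f2 c.
Proof.
rewrite /fourier mulrCA -mulrDr; congr (_ * _).
rewrite mulr_sumr -big_split /=.
by apply: eq_bigr => y _; rewrite mulrDl mulrA.
Qed.

Lemma fourier1 c : fourier (fun=> 1) c = (c == 0)%:R.
Proof.
rewrite /fourier; under eq_bigr do rewrite mul1r -mulNr.
by rewrite character_sum oppr_eq0 mulrC mulfK.
Qed.

Lemma fourier0 f : fourier f 0 = #|F|%:R^-1 * \sum_y f y.
Proof.
have [chi0 _ _ _] := chiP.
by rewrite /fourier; under eq_bigr do rewrite mul0r oppr0 chi0 mulr1.
Qed.

End Fourier.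

(** * Elementary symmetric polynomials of normalized indicators *)

Definition elem_sym (R : comNzRingType) N (v : 'I_N -> R) (k : nat) : R :=
  \sum_(T : {set 'I_N} | #|T| == k) \prod_(i in T) v i.

Lemma elem_symM (R : comNzRingType) N (v : 'I_N -> R) j k :
  elem_sym v j * elem_sym v k =
  \sum_(T : {set 'I_N} | #|T| == j) \sum_(U : {set 'I_N} | #|U| == k)
     \prod_i v i ^+ ((i \in T) + (i \in U)).
Proof.
rewrite /elem_sym mulr_suml; apply: eq_bigr => T _.
rewrite mulr_sumr; apply: eq_bigr => U _.
rewrite big_mkcond /= [X in _ * X]big_mkcond -big_split /=; apply: eq_bigr => i _.
by case: (i \in T); case: (i \in U); rewrite ?mulr1 ?mul1r ?expr2.
Qed.

Lemma prod_sum_pairs_set (R : comNzRingType) N (F : 'I_N -> bool -> bool -> R) :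
  \prod_i (F i true true + F i true false + (F i false true + F i false false)) =
  \sum_(T : {set 'I_N}) \sum_(U : {set 'I_N}) \prod_i F i (i \in T) (i \in U).
Proof.
rewrite bigA_distr /=; apply: eq_bigr => T _.
rewrite (eq_bigr (fun i => F i (i \in T) true + F i (i \in T) false)); last first.
  by move=> i _; case: (i \in T).
by rewrite bigA_distr /=; apply: eq_bigr => U _; apply: eq_bigr => i _; case: (i \in U).
Qed.

Section Gram.
Variables (F : finFieldType) (C : numClosedFieldType) (chi : F -> C).
Hypothesis chiP : is_character chi.
Variables (N n : nat) (B : 'M[F]_(N, n)) (g : 'I_N -> F -> C) (kap : C).
Hypothesis g_mean : forall i, \sum_y g i y = 0.
Hypothesis g_sq : forall i y, g i y ^+ 2 = 1 + kap * g i y.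

(** For index sets [T] and [U], coordinate [i] carries the power [d = (i \in T) + (i \in U)]. By
    [g_sq] the powers 0, 1, 2 all lie in the span of 1 and [g i]. *)
Let hat i (d : nat) c := fourier chi (fun y => g i y ^+ d) c.

Let hat_0 i d : (d <= 2)%N -> hat i d 0 = (d != 1)%:R.
Proof.
rewrite /hat => d2; case: d d2 => [|[|[|]]] // _.
- by rewrite -[LHS]/(fourier chi (fun=> 1) 0) fourier1 // eqxx.
- by rewrite (fourier0 chiP); under eq_bigr do rewrite expr1; rewrite g_mean mulr0.
- have -> : fourier chi (fun y => g i y ^+ 2) 0 = fourier chi (fun y => 1 + kap * g i y) 0.
    by rewrite /fourier; congr (_ * _); apply: eq_bigr => y _; rewrite g_sq.
  by rewrite fourierD fourier1 // (fourier0 chiP) g_mean !mulr0 addr0 eqxx.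
Qed.

Let hat_n0 i d c : (d <= 2)%N -> c != 0 ->
  hat i d c = (d == 1)%:R * fourier chi (g i) c + (d == 2)%:R * (kap * fourier chi (g i) c).
Proof.
move=> d2 c0; rewrite /hat; case: d d2 => [|[|[|]]] // _ /=.
- by rewrite -[LHS]/(fourier chi (fun=> 1) c) fourier1 // (negbTE c0) !mul0r addr0.
- by rewrite mul1r mul0r addr0.
- have -> : fourier chi (fun y => g i y ^+ 2) c = fourier chi (fun y => 1 + kap * g i y) c.
    by rewrite /fourier; congr (_ * _); apply: eq_bigr => y _; rewrite g_sq.
  by rewrite fourierD fourier1 // (negbTE c0) mul0r mul1r.
Qed.

(** The zero codeword gives the orthogonality relation, since by [hat_0] it only sees [T = U]. For
    the others, [w ^+ (j + k)] is the product of [w ^+ d] over the coordinates, and forgetting the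
    sizes of [T] and [U] leaves a sum over all pairs of sets, which factors. A zero coordinate
    allows [d = 0] or [2], a nonzero one [d = 1] (in two ways) or [2]. *)
Lemma elem_sym_Gram (w : C) j k : 0 < w ->
  `| #|F|%:R ^- n * (\sum_(x : 'cV[F]_n)
        elem_sym (fun i => g i ((B *m x) i 0)) j * elem_sym (fun i => g i ((B *m x) i 0)) k)
     - (j == k)%:R * 'C(N, k)%:R |
  <= w ^- (j + k) * \sum_(c : 'rV[F]_N | (c *m B == 0) && (c != 0))
       \prod_i (if c 0 i == 0 then 1 + w ^+ 2
                else (2 * w + `|kap| * w ^+ 2) * `|fourier chi (g i) (c 0 i)|).
Proof.
move=> w0; have w_ge0 := ltW w0.
pose d (T U : {set 'I_N}) i : nat := ((i \in T) + (i \in U))%N.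
have d2 T U i : (d T U i <= 2)%N by rewrite /d; case: (_ \in _); case: (_ \in _).
pose S c := \sum_(T : {set 'I_N} | #|T| == j) \sum_(U : {set 'I_N} | #|U| == k)
     \prod_i hat i (d T U i) (c i).
have -> : #|F|%:R ^- n * (\sum_(x : 'cV[F]_n)
        elem_sym (fun i => g i ((B *m x) i 0)) j * elem_sym (fun i => g i ((B *m x) i 0)) k) =
    \sum_(c : 'rV[F]_N | c *m B == 0) S (c 0).
  under eq_bigr do rewrite elem_symM.
  rewrite exchange_big /= mulr_sumr.
  rewrite [RHS]exchange_big /=; apply: eq_bigr => T _.
  rewrite exchange_big /= mulr_sumr [RHS]exchange_big /=; apply: eq_bigr => U _.
  rewrite (Poisson_summation chiP B (fun i y => g i y ^+ (d T U i))) mulKf //.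
  by rewrite expf_neq0 // pnatr_eq0 -lt0n; apply/card_gt0P; exists 0.
rewrite (bigD1 0) ?mul0mx //=.
have -> : S ((0 : 'rV_N) 0) = (j == k)%:R * 'C(N, k)%:R.
  rewrite /S (eq_bigr (fun T : {set 'I_N} => (#|T| == k)%:R)); last first.
    move=> T _; transitivity (\sum_(U : {set 'I_N} | #|U| == k) (U == T)%:R : C).
      apply: eq_bigr => U _; under eq_bigr do rewrite mxE hat_0 //.
      case: (U =P T) => [->|/eqP UT]; first by rewrite big1 // => i _; rewrite /d;
          case: (_ \in _).
      have [i iUT] : exists i, (i \in T) != (i \in U).
        apply/existsP; apply: contraNT UT; rewrite negb_exists => /forallP H.
        by apply/eqP/setP => i; have := H i; rewrite negbK => /eqP ->.
      rewrite (bigD1 i) //= /d; move: iUT.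
      by case: (_ \in _); case: (_ \in _) => //= _; rewrite mul0r.
    rewrite big_mkcond (bigD1 T) //= eqxx big1 ?addr0; first by case: ifP.
    by move=> U /negbTE ->; case: ifP.
  have [->|jk] := eqVneq j k; last first.
    by rewrite mul0r big1 // => T /eqP ->; rewrite (negbTE jk).
  rewrite mul1r (eq_bigr (fun=> 1)) => [|T ->] //.
  have := card_draws 'I_N k; rewrite card_ord => <-.
  rewrite -sumr_const.
  by apply: eq_bigl => T; rewrite inE.
rewrite addrAC subrr add0r; apply: le_trans (ler_norm_sum _ _ _) _.
rewrite mulr_sumr; apply: ler_sum => c /andP[_ c0].
rewrite ler_pdivlMl ?exprn_gt0 // mulrC.
pose h i (a b : bool) : C := w ^+ (a + b) * `|hat i (a + b) (c 0 i)|.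
have h0 i a b : 0 <= h i a b by rewrite mulr_ge0 // exprn_ge0.
apply: (@le_trans _ _ (\sum_(T : {set 'I_N}) \sum_(U : {set 'I_N}) \prod_i h i (i \in T)
    (i \in U))).
  rewrite /S; apply: le_trans (ler_wpM2r _ (ler_norm_sum _ _ _)) _; first exact: exprn_ge0.
  rewrite mulr_suml big_mkcond /=; apply: ler_sum => T _; case: ifP => [/eqP Tj|_];
      last first.
    by rewrite sumr_ge0 // => *; rewrite prodr_ge0.
  apply: le_trans (ler_wpM2r _ (ler_norm_sum _ _ _)) _; first exact: exprn_ge0.
  rewrite mulr_suml big_mkcond /=; apply: ler_sum => U _; case: ifP => [/eqP Uk|_];
      last first.
    by rewrite prodr_ge0.
  rewrite normr_prod mulrC.
  have -> : w ^+ (j + k) = \prod_i w ^+ d T U i.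
    rewrite -Tj -Uk -[#|T|]sum1_card -[#|U|]sum1_card big_mkcond [X in (_ + X)%N]big_mkcond.
    rewrite -big_split /= expr_sum; apply: eq_bigr => i _.
    by rewrite /d; case: (_ \in _); case: (_ \in _).
  by rewrite -big_split /=.
rewrite -prod_sum_pairs_set; apply: ler_prod => i _.
rewrite !addr_ge0 //= /h /=; case: (c 0 i =P 0) => [->|/eqP ci].
  rewrite !hat_0 //= normr0 normr1 expr0 !mulr1 !mulr0 !add0r !addr0.
  by rewrite addrC lexx.
rewrite !hat_n0 //= !mul1r !mul0r !add0r !addr0 normr0 normrM.
by rewrite le_eqVlt; apply/orP; left; apply/eqP; ring.
Qed.

End Gram.

(** Double counting of the incidences [i \in U], with [T = U :\ i]. *)
Lemma sum_setU1 (R : nmodType) N (f : {set 'I_N} -> 'I_N -> R) k :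
  \sum_(T : {set 'I_N} | #|T| == k) \sum_(i | i \notin T) f (i |: T) i =
  \sum_(U : {set 'I_N} | #|U| == k.+1) \sum_(i in U) f U i.
Proof.
rewrite (exchange_big_dep xpredT) //= [RHS](exchange_big_dep xpredT) //=.
apply: eq_bigr => i _.
rewrite [RHS](reindex_onto (fun T => i |: T) (fun U => U :\ i)) /=; last first.
  by move=> U /andP[_ iU]; exact: finset.setD1K.
apply: eq_bigl => T; rewrite finset.setU11 andbT cardsU1.
case: (boolP (i \in T)) => [iT|iT] /=; last by rewrite finset.setU1K // eqxx !andbT;
    apply/idP/idP; lia.
rewrite andbF; symmetry; apply/negbTE/negP => /andP[_ /eqP/setP/(_ i)].
by rewrite !inE eqxx /= iT.
Qed.

(** Multiplication by [v i] adds [i] to [T] if it is absent; otherwise [v i ^+ 2 = 1 + kap * v i]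
    removes or keeps it. A set of size [k.+2] arises in [k.+2] ways, one of size [k] in [N - k]
    ways. *)
Lemma elem_sym_rec (R : comNzRingType) N (v : 'I_N -> R) (kap : R) k :
  (forall i, v i ^+ 2 = 1 + kap * v i) ->
  (\sum_i v i) * elem_sym v k.+1 =
    k.+2%:R * elem_sym v k.+2 + kap * k.+1%:R * elem_sym v k.+1 + (N - k)%:R * elem_sym v k.
Proof.
move=> v2; rewrite {1}/elem_sym mulr_sumr.
rewrite (eq_bigr (fun T : {set 'I_N} => \sum_(i | i \notin T) \prod_(l in i |: T) v l
   + \sum_(i in T) (\prod_(l in T :\ i) v l + kap * \prod_(l in T) v l))); last first.
  move=> T _; rewrite mulr_suml (bigID [in T]) /= addrC; congr (_ + _).
    by apply: eq_bigr => i iT; rewrite big_setU1.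
  apply: eq_bigr => i iT; rewrite (big_setD1 i iT) /= mulrA -expr2 v2.
  by rewrite mulrDl mul1r mulrA.
rewrite big_split /= -addrA; congr (_ + _).
  rewrite (sum_setU1 (fun T _ => \prod_(l in T) v l)) /elem_sym mulr_sumr.
  by apply: eq_bigr => U /eqP Uk; rewrite sumr_const Uk mulr_natl.
under eq_bigr do rewrite big_split /=.
rewrite big_split /= addrC; congr (_ + _).
  rewrite /elem_sym mulr_sumr; apply: eq_bigr => U /eqP Uk.
  by rewrite sumr_const Uk mulrAC mulr_natr.
rewrite -(sum_setU1 (fun T i => \prod_(l in T :\ i) v l)) /elem_sym mulr_sumr.
apply: eq_bigr => U /eqP Uk.
rewrite [LHS](eq_bigr (fun=> \prod_(l in U) v l)) => [|i iU];
    last by rewrite /= finset.setU1K.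
rewrite (eq_bigl [in ~: U]) => [|i]; last by rewrite inE.
rewrite sumr_const -[LHS]mulr_natl; congr (_%:R * _).
by have := cardsC U; rewrite card_ord Uk; lia.
Qed.

(** * Fourier coefficients of a set of residues *)

Section Dirichlet.
Variable R : realType.

Lemma sum_cos_arith (x h : R) k :
  (\sum_(j < k) cos (x + 2 * h * j%:R)) * sin h =
  cos (x + (k%:R - 1) * h) * sin (k%:R * h).
Proof.
have prodE a b : 2 * (cos a * sin b) = sin (a + b) - sin (a - b) :> R.
  by rewrite sinD sinB; ring.
have two0 : 2 != 0 :> R by rewrite pnatr_eq0.
apply: (mulfI two0); rewrite prodE.
have -> : x + (k%:R - 1) * h + k%:R * h = x + 2 * h * k%:R - h by ring.
have -> : x + (k%:R - 1) * h - k%:R * h = x - h by ring.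
elim: k => [|k IH]; first by rewrite big_ord0 mul0r !mulr0 addr0 subrr.
rewrite big_ord_recr /= (mulrDl _ _ (sin h)) (mulrDr 2) {}IH prodE.
have -> : x + 2 * h * k.+1%:R - h = x + 2 * h * k%:R + h by rewrite -natr1; ring.
by ring.
Qed.

Lemma cosDnpi (x : R) n : cos (x + 2 * pi * n%:R) = cos x.
Proof.
have -> : 2 * pi * n%:R = (pi *+ 2) *+ n :> R
    by rewrite -mulr_natl -[RHS]mulr_natr mulrC; ring.
exact: periodicn (@cosD2pi R) n x.
Qed.

Lemma cos_ge_near (a y : R) : 0 <= a <= pi -> - a <= y <= a -> cos a <= cos y.
Proof.
move=> /andP[a0 api] /andP[ya yb].
wlog y0 : y ya yb / 0 <= y.
  move=> H; have [/H->//|y0] := leP 0 y; rewrite -(cosN y); apply: H; lra.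
by rewrite leNgt ltr_cos ?in_itv /=; [lra|lra|lra].
Qed.

Lemma cos_le_far (a y : R) : 0 <= a <= pi -> a <= y <= 2 * pi - a -> cos y <= cos a.
Proof.
move=> /andP[a0 api] /andP[ya yb].
have [yp|yp] := leP y pi.
  by rewrite leNgt ltr_cos ?in_itv /=; [lra|lra|lra].
have -> : cos y = cos (2 * pi - y).
  by rewrite -[LHS]cosN -(cosDnpi (- y) 1) mulr1 addrC.
by rewrite leNgt ltr_cos ?in_itv /=; [lra|lra|lra].
Qed.

(* Comparing each cosine with the threshold cos (pi k / q.+2), k = #|S|, shows that
   an arc of k consecutive residues is extremal. *)
Lemma sum_cos_set q (S : {set 'I_q.+2}) (phi : R) :
  (\sum_(s in S) cos (2 * (pi / q.+2%:R) * s%:R - phi)) * sin (pi / q.+2%:R)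
    <= sin (#|S|%:R * (pi / q.+2%:R)).
Proof.
set h := pi / q.+2%:R; set k := #|S|.
have P0 : 0 < q.+2%:R :> R by rewrite ltr0n.
have hP : h * q.+2%:R = pi by rewrite divfK ?gt_eqF.
have h0 : 0 < h by rewrite divr_gt0 ?pi_gt0.
have leq_k : (k <= q.+2)%N by rewrite -[q.+2 in leqRHS]card_ord max_card.
have kP : k%:R <= q.+2%:R :> R by rewrite ler_nat.
have k0 : 0 <= k%:R :> R by rewrite ler0n.
pose M := (Num.bound `|phi|).+2.
(* Whole turns are added to the phase so that [u] below is nonnegative and can be truncated. *)
pose phi' := phi + 2 * pi * M%:R.
have [pi2 pi4] : 2 <= pi :> R /\ pi <= 4 :> R by split;
    [exact: pi_ge2|have := pihalf_lt2 R; lra].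
have phi'_ge : pi <= phi'.
  have lb : `|phi| < M%:R - 2.
    rewrite /M -addn2 natrD addrK; exact: archi_boundP.
  have := ler_norm (- phi); rewrite normrN => lb'.
  have := normr_ge0 phi; move: lb; rewrite /phi'; set m := M%:R => lb nphi.
  have : 2 * m <= pi * m by rewrite ler_wpM2r //; lra.
  lra.
pose G (x : nat) : R := cos (2 * h * x%:R - phi').
have GE x : G x = cos (2 * h * x%:R - phi).
  rewrite -[RHS](cosDnpi _ 0) /G /phi' mulr0 addr0.
  by rewrite -(cosDnpi (2 * h * x%:R - (phi + 2 * pi * M%:R)) M); congr cos; ring.
have Gmod x : G (x %% q.+2)%N = G x.
  rewrite !GE {2}(divn_eq x q.+2) natrD natrM.
  rewrite -(cosDnpi (2 * h * (x %% q.+2)%N%:R - phi) (x %/ q.+2)%N) -hP; congr cos; ring.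
under eq_bigr do rewrite -GE.
pose T := cos (k%:R * h).
(* [G x >= T] on the arc [u <= x <= u + k]. As [j0] is the first integer beyond [u], the integers
   [j0, ..., j0 + k - 1] lie on this arc and the rest of the period lies on the complementary
   one. *)
pose u := phi' / (2 * h) - k%:R / 2.
have u2h : u * (2 * h) = phi' - k%:R * h.
  by rewrite /u; field; rewrite gt_eqF.
have u0 : 0 <= u by rewrite -(pmulr_lge0 _ (_ : 0 < 2 * h)) ?u2h; nra.
pose j0 := (Num.trunc u).+1.
have /andP[uj1 uj2] := truncn_itv u0; rewrite -natr1 in uj2.
have j0E : j0%:R = (Num.trunc u)%:R + 1 :> R by rewrite natr1.
have kh_pi : 0 <= k%:R * h <= pi by nra.
have near (j : nat) : (j < k)%N -> T <= G (j0 + j).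
  move=> ltjk; apply: cos_ge_near => //; rewrite natrD j0E.
  have : j%:R + 1 <= k%:R :> R by rewrite natr1 ler_nat.
  have := ler0n R j.
  move: uj1 uj2 u2h; set t := (Num.trunc u)%:R; nra.
have far (j : nat) : (k <= j < q.+2)%N -> G (j0 + j) <= T.
  move=> /andP[lekj ltj]; apply: cos_le_far => //; rewrite natrD j0E.
  have : j%:R + 1 <= q.+2%:R :> R by rewrite natr1 ler_nat.
  have : k%:R <= j%:R :> R by rewrite ler_nat.
  move: uj1 uj2 u2h hP; set t := (Num.trunc u)%:R; set Q := q.+2%:R; nra.
have step1 : \sum_(s in S) G s <= k%:R * T + \sum_(s < q.+2) Num.max 0 (G s - T).
  apply: (@le_trans _ _ (\sum_(s in S) (T + Num.max 0 (G s - T)))).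
    by apply: ler_sum => s _; rewrite -lerBlDl le_max lexx orbT.
  rewrite big_split /= sumr_const mulr_natl lerD2l big_mkcond /=.
  by apply: ler_sum => s _; case: ifP => // _; rewrite le_max lexx.
have step2 : \sum_(s < q.+2) Num.max 0 (G s - T) = \sum_(j < k) (G (j0 + j) - T).
  rewrite (reindex_inj (addrI (inZp j0 : 'I_q.+2))) /=.
  rewrite (big_ord_widen _ (fun j => G (j0 + j) - T) leq_k) [RHS]big_mkcond /=.
  apply: eq_bigr => j _; rewrite Gmod -Gmod modnDml Gmod.
  case: ltnP => [/near|lekj]; first by move=> H; rewrite max_r ?subr_ge0.
  by rewrite max_l // subr_le0 far // lekj ltn_ord.
rewrite {}step2 sumrB sumr_const card_ord mulr_natl addrC subrK in step1.
have sinh0 : 0 <= sin h.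
  apply: sin_ge0_pi; rewrite (ltW h0) /= -hP ler_peMr ?(ltW h0) //.
  by rewrite ler1n.
apply: le_trans (ler_wpM2r sinh0 step1) _.
rewrite (eq_bigr (fun j : 'I_k => cos (2 * h * j0%:R - phi' + 2 * h * j%:R))); last first.
  by move=> j _; rewrite /G natrD; congr cos; ring.
rewrite sum_cos_arith ler_piMl ?cos_le1 //; exact: sin_ge0_pi.
Qed.

End Dirichlet.

Section FpCharacter.
Variables (R : realType) (p : nat).
Hypothesis p_pr : prime p.

Definition expFp (a : 'F_p) : R[i] :=
  (cos (2 * (pi / p%:R) * (nat_of_ord a)%:R) +i* sin (2 * (pi / p%:R) *
      (nat_of_ord a)%:R))%C.

Let p_gt0 : 0 < p%:R :> R.
Proof. by rewrite ltr0n prime_gt0. Qed.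

Lemma sinDnpi (x : R) n : sin (x + 2 * pi * n%:R) = sin x.
Proof.
have -> : 2 * pi * n%:R = (pi *+ 2) *+ n :> R
    by rewrite -mulr_natl -[RHS]mulr_natr mulrC; ring.
exact: periodicn (@sinD2pi R) n x.
Qed.

Let modE (x : nat) : 2 * (pi / p%:R) * x%:R =
  2 * (pi / p%:R) * (x %% p)%N%:R + 2 * pi * (x %/ p)%N%:R :> R.
Proof. by rewrite {1}(divn_eq x p) natrD natrM; field; rewrite gt_eqF. Qed.

Lemma expFp_mod (x : nat) :
  (cos (2 * (pi / p%:R) * x%:R) +i* sin (2 * (pi / p%:R) * x%:R))%C = expFp x%:R.
Proof. by rewrite /expFp val_Fp_nat // modE cosDnpi sinDnpi. Qed.

Lemma expFpD : {morph expFp : a b / a + b >-> a * b}.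
Proof.
move=> a b; rewrite -[a]natr_Zp -[b]natr_Zp -natrD -!expFp_mod natrD mulrDr.
by rewrite cosD sinD; apply/eqP; rewrite eq_complex /= !eqxx addrC mulrC eqxx.
Qed.

Lemma normc_expFp a : `|expFp a| = 1.
Proof. by rewrite normc_def /= cos2Dsin2 sqrtr1. Qed.

Lemma expFp0 : expFp 0 = 1.
Proof. by rewrite /expFp /= mulr0 cos0 sin0. Qed.

Lemma expFp_neq1 a : a != 0 -> expFp a != 1.
Proof.
move=> a0; apply/eqP=> /(congr1 (@complex.Re R)) /=.
set h := pi / p%:R; set x : R := (nat_of_ord a)%:R.
have x0 : 0 < x by rewrite ltr0n lt0n.
have xp : x < p%:R by rewrite ltr_nat -[p in leqRHS](Fp_cast p_pr) ltn_ord.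
have hp : h * p%:R = pi by rewrite divfK ?gt_eqF.
have h0 : 0 < h by rewrite divr_gt0 ?pi_gt0.
have s0 : 0 < sin (h * x).
  by apply: sin_gt0_pi; rewrite mulr_gt0 //= -hp ltr_pM2l.
have -> : 2 * h * x = h * x + h * x by ring.
rewrite cosD => c1; have := cos2Dsin2 (h * x); nra.
Qed.

Lemma expFp_character : is_character expFp.
Proof.
split; [exact: expFp0|exact: expFpD| |].
- move=> a; have uJ : expFp a * (expFp a)^* = 1 by rewrite -normCK normc_expFp expr1n.
  have uN : expFp a * expFp (- a) = 1 by rewrite -expFpD subrr expFp0.
  have u0 : expFp a != 0 by rewrite -normr_eq0 normc_expFp oner_eq0.
  by apply: (mulfI u0); rewrite uJ uN.
- move=> a a0; set s := \sum_y _.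
  have : expFp a * s = s.
    rewrite mulr_sumr [RHS](reindex_inj (addIr 1)) /=.
    by apply: eq_bigr => y _; rewrite -expFpD mulrDr mulr1 addrC.
  move=> /eqP; rewrite -subr_eq0 -{2}[s]mul1r -mulrBl mulf_eq0 subr_eq0.
  by rewrite (negbTE (expFp_neq1 a0)) /= => /eqP.
Qed.

(** The modulus of [Z] equals [cos phi * Re Z + sin phi * Im Z] for [phi] the argument of [Z], and
    [sum_cos_set] is uniform in [phi]. *)
Lemma normc_sum_expFp (S : {set 'F_p}) :
  `|\sum_(s in S) expFp s| <= (sin (#|S|%:R * (pi / p%:R)) / sin (pi / p%:R))%:C%C.
Proof.
have h0 : 0 < pi / p%:R :> R by rewrite divr_gt0 ?pi_gt0.
have sin_gt0 : 0 < sin (pi / p%:R) :> R.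
  apply: sin_gt0_pi; rewrite h0 ltr_pdivrMr // ltr_pMr ?pi_gt0 //.
  by rewrite ltr1n prime_gt1.
set Z := \sum_(s in S) _.
have ReZ : complex.Re Z = \sum_(s in S) cos (2 * (pi / p%:R) * (nat_of_ord s)%:R).
  by rewrite /Z (raddf_sum (@complex.Re R)).
have ImZ : complex.Im Z = \sum_(s in S) sin (2 * (pi / p%:R) * (nat_of_ord s)%:R).
  by rewrite /Z (raddf_sum (@complex.Im R)).
have key phi : cos phi * complex.Re Z + sin phi * complex.Im Z <=
    sin (#|S|%:R * (pi / p%:R)) / sin (pi / p%:R).
  rewrite ler_pdivlMr //.
  have := sum_cos_set (q := Zp_trunc (pdiv p)) S phi.
  have -> : (Zp_trunc (pdiv p)).+2%:R = p%:R :> R by rewrite (Fp_cast p_pr).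
  apply: le_trans.
  rewrite ler_pM2r // ReZ ImZ !mulr_sumr -big_split /= le_eqVlt.
  apply/orP; left; apply/eqP; apply: eq_bigr => s _; rewrite cosB; ring.
rewrite normc_def lecR; set r := Num.sqrt _.
have r2 : r ^+ 2 = complex.Re Z ^+ 2 + complex.Im Z ^+ 2.
  by rewrite sqr_sqrtr // addr_ge0 ?sqr_ge0.
have r_ge0 : 0 <= r by exact: sqrtr_ge0.
move: r2 r_ge0 key; move: (complex.Re Z) (complex.Im Z) => a b r2.
rewrite le_eqVlt => /predU1P[<- key|r0 key].
  rewrite ler_pdivlMr // mul0r; apply: sin_ge0_pi; apply/andP; split.
    by rewrite mulr_ge0 ?ler0n // ltW.
  rewrite mulrA ler_pdivrMr // mulrC ler_pM2l ?pi_gt0 // ler_nat.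
  by rewrite -[p in leqRHS](Fp_cast p_pr) -[leqRHS]card_ord max_card.
have [phi [ca sb]] : exists phi : R, cos phi = a / r /\ sin phi = b / r.
  have ar : (a / r) ^+ 2 + (b / r) ^+ 2 = 1.
    by rewrite !expr_div_n -mulrDl -r2 divff // gt_eqF // exprn_gt0.
  have lea : -1 <= a / r <= 1 by nra.
  have [_ ac] := acos_def lea.
  have sq : Num.sqrt (1 - (a / r) ^+ 2) = `|b / r|.
    by rewrite -ar addrC addKr sqrtr_sqr.
  have [b0|b0] := leP 0 (b / r).
    by exists (acos (a / r)); rewrite ac sin_acos // sq ger0_norm.
  exists (- acos (a / r)); rewrite cosN sinN ac sin_acos // sq ltr0_norm //.
  by rewrite opprK.
apply: le_trans (key phi); rewrite ca sb.
have -> : a / r * a + b / r * b = (a ^+ 2 + b ^+ 2) / r by ring.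
by rewrite -r2 expr2 mulfK // gt_eqF.
Qed.

End FpCharacter.

(** * Normalized indicators and their Fourier coefficients *)

Section NormalizedIndicator.
Variables (R : realType) (p : nat) (rho : R).
Hypotheses (p_pr : prime p) (rho01 : 0 < rho < 1).

Definition std_dev : R := Num.sqrt (rho * (1 - rho)).

Definition indic (S : {set 'F_p}) (y : 'F_p) : R := ((y \in S)%:R - rho) / std_dev.

(** The norm on [R[i]] takes its values in [R[i]]; [complex.Re] brings it back to [R]. *)
Definition indic_hat (S : {set 'F_p}) (v : 'F_p) : R :=
  complex.Re `|fourier (@expFp R p) (fun y => (indic S y)%:C%C) v|.

Let var_gt0 : 0 < rho * (1 - rho).
Proof. by case/andP: rho01 => ? ?; rewrite mulr_gt0 // subr_gt0. Qed.

Lemma std_dev_gt0 : 0 < std_dev.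
Proof. by rewrite sqrtr_gt0. Qed.

Lemma std_dev_sq : std_dev ^+ 2 = rho * (1 - rho).
Proof. by rewrite sqr_sqrtr // ltW. Qed.

Let p_gt0 : 0 < p%:R :> R.
Proof. by rewrite ltr0n prime_gt0. Qed.

Let chiP := expFp_character R p_pr.

Lemma indic_hatE S v :
  `|fourier (@expFp R p) (fun y => (indic S y)%:C%C) v| = (indic_hat S v)%:C%C.
Proof. by rewrite /indic_hat normc_def. Qed.

Lemma indic_hat_ge0 S v : 0 <= indic_hat S v.
Proof. by rewrite -lecR -indic_hatE normr_ge0. Qed.

Lemma indic_sq S y :
  indic S y ^+ 2 = 1 + (1 - 2 * rho) / std_dev * indic S y.
Proof.
have s0 := std_dev_gt0; have s2 := std_dev_sq.
rewrite /indic; apply: (mulIf (lt0r_neq0 (exprn_gt0 2 s0))).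
have -> : (((y \in S)%:R - rho) / std_dev) ^+ 2 * std_dev ^+ 2 = ((y \in S)%:R - rho) ^+ 2.
  by field; rewrite gt_eqF.
have -> : (1 + (1 - 2 * rho) / std_dev * (((y \in S)%:R - rho) / std_dev)) * std_dev ^+ 2
   = std_dev ^+ 2 + (1 - 2 * rho) * ((y \in S)%:R - rho) by field; rewrite gt_eqF.
by rewrite s2; case: (y \in S) => /=; ring.
Qed.

Section Cardinal.
Variable S : {set 'F_p}.
Hypothesis cardS : #|S|%:R = rho * p%:R.

Lemma indic_mean : \sum_y indic S y = 0.
Proof.
rewrite /indic -mulr_suml sumrB sumr_const card_Fp //.
have -> : \sum_(y : 'F_p) (y \in S)%:R = #|S|%:R :> R.
  by rewrite -natr_sum -sum1_card [in RHS]big_mkcond.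
by rewrite cardS mulr_natr subrr mul0r.
Qed.

Lemma sum_indic_hat_sq : \sum_(v | v != 0) indic_hat S v ^+ 2 <= 1.
Proof.
have H := Parseval chiP (fun y => (indic S y)%:C%C).
apply: (@le_trans _ _ (\sum_v indic_hat S v ^+ 2)).
  by rewrite [leRHS](bigD1 0) //= lerDr sqr_ge0.
rewrite le_eqVlt; apply/orP; left; apply/eqP.
apply: (fmorph_inj (real_complex R)) => /=.
rewrite rmorph_sum rmorph1 /=.
under eq_bigr do rewrite rmorphXn /= -indic_hatE.
rewrite H card_Fp //.
have -> : \sum_y `|(indic S y)%:C%C| ^+ 2 = (\sum_y indic S y ^+ 2)%:C%C.
  rewrite rmorph_sum /=; apply: eq_bigr => y _.
  by rewrite normc_def /= expr0n addr0 sqrtr_sqr -rmorphXn /= real_normK ?num_real.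
under [X in real_complex R X]eq_bigr do rewrite indic_sq.
rewrite big_split /= -mulr_sumr indic_mean mulr0 addr0 sumr_const card_Fp //.
by rewrite rmorph_nat mulVf // pnatr_eq0 -lt0n prime_gt0.
Qed.

Let hat_sum v : v != 0 -> indic_hat S v =
  complex.Re `|\sum_(s in S) expFp R (- (v * s))| / (p%:R * std_dev).
Proof.
move=> v0; rewrite /indic_hat.
have -> : fourier (@expFp R p) (fun y => (indic S y)%:C%C) v =
   ((p%:R * std_dev)^-1)%:C%C * \sum_(s in S) expFp R (- (v * s)).
  rewrite /fourier card_Fp // invfM rmorphM /= fmorphV rmorph_nat -mulrA; congr (_ * _).
  rewrite (eq_bigr (fun y => (std_dev^-1)%:C%C * ((y \in S)%:R * expFp R (- (v * y))) -
     (rho / std_dev)%:C%C * expFp R (- (v * y)))); last first.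
    move=> y _; rewrite /indic mulrBl rmorphB /= !rmorphM rmorph_nat /=; ring.
  rewrite sumrB -!mulr_sumr [X in _ - _ * X](eq_bigr (fun y => expFp R (- v * y)));
      last first.
    by move=> y _; rewrite mulNr.
  rewrite (character_sum chiP) oppr_eq0 (negbTE v0) mul0r mulr0 subr0; congr (_ * _).
  rewrite [RHS]big_mkcond; apply: eq_bigr => y _.
  by case: (y \in S); rewrite ?mul1r ?mul0r.
rewrite normrM normc_def /= expr0n addr0 sqrtr_sqr ger0_norm; last first.
  by rewrite invr_ge0 mulr_ge0 ?ltW // std_dev_gt0.
by rewrite [RHS]mulrC mul0r subr0.
Qed.

Let normRe_le (z : R[i]) b : `|z| <= b%:C%C -> complex.Re `|z| <= b.
Proof. by rewrite normc_def /= lecR. Qed.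

Lemma indic_hat_le_rho v : v != 0 -> indic_hat S v <= rho / std_dev.
Proof.
move=> v0; rewrite hat_sum // invfM mulrA ler_pM2r ?invr_gt0 ?std_dev_gt0 //.
rewrite ler_pdivrMr //; apply: normRe_le.
apply: le_trans (ler_norm_sum _ _ _) _.
under eq_bigr do rewrite (normc_expFp R).
by rewrite sumr_const -cardS (rmorph_nat (real_complex R)).
Qed.

(** The full character sum vanishes, so the sum over [S] is minus the sum over its complement. *)
Lemma indic_hat_le_rhoC v : v != 0 -> indic_hat S v <= (1 - rho) / std_dev.
Proof.
move=> v0; rewrite hat_sum // invfM mulrA ler_pM2r ?invr_gt0 ?std_dev_gt0 //.
rewrite ler_pdivrMr //; apply: normRe_le.
have : \sum_y expFp R (- v * y) = 0.
  by rewrite (character_sum chiP) oppr_eq0 (negbTE v0) mul0r.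
rewrite (bigID [in S]) /= => /eqP; rewrite addr_eq0 => /eqP sS.
rewrite (eq_bigr (fun s => expFp R (- v * s))); last by move=> *; rewrite mulNr.
rewrite sS normrN; apply: le_trans (ler_norm_sum _ _ _) _.
under eq_bigr do rewrite (normc_expFp R).
rewrite (eq_bigl [in ~: S]); last by move=> i; rewrite inE.
rewrite sumr_const -(rmorph_nat (real_complex R) #|~: S|) lecR mulrBl mul1r -cardS.
have : (#|S| + #|~: S|)%:R = p%:R :> R by rewrite cardsC card_Fp.
by rewrite natrD => <-; rewrite addrC addKr.
Qed.

(** Multiplication by [- v] permutes the residues, so the coefficient at [v] comes from the plain
    character sum over another set of the same size. *)
Lemma indic_hat_le_sin v : v != 0 ->
  indic_hat S v <= sin (rho * pi) / (p%:R * sin (pi / p%:R) * std_dev).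
Proof.
move=> v0; rewrite hat_sum //.
have -> : sin (rho * pi) / (p%:R * sin (pi / p%:R) * std_dev) =
    (sin (#|S|%:R * (pi / p%:R)) / sin (pi / p%:R)) / (p%:R * std_dev).
  rewrite cardS (_ : rho * p%:R * (pi / p%:R) = rho * pi); last by field; rewrite gt_eqF.
  by rewrite !invfM; ring.
rewrite ler_pM2r ?invr_gt0 ?mulr_gt0 ?std_dev_gt0 //; apply: normRe_le.
have inj : injective (fun s : 'F_p => - (v * s)).
  by move=> a b /oppr_inj /(mulfI v0).
rewrite -(card_imset S inj) -(big_imset (expFp R (p := p))) /=; last by move=> a b _ _;
    exact: inj.
exact: normc_sum_expFp.
Qed.

End Cardinal.

Variables (N n : nat) (B : 'M['F_p]_(N, n)) (S : 'I_N -> {set 'F_p}).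
Hypothesis cardS : forall i, #|S i|%:R = rho * p%:R.

Definition indic_vec (x : 'cV['F_p]_n) (i : 'I_N) : R := indic (S i) ((B *m x) i 0).

Lemma indic_Gram (w : R) j k : 0 < w ->
  `| p%:R ^- n * (\sum_x elem_sym (indic_vec x) j * elem_sym (indic_vec x) k)
     - (j == k)%:R * 'C(N, k)%:R |
  <= w ^- (j + k) * \sum_(c : 'rV['F_p]_N | (c *m B == 0) && (c != 0))
       \prod_i (if c 0 i == 0 then 1 + w ^+ 2
                else (2 * w + `|1 - 2 * rho| / std_dev * w ^+ 2) * indic_hat (S i) (c 0 i)).
Proof.
move=> w0.
pose kap : R[i] := ((1 - 2 * rho) / std_dev)%:C%C.
pose g i y : R[i] := (indic (S i) y)%:C%C.
have g_mean i : \sum_y g i y = 0.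
  by rewrite -(rmorph_sum (real_complex R)) indic_mean // rmorph0.
have g_sq i y : g i y ^+ 2 = 1 + kap * g i y.
  by rewrite /g /kap -rmorphXn indic_sq rmorphD rmorph1 rmorphM.
have w0' : 0 < w%:C%C by rewrite ltcR.
have := elem_sym_Gram chiP B g_mean g_sq j k w0'.
rewrite -lecR; congr (is_true (_ <= _)).
  rewrite card_Fp //.
  have elem_symE x l : elem_sym (fun i => g i ((B *m x) i 0)) l = (elem_sym (indic_vec x) l)%:C%C.
    rewrite /elem_sym rmorph_sum; apply: eq_bigr => T _; rewrite rmorph_prod;
        apply: eq_bigr => i _.
    by [].
  have -> : p%:R ^- n * (\sum_(x : 'cV['F_p]_n) elem_sym (fun i =>
      g i ((B *m x) i 0)) j * elem_sym (fun i => g i ((B *m x) i 0)) k)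
     - (j == k)%:R * 'C(N, k)%:R =
   (p%:R ^- n * (\sum_x elem_sym (indic_vec x) j * elem_sym (indic_vec x) k)
     - (j == k)%:R * 'C(N, k)%:R)%:C%C.
    rewrite rmorphB !rmorphM fmorphV rmorphXn /= !rmorph_nat rmorph_sum; congr (_ * _ - _).
    by apply: eq_bigr => x _; rewrite !elem_symE rmorphM.
  by rewrite normc_def /= expr0n addr0 sqrtr_sqr.
rewrite rmorphM fmorphV rmorphXn rmorph_sum; congr (_ * _); apply: eq_bigr => c _.
rewrite rmorph_prod; apply: eq_bigr => i _; case: ifP => _.
  by rewrite rmorphD rmorph1 rmorphXn.
rewrite indic_hatE rmorphM rmorphD !rmorphM rmorph_nat; congr ((_ + _ * _) * _).
rewrite normc_def /= expr0n addr0 sqrtr_sqr normrM normfV (ger0_norm (ltW std_dev_gt0)).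
by rewrite rmorphM.
Qed.

End NormalizedIndicator.

Local Open Scope classical_set_scope.
Local Open Scope ring_scope.

(** * The error exponent *)

Section Entropy.
Variable R : realType.
Implicit Types x y w : R.

Lemma entropy_ratio x y : 0 <= x -> 0 < y ->
  entropy (x / (x + y)) = ln (x + y) - (x * ln x + y * ln y) / (x + y).
Proof.
move=> x0 y0; have s0 : 0 < x + y by rewrite ltr_wpDl.
have s_neq0 : x + y != 0 by rewrite gt_eqF.
rewrite /entropy.
have -> : 1 - x / (x + y) = y / (x + y) by field.
rewrite (ln_div (x := y)) ?posrE //.
move: x0; rewrite le_eqVlt => /predU1P[<-|x0].
  by rewrite !mul0r oppr0 mul0r !add0r; field; rewrite gt_eqF.
by rewrite ln_div ?posrE //; field.
Qed.

Lemma ln_le_sub1 x : 0 < x -> ln x <= x - 1.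
Proof.
move=> x0; rewrite -{1}(subrK 1 x) addrC; apply: le_ln1Dx; lra.
Qed.

(* Gibbs' inequality against the distribution (y / (1 + y), 1 / (1 + y)). *)
Lemma entropy_le x y : 0 < x < 1 -> 0 < y -> entropy x <= ln (1 + y) - x * ln y.
Proof.
move=> /andP[x0 x1] y0; have x10 : 0 < 1 - x by lra.
have y1 : 0 < 1 + y by lra.
have h1 := ln_le_sub1 (divr_gt0 (divr_gt0 y0 y1) x0).
have h2 := ln_le_sub1 (divr_gt0 (divr_gt0 ltr01 y1) x10).
rewrite !ln_div ?posrE ?divr_gt0 // ln1 in h1 h2.
have k1 : x * (ln y - ln (1 + y) - ln x) <= y / (1 + y) - x.
  have -> : y / (1 + y) - x = x * (y / (1 + y) / x - 1) by field; rewrite !gt_eqF.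
  by rewrite ler_pM2l.
have k2 : (1 - x) * (0 - ln (1 + y) - ln (1 - x)) <= 1 / (1 + y) - (1 - x).
  have -> : 1 / (1 + y) - (1 - x) = (1 - x) * (1 / (1 + y) / (1 - x) - 1).
    by field; rewrite !gt_eqF.
  by rewrite ler_pM2l.
have e : y / (1 + y) + 1 / (1 + y) = 1 by field; rewrite gt_eqF.
rewrite /entropy; nra.
Qed.

End Entropy.

Section ErrorExponent.
Variables (R : realType) (rho mu : R).
Hypotheses (rho01 : 0 < rho < 1) (mu01 : 0 <= 2 * mu < 1).

Definition kappa : R := `|1 - 2 * rho| / Num.sqrt (rho * (1 - rho)).

Lemma kappa_ge0 : 0 <= kappa.
Proof. by rewrite divr_ge0 ?sqrtr_ge0. Qed.

(* Stationary point of the maximization over gamma, parametrized by w = sqrt z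
   where z is the dual variable. *)
Definition delta_of (w : R) : R :=
  mu * (kappa * w / (kappa * w + 2)) + (1 - 2 * mu) * (w ^+ 2 / (w ^+ 2 + 1)).

(* Lagrange dual of the maximization over gamma. For w = 0 the junk value
   ln 0 = 0 is harmless, as delta_of 0 = 0. *)
Definition dual_exponent (delta w : R) : R :=
  2 * mu * ln (2 + kappa * w) + (1 - 2 * mu) * ln (1 + w ^+ 2)
  - 2 * delta * ln w - entropy (mu + delta).

(** The supremum is at least the objective at the stationary point [g], where it coincides with the
    dual function. Through this inequality the negativity of [E + F] passes to [dual_exponent]. *)
Lemma E_term_ge (w : R) : 0 <= w ->
  ((dual_exponent (delta_of w) w)%:E <= E_term rho mu (delta_of w))%E.
Proof.
move=> w0; have k0 := kappa_ge0; have /andP[mu0 mu1] := mu01.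
have kw0 : 0 <= kappa * w by rewrite mulr_ge0.
have kw2 : 0 < kappa * w + 2 by lra.
have w21 : 0 < w ^+ 2 + 1 by have := sqr_ge0 w; lra.
have nkw2 : kappa * w + 2 != 0 by rewrite gt_eqF.
have nw21 : w ^+ 2 + 1 != 0 by rewrite gt_eqF.
have n2 : 2 != 0 :> R by rewrite pnatr_eq0.
have n12mu : 1 - 2 * mu != 0 by rewrite gt_eqF //; lra.
set delta := delta_of w.
pose g := 2 * mu * (kappa * w / (kappa * w + 2)).
have ug : (delta - g / 2) / (1 - 2 * mu) = w ^+ 2 / (w ^+ 2 + 1).
  by rewrite /delta /delta_of /g; field; rewrite ?n2 ?nkw2 ?nw21 ?n12mu.
have g_range : gamma_range mu delta g.
  split; rewrite /ratio01.
    case: eqP => [mu_0|/eqP mu_n0]; first by rewrite /g mu_0 mul0r.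
    rewrite /g mulrAC divff // mul1r divr_ge0 ?(ltW kw2) //= ler_pdivrMr //; lra.
  rewrite (negbTE n12mu) ug divr_ge0 ?sqr_ge0 ?(ltW w21) //= ler_pdivrMr //.
  by have := sqr_ge0 w; lra.
have Hg : 2 * mu * entropy (g / (2 * mu)) =
    2 * mu * (ln (kappa * w + 2) - (kappa * w * ln (kappa * w) + 2 * ln 2) / (kappa * w +
        2)).
  have [->|mu_n0] := eqVneq (2 * mu) 0; first by rewrite !mul0r.
  have -> : g / (2 * mu) = kappa * w / (kappa * w + 2) by rewrite /g mulrAC divff // mul1r.
  by rewrite entropy_ratio.
have Hu : entropy ((delta - g / 2) / (1 - 2 * mu)) =
    ln (w ^+ 2 + 1) - (w ^+ 2 * ln (w ^+ 2)) / (w ^+ 2 + 1).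
  by rewrite ug entropy_ratio ?sqr_ge0 // ln1 mulr0 addr0.
have lnw2 : w ^+ 2 * ln (w ^+ 2) = 2 * w ^+ 2 * ln w.
  move: w0; rewrite le_eqVlt => /predU1P[<-|w_gt0]; first by rewrite expr0n !mulr0 !mul0r.
  by rewrite lnXn // mulr2n; ring.
have gE : g * (kappa * w + 2) = 2 * mu * (kappa * w) by rewrite /g; field.
pose lk := ln (kappa / 2).
have obj : E_objective rho mu delta g =
  (g * lk + (2 * mu * entropy (g / (2 * mu)) +
      (1 - 2 * mu) * entropy ((delta - g / 2) / (1 - 2 * mu))))%:E.
  rewrite /E_objective [RHS]EFinD; congr (_ + _)%E.
  have -> : `|1 - 2 * rho| / (2 * Num.sqrt (rho * (1 - rho))) = kappa / 2.
    by rewrite /kappa invfM -[RHS]mulrA [in RHS](mulrC _ 2^-1).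
  (* [kappa = 0] means [rho = 1/2]: the extended logarithm is -oo, but the stationary [g] is 0. *)
  have [k_0|k_n0] := eqVneq kappa 0.
    by rewrite /g k_0 !mul0r mulr0 mul0r mul0e.
  by rewrite lne_EFin ?EFinM // divr_gt0 // lt0r k_n0 k0.
have main : dual_exponent delta w = 2 * mu * ln 2 - entropy (mu + delta) +
  (g * lk + (2 * mu * entropy (g / (2 * mu)) +
      (1 - 2 * mu) * entropy ((delta - g / 2) / (1 - 2 * mu)))).
  rewrite /dual_exponent Hg Hu lnw2 (addrC 2) (addrC 1 (w ^+ 2)).
  have -> : g * lk = g * (ln kappa - ln 2).
    have [k_0|k_n0] := eqVneq kappa 0; first by rewrite /g k_0 mul0r mul0r mulr0 !mul0r.
    by rewrite /lk ln_div ?posrE // lt0r k_n0 k0.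
  have -> : kappa * w * ln (kappa * w) = kappa * w * (ln kappa + ln w).
    have [->|kw_n0] := eqVneq (kappa * w) 0; first by rewrite !mul0r.
    have [kn wn] : kappa != 0 /\ w != 0.
      by split; apply: contraNneq kw_n0 => ->; rewrite ?mul0r ?mulr0.
    by rewrite lnM // posrE lt0r ?kn ?wn.
  rewrite /g /delta /delta_of; field.
  by rewrite nkw2 nw21.
rewrite main EFinD /E_term leeD2l //; apply: ereal_sup_ubound.
by exists g; rewrite // obj.
Qed.

End ErrorExponent.

Lemma sin_le_id (R : realType) (x : R) : 0 <= x -> sin x <= x.
Proof.
rewrite le_eqVlt => /predU1P[<-|x0]; first by rewrite sin0.
have [|c _] := @MVT R sin cos 0 x x0 (fun y _ => is_derive_sin y).
  by apply: continuous_subspaceT => y; exact: continuous_sin.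
by rewrite sin0 !subr0 => ->; rewrite ler_piMl ?cos_le1 // ltW.
Qed.

Lemma sin_ge_quadratic (R : realType) (x : R) : 0 < x -> x * (1 - x) <= sin x.
Proof.
move=> x0.
have [|a] := @MVT R sin cos 0 x x0 (fun y _ => is_derive_sin y).
  by apply: continuous_subspaceT => y; exact: continuous_sin.
rewrite in_itv /= => /andP[a0 ax]; rewrite sin0 !subr0 => ->.
have [|b _] := @MVT R cos (fun y => - sin y) 0 a a0 (fun y _ => is_derive_cos y).
  by apply: continuous_subspaceT => y; exact: continuous_cos.
rewrite cos0 subr0 => Hc; rewrite mulrC ler_wpM2r ?(ltW x0) //.
have : sin b * a <= a by rewrite ler_piMl ?sin_le1 // ltW.
lra.
Qed.

(** * Range of the dual variable, and rates [2 * mu] below 1/2 *)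

Section SmallRate.
Variables (R : realType) (rho mu : R).
Hypotheses (rho01 : 0 < rho < 1) (mu01 : 0 <= 2 * mu < 1).

Let std := Num.sqrt (rho * (1 - rho)).
Let std_gt0 : 0 < std.
Proof. by case/andP: rho01 => ? ?; rewrite sqrtr_gt0 mulr_gt0 // subr_gt0. Qed.
Let std_sq : std ^+ 2 = rho * (1 - rho).
Proof. by case/andP: rho01 => ? ?; rewrite sqr_sqrtr // ltW // mulr_gt0 // subr_gt0. Qed.

(** Intermediate value theorem on [[0, w1]] with [w1 ^+ 2 = (1 - rho) / rho]: the value at [w1] is
    exactly [1 - rho - mu] for [rho <= 1/2], and at least that otherwise. *)
Lemma delta_of_surj (delta : R) : 0 <= delta <= 1 - rho - mu ->
  exists w, [/\ 0 <= w, rho * w ^+ 2 <= 1 - rho & delta_of rho mu w = delta].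
Proof.
move=> /andP[d0 d1]; have /andP[r0 r1] := rho01; have /andP[m0 m1] := mu01.
have k0 := kappa_ge0 rho.
pose w1 := std / rho.
have w1_gt0 : 0 < w1 by rewrite divr_gt0.
have w1_sq : rho * w1 ^+ 2 = 1 - rho.
  by rewrite /w1 expr_div_n std_sq; field; rewrite gt_eqF.
have kw1 : kappa rho * w1 = `|1 - 2 * rho| / rho.
  by rewrite /kappa /w1 -/std; field; rewrite !gt_eqF.
have D0 : delta_of rho mu 0 = 0.
  by rewrite /delta_of expr0n !(mulr0, mul0r) addr0.
have D1 : 1 - rho - mu <= delta_of rho mu w1.
  rewrite /delta_of kw1.
  have -> : w1 ^+ 2 / (w1 ^+ 2 + 1) = 1 - rho.
    have e : w1 ^+ 2 = (1 - rho) / rho by rewrite -w1_sq mulrAC divff ?mul1r // gt_eqF.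
    by rewrite e; field; rewrite gt_eqF //= gt_eqF //; lra.
  suff : 1 - 2 * rho <= `|1 - 2 * rho| / rho / (`|1 - 2 * rho| / rho + 2) by nra.
  have [h|h] := leP 0 (1 - 2 * rho).
    rewrite ger0_norm // le_eqVlt; apply/orP; left; apply/eqP; field.
    by rewrite gt_eqF //= gt_eqF //; lra.
  apply: (@le_trans _ _ 0); first exact: ltW.
  by rewrite divr_ge0 ?addr_ge0 ?divr_ge0 // ltW.
have cont : {within `[0, w1], continuous (delta_of rho mu)}.
  apply: continuous_in_subspaceT => w; rewrite inE /= in_itv /= => /andP[w0 _].
  have kw0 : 0 <= kappa rho * w by rewrite mulr_ge0.
  have w2 := sqr_ge0 w.
  have cw2 : (fun x : R => x ^+ 2) @ w --> w ^+ 2 by exact: (@exprn_continuous R 2 w).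
  rewrite /delta_of; apply: cvgD; apply: cvgMr.
    apply: cvgM; first by apply: cvgMr; exact: cvg_id.
    apply: cvgV; first by rewrite gt_eqF //; lra.
    by apply: cvgD; [apply: cvgMr; exact: cvg_id | exact: cvg_cst].
  apply: cvgM => //; apply: cvgV; first by rewrite gt_eqF //; lra.
  by apply: cvgD => //; exact: cvg_cst.
have [|w] := @IVT R (delta_of rho mu) 0 w1 delta (ltW w1_gt0) cont.
  by rewrite D0 ge_min d0 le_max (le_trans d1 D1) orbT.
rewrite in_itv /= => /andP[w0 ww1] Dw; exists w; split=> //.
by rewrite -w1_sq ler_pM2l // ler_sqr ?nnegrE // ltW.
Qed.

Hypothesis mu14 : 4 * mu < 1.

(** Both [4 * mu - 1] and the logarithm of the sine quotient are at most 0 here, so the last summand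
    of [F_term] is nonnegative. *)
Lemma F_term_ge_small : - (1 - 3 * mu) * ln rho - mu * ln (1 - rho) <= F_term rho mu.
Proof.
have /andP[r0 r1] := rho01; have /andP[m0 m1] := mu01.
rewrite /F_term ln_div ?posrE ?subr_gt0 //.
suff : 0 <= 2 * mu * (4 * mu - 1) * ln (`|sin (rho * pi)| / (rho * pi)) by lra.
have rpi : 0 < rho * pi by rewrite mulr_gt0 ?pi_gt0.
have : ln (`|sin (rho * pi)| / (rho * pi)) <= 0.
  apply: ln_le0; rewrite ler_pdivrMr // mul1r ger0_norm ?sin_le_id ?(ltW rpi) //.
  by apply: sin_ge0_pi; rewrite (ltW rpi) /= ler_piMl ?pi_ge0 // ltW.
move=> L0; apply: mulr_le0 => //; apply: mulr_ge0_le0 => //. by rewrite subr_le0 ltW.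
Qed.

(** Tangent bounds [ln x <= x - 1] at [rho], [(1 - rho) * (1 - 3 * mu) / mu] and [1 / (1 - mu)]; the
    second argument is chosen to cancel the terms in [rho]. What remains is
    [mu * ln (4 * (1 - 3 * mu))], nonnegative as [mu < 1/4]. *)
Lemma small_rate_numeric : 0 < mu ->
  0 <= 2 * mu * ln 2 + mu * ln mu + (1 - mu) * ln (1 - mu)
       - (1 - 3 * mu) * ln rho - mu * ln (1 - rho).
Proof.
move=> mu0; have /andP[r0 r1] := rho01; have h14 := mu14.
have u0 : 0 < 1 - rho by lra.
have m3 : 0 < 1 - 3 * mu by lra.
have h1 := ln_le_sub1 r0.
have h2 := ln_le_sub1 (divr_gt0 (mulr_gt0 u0 m3) mu0).
rewrite ln_div ?posrE ?mulr_gt0 // lnM ?posrE // in h2.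
have m1 : 0 < 1 - mu by lra.
have h3 := ln_le_sub1 (divr_gt0 ltr01 m1); rewrite ln_div ?posrE // ln1 in h3.
have h4 : 0 <= 2 * ln 2 + ln (1 - 3 * mu).
  have -> : 2 * ln 2 = ln (2 ^+ 2) :> R by rewrite lnXn // mulr_natl.
  by rewrite -lnM ?posrE ?exprn_gt0 // ln_ge0 //; lra.
have k2 : mu * (ln (1 - rho) + ln (1 - 3 * mu) - ln mu) <= (1 - rho) * (1 - 3 * mu) - mu.
  have -> : (1 - rho) * (1 - 3 * mu) - mu = mu * ((1 - rho) * (1 - 3 * mu) / mu - 1).
    by field; rewrite gt_eqF.
  by rewrite ler_pM2l.
have k3 : (1 - mu) * (0 - ln (1 - mu)) <= mu.
  have e : (1 - mu) * (1 / (1 - mu) - 1) = mu by field; rewrite gt_eqF.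
  by rewrite -[leRHS]e ler_pM2l.
have k1 : (1 - 3 * mu) * ln rho <= (1 - 3 * mu) * (rho - 1) by rewrite ler_pM2l.
have k4 : 0 <= mu * (2 * ln 2 + ln (1 - 3 * mu)) by rewrite mulr_ge0 // ltW.
lra.
Qed.

(** For [mu > 0], Gibbs' inequality is applied at [mu / (1 - mu)] if [w ^+ 2] is at most this value,
    and at [w ^+ 2] otherwise. If then [w <= 1], the quotient [w ^+ 2 / (1 + w ^+ 2) ^+ 2] is at
    least its value at [mu / (1 - mu)], and both cases reduce to [small_rate_numeric]. For [w > 1]
    both summands are nonnegative. *)
Lemma small_rate_exponent_ge0 (w : R) : 0 <= w -> rho * w ^+ 2 <= 1 - rho ->
  mu + delta_of rho mu w < 1 ->
  0 <= dual_exponent rho mu (delta_of rho mu w) w + F_term rho mu.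
Proof.
move=> w0 w1 lam1; have h14 := mu14; have /andP[r0 r1] := rho01; have /andP[m0 m1] := mu01.
have k0 := kappa_ge0 rho.
have HF := F_term_ge_small.
have u0 : 0 < 1 - rho by lra.
have lnr : ln rho <= 0 by rewrite ln_le0 // ltW.
have lnu : ln (1 - rho) <= 0 by rewrite ln_le0 //; lra.
have [mu_0|mu_n0] := eqVneq mu 0.
  have E : dual_exponent rho mu (delta_of rho mu w) w = 0.
    rewrite /dual_exponent /delta_of mu_0 !(mulr0, mul0r, subr0, mul1r, add0r).
    have w21 : 0 < w ^+ 2 + 1 by have := sqr_ge0 w; lra.
    rewrite entropy_ratio ?sqr_ge0 // ln1 mulr0 addr0 (addrC 1).
    move: w0; rewrite le_eqVlt => /predU1P[<-|w_gt0].
      by rewrite expr0n !(mulr0, mul0r, subr0) subrr.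
    by rewrite lnXn // mulr2n; field; rewrite gt_eqF.
  rewrite E add0r; apply: le_trans HF; rewrite mu_0; nra.
have mu0 : 0 < mu by rewrite lt0r mu_n0; lra.
have num := small_rate_numeric mu0.
set delta := delta_of rho mu w in lam1 *.
have kw0 : 0 <= kappa rho * w by rewrite mulr_ge0.
have d0 : 0 <= delta.
  apply: addr_ge0; apply: mulr_ge0; [exact: ltW| |lra|].
    by rewrite divr_ge0 //; lra.
  by rewrite divr_ge0 ?sqr_ge0 // addr_ge0 ?sqr_ge0.
have w2 := sqr_ge0 w.
have lam01 : 0 < mu + delta < 1 by rewrite lam1 andbT; lra.
have ln1w2 : 0 <= ln (1 + w ^+ 2) by rewrite ln_ge0; lra.
have lnk : ln 2 <= ln (2 + kappa rho * w) by rewrite ler_ln ?posrE //; lra.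
have ln1mu : ln (1 - mu) <= 0 by rewrite ln_le0 //; lra.
have m10 : 0 < 1 - mu by lra.
have [w_small|w_big] := leP (w ^+ 2) (mu / (1 - mu)).
  have y0 : 0 < mu / (1 - mu) by rewrite divr_gt0.
  have := entropy_le lam01 y0.
  have -> : 1 + mu / (1 - mu) = 1 / (1 - mu) by field; rewrite gt_eqF.
  have hd : 2 * delta * ln w <= delta * ln (mu / (1 - mu)).
    move: w0; rewrite le_eqVlt => /predU1P[w_0|w_gt0].
      rewrite /delta /delta_of -w_0 expr0n !(mulr0, mul0r, addr0) //=.
    rewrite [2 * delta]mulrC -mulrA ler_wpM2l //.
    have -> : 2 * ln w = ln (w ^+ 2) by rewrite lnXn // mulr_natl.
    by rewrite ler_ln ?posrE // exprn_gt0.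
  rewrite !ln_div ?posrE // in hd *; rewrite ln1 /dual_exponent; nra.
have w_gt0 : 0 < w.
  rewrite lt0r w0 andbT; apply: contraTneq w_big => ->.
  by rewrite expr0n -leNgt divr_ge0 // ltW.
have w2_gt0 : 0 < w ^+ 2 by rewrite exprn_gt0.
have lnw2 : ln (w ^+ 2) = 2 * ln w by rewrite lnXn // mulr_natl.
have E : 2 * mu * (ln (2 + kappa rho * w) + ln w - ln (1 + w ^+ 2)) <=
    dual_exponent rho mu delta w.
  have := entropy_le lam01 w2_gt0; rewrite lnw2 /dual_exponent; lra.
have [w_le1|w_gt1] := leP w 1.
  have hq : ln (mu * (1 - mu)) <= ln (w ^+ 2) - 2 * ln (1 + w ^+ 2).
    have -> : 2 * ln (1 + w ^+ 2) = ln ((1 + w ^+ 2) ^+ 2).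
      by rewrite lnXn ?mulr_natl //; lra.
    have p0 : 0 < (1 + w ^+ 2) ^+ 2 by rewrite exprn_gt0 //; lra.
    rewrite -ln_div ?posrE // ler_ln ?posrE; [|exact: mulr_gt0|exact: divr_gt0].
    rewrite ler_pdivlMr //; move: w_big; rewrite ltr_pdivrMr // => w_big.
    have w2_1 : w ^+ 2 <= 1 by rewrite expr_le1.
    move: (w ^+ 2) w_big w2_1 w2_gt0 => s w_big s1 s0.
    have -> : mu * (1 - mu) * (1 + s) ^+ 2 =
        s - (s * (1 - mu) - mu) * ((1 - mu) - s * mu) by ring.
    rewrite lerBlDr lerDl mulr_ge0 //; nra.
  move: hq; rewrite lnM ?posrE // lnw2 => hq.
  have e2 : mu * (ln mu + ln (1 - mu)) <= mu * (2 * ln w - 2 * ln (1 + w ^+ 2))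
      by rewrite ler_pM2l.
  have e3 : mu * ln 2 <= mu * ln (2 + kappa rho * w) by rewrite ler_pM2l.
  have e4 : 0 <= (2 * mu - 1) * ln (1 - mu) by nra.
  lra.
suff : 0 <= ln (2 + kappa rho * w) + ln w - ln (1 + w ^+ 2) by nra.
have p2 : 0 < 2 + kappa rho * w by lra.
rewrite -lnM ?posrE // subr_ge0 ler_ln ?posrE ?mulr_gt0 //; last by lra.
have kE : kappa rho * std = `|1 - 2 * rho| by rewrite /kappa -/std divfK // gt_eqF.
have w_le : rho * w <= std.
  rewrite -ler_sqr ?nnegrE ?(ltW std_gt0) ?mulr_ge0 ?(ltW r0) //.
  rewrite exprMn std_sq expr2 -mulrA ler_pM2l //.
have s_le : w * std <= 1 - rho.
  rewrite -ler_sqr ?nnegrE ?(ltW u0) ?mulr_ge0 ?(ltW std_gt0) //.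
  rewrite exprMn std_sq; nra.
(* [w * std <= 1 - rho] and [rho * w <= std] give [(w ^+ 2 - 1) * std <= (1 - 2 * rho) * w]. *)
have kw : w ^+ 2 - 1 <= kappa rho * w.
  rewrite -(ler_pM2r std_gt0) mulrAC kE.
  have := ler_norm (1 - 2 * rho); nra.
nra.
Qed.

End SmallRate.

Section Exponent.
Variables (R : realType) (rho mu w : R).
Hypotheses (rho01 : 0 < rho < 1) (mu_ge : 1 <= 4 * mu) (mu_lt : 2 * mu < 1) (w_gt0 : 0 < w).

Let beta := 2 * w + `|1 - 2 * rho| / std_dev rho * w ^+ 2.

Lemma beta_gt0 : 0 < beta.
Proof.
have s0 := std_dev_gt0 rho01; rewrite /beta.
by rewrite ltr_wpDr ?mulr_gt0 // mulr_ge0 ?sqr_ge0 // divr_ge0 // ltW.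
Qed.

Let logit := ln rho - ln (1 - rho).

Let beta_std : beta * std_dev rho = 2 * w * std_dev rho + `|1 - 2 * rho| * w ^+ 2.
Proof. by rewrite /beta; field; rewrite gt_eqF ?std_dev_gt0. Qed.

(* t is the ratio between the weight given to the zero coordinates of a dual
   codeword and beta. The value t = rho / std_dev gives exactly F_term, but for
   rho > 1/2 it may violate beta * t <= 1 + w^2; then min(1, (1 + w^2) / beta)
   is admissible and no worse. *)
Lemma dual_weight_choice : exists t : R,
  [/\ 0 < t, beta * t <= 1 + w ^+ 2, Num.min rho (1 - rho) / std_dev rho <= t,
      2 * ln t - ln (1 + t ^+ 2) <= ln (Num.min rho 2^-1) &
      (1 - 2 * mu) * (ln (1 + t ^+ 2) - 2 * (1 - 2 * mu) * ln t)
        + mu * (4 * mu - 1) * logit <= (2 * mu - 1) * ln rho + mu * logit].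
Proof.
have s0 := std_dev_gt0 rho01; have s2 := std_dev_sq rho01.
have h1 := mu_ge; have h2 := mu_lt; have w0 := w_gt0.
have /andP[r0 r1] := rho01.
have u0 : 0 < 1 - rho by lra.
set s := std_dev rho in s0 s2 *.
have lns : 2 * ln s = ln rho + ln (1 - rho).
  by rewrite -lnM ?posrE // -s2 lnXn // mulr_natl.
have [le_half|gt_half] := leP rho 2^-1.
  have t0 : 0 < rho / s by rewrite divr_gt0.
  have lnt : ln (rho / s) = logit / 2 by rewrite ln_div ?posrE // /logit; lra.
  have t2 : 1 + (rho / s) ^+ 2 = 1 / (1 - rho).
    by rewrite expr_div_n s2; field; rewrite !gt_eqF.
  have ln1t : ln (1 + (rho / s) ^+ 2) = - ln (1 - rho).
    by rewrite t2 ln_div ?posrE // ln1 sub0r.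
  exists (rho / s); split => //.
  - rewrite -(ler_pM2r (exprn_gt0 2 s0)).
    have -> : beta * (rho / s) * s ^+ 2 = (beta * s) * rho by field; rewrite gt_eqF.
    rewrite beta_std -/s ger0_norm; last by lra.
    have : 0 <= (s - w * rho) ^+ 2 by exact: sqr_ge0.
    rewrite s2; have -> : (s - w * rho) ^+ 2 =
        s ^+ 2 - 2 * s * w * rho + w ^+ 2 * rho ^+ 2 by ring.
    rewrite s2 => H; lra.
  - by rewrite ler_pM2r ?invr_gt0 // ge_min lexx.
  - by rewrite lnt ln1t /logit; lra.
  - rewrite lnt ln1t /logit; lra.
have bA : beta * s <= rho * (1 + w ^+ 2).
  rewrite beta_std -/s ler0_norm; last by lra.
  rewrite -(ler_pM2r u0).
  have : 0 <= ((1 - rho) * w - s) ^+ 2 by exact: sqr_ge0.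
  have -> : ((1 - rho) * w - s) ^+ 2 =
      (1 - rho) ^+ 2 * w ^+ 2 - 2 * (1 - rho) * w * s + s ^+ 2 by ring.
  rewrite s2 => H; lra.
have A0 : 0 < 1 + w ^+ 2 by have := sqr_ge0 w; lra.
have b0 := beta_gt0.
have s_half : s <= 2^-1.
  rewrite -ler_sqr ?nnegrE ?(ltW s0) ?invr_ge0 // s2.
  by have := sqr_ge0 (rho - 2^-1); lra.
have us : 1 - rho <= s.
  rewrite -ler_sqr ?nnegrE ?(ltW s0) ?(ltW u0) // s2 expr2 ler_pM2r //; lra.
have logit0 : 0 <= logit by rewrite subr_ge0 ler_ln ?posrE //; lra.
have rhs : - ln s <= - ln (1 - rho) - (1 - 2 * mu) * logit.
  have : (1 - 2 * mu) * logit <= logit / 2 by rewrite mulrC ler_wpM2l //; lra.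
  rewrite /logit in logit0 *; lra.
(* For [rho > 1/2] the last requirement follows from a bound free of [logit], because [logit >= 0]
   and [1 - 2 * mu <= 1/2]. *)
have final t : ln (1 + t ^+ 2) - 2 * (1 - 2 * mu) * ln t <= - ln s ->
    (1 - 2 * mu) * (ln (1 + t ^+ 2) - 2 * (1 - 2 * mu) * ln t)
        + mu * (4 * mu - 1) * logit <= (2 * mu - 1) * ln rho + mu * logit.
  move=> /le_trans/(_ rhs) H.
  have : (1 - 2 * mu) * (ln (1 + t ^+ 2) - 2 * (1 - 2 * mu) * ln t) <=
      (1 - 2 * mu) * (- ln (1 - rho) - (1 - 2 * mu) * logit).
    by rewrite ler_wpM2l //; lra.
  rewrite /logit; lra.
have half t : 0 < t -> t <= 1 -> 2 * ln t - ln (1 + t ^+ 2) <= ln 2^-1.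
  move=> t0 t1; have t2 : 0 < t ^+ 2 by exact: exprn_gt0.
  have -> : 2 * ln t = ln (t ^+ 2) by rewrite lnXn // mulr_natl.
  rewrite -ln_div ?posrE //; last by lra.
  rewrite ler_ln ?posrE ?invr_gt0 //; last by rewrite divr_gt0 //; lra.
  rewrite ler_pdivrMr; last by lra.
  have : t ^+ 2 <= 1 by rewrite expr_le1 // ltW.
  lra.
have minE : Num.min rho (1 - rho) = 1 - rho by rewrite min_r //; lra.
rewrite minE.
have usle1 : (1 - rho) / s <= 1 by rewrite ler_pdivrMr // mul1r.
have [b_le|b_gt] := leP beta (1 + w ^+ 2).
  exists 1; split => //; first by rewrite mulr1.
    exact: half.
  apply: final; rewrite expr1n ln1 mulr0 subr0 -lnV ?posrE // ler_ln ?posrE ?invr_gt0 //.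
  rewrite -[leRHS]div1r ler_pdivlMr //; lra.
pose b := beta / (1 + w ^+ 2).
have b_gt0 : 0 < b by rewrite divr_gt0.
have b1 : 1 < b by rewrite ltr_pdivlMr // mul1r.
have bs : b * s <= rho by rewrite /b mulrAC ler_pdivrMr.
exists b^-1; split => //.
- by rewrite invr_gt0.
- by rewrite /b invf_div mulrC divfK // gt_eqF.
- rewrite ler_pdivrMr // mulrC ler_pdivlMr //.
  have : (1 - rho) * (b * s) <= (1 - rho) * rho by rewrite ler_pM2l.
  rewrite (mulrC (1 - rho) rho) -s2 => H; rewrite -(ler_pM2r s0); lra.
- apply: half; first by rewrite invr_gt0.
  by rewrite invf_le1 // ltW.
apply: final.
have lnb0 : 0 <= ln b by rewrite ln_ge0 // ltW.
have lnE : ln (1 + b^-1 ^+ 2) = ln (b ^+ 2 + 1) - 2 * ln b.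
  have -> : 1 + b^-1 ^+ 2 = (b ^+ 2 + 1) / b ^+ 2 by field; rewrite gt_eqF.
  have b20 : 0 < b ^+ 2 by exact: exprn_gt0.
  rewrite ln_div ?posrE //; last by lra.
  by rewrite lnXn // mulr_natl.
rewrite lnE lnV ?posrE //.
have : ln (b ^+ 2 + 1) <= ln b - ln s.
  have b20 : 0 < b ^+ 2 by exact: exprn_gt0.
  rewrite -ln_div ?posrE // ler_ln ?posrE ?divr_gt0 //; last by lra.
  rewrite ler_pdivlMr // -(ler_pM2r s0).
  (* [1 - rho <= s <= b * s <= rho], and [rho], [1 - rho] are the roots of [x ^+ 2 - x + s ^+ 2];
     hence [(b ^+ 2 + 1) * s <= b]. *)
  have : (b * s - rho) * (b * s - (1 - rho)) <= 0.
    apply: mulr_le0_ge0; first by rewrite subr_le0.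
    rewrite subr_ge0; apply: le_trans us _; by rewrite ler_peMl ?(ltW s0) ?(ltW b1).
  have -> : (b ^+ 2 + 1) * s * s = (b * s) ^+ 2 + s ^+ 2 by ring.
  by rewrite s2; lra.
have : 0 <= (4 * mu - 1) * ln b by rewrite mulr_ge0 //; lra.
lra.
Qed.

End Exponent.

Section DualSum.
Variables (R : realType) (rho mu w : R).
Hypotheses (rho01 : 0 < rho < 1) (mu_ge : 1 <= 4 * mu) (mu_lt : 2 * mu < 1) (w_gt0 : 0 < w).

Let beta := 2 * w + `|1 - 2 * rho| / std_dev rho * w ^+ 2.

Let beta_kappa : beta = w * (2 + kappa rho * w).
Proof. by rewrite /beta /kappa -/(std_dev rho); ring. Qed.

Let sinc := `|sin (rho * pi)| / (rho * pi).

Let sinc_gt0 : 0 < sinc.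
Proof.
have /andP[r0 r1] := rho01.
rewrite /sinc divr_gt0 ?mulr_gt0 ?pi_gt0 // normr_gt0 gt_eqF //.
by apply: sin_gt0_pi; rewrite mulr_gt0 ?pi_gt0 //= gtr_pMl ?pi_gt0.
Qed.

(* N = m - d rows are kept. Each dropped row gains a factor min(rho, 1/2), the
   rest is Gibbs' inequality, so a merely negative exponent suffices. *)
Lemma dual_exponent_bound (m n N d : nat) (delta t r corr : R) :
  n%:R = 2 * mu * m%:R -> (0 < N)%N -> N%:R + d%:R = m%:R :> R -> (N <= n.*2)%N -> (n <=
      N)%N ->
  0 < mu + delta < 1 ->
  dual_exponent rho mu delta w + F_term rho mu < 0 ->
  0 < t -> 2 * ln t - ln (1 + t ^+ 2) <= ln (Num.min rho 2^-1) ->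
  (1 - 2 * mu) * (ln (1 + t ^+ 2) - 2 * (1 - 2 * mu) * ln t)
        + mu * (4 * mu - 1) * (ln rho - ln (1 - rho))
    <= (2 * mu - 1) * ln rho + mu * (ln rho - ln (1 - rho)) ->
  0 < r <= 1 -> 1 <= corr -> r <= sinc * (rho / std_dev rho) * corr / t ->
  ((1 + w ^+ 2) / (beta * t)) ^+ (N - n) *
    ((beta * t) ^+ (n.*2 - N) * expR (n%:R * (n.*2 - N)%N%:R / N%:R * ln r) *
     ((beta * t) ^+ 2 + beta ^+ 2) ^+ (N - n))
  <= corr ^+ m * Num.min rho 2^-1 ^+ d * expR (N%:R * (entropy (mu + delta) + 2 * (mu +
      delta) * ln w)).
Proof.
have mu2 : 0 <= 2 * mu by have := mu_ge; lra.
have mu4 : 0 <= 4 * mu - 1 by rewrite subr_ge0; exact: mu_ge.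
have mu12 : 0 <= 1 - 2 * mu by rewrite subr_ge0 ltW //; exact: mu_lt.
have e0 : 0 <= 2 * mu * (4 * mu - 1) by exact: mulr_ge0.
have e1 : 2 * mu * (4 * mu - 1) <= 1 by have := mulr_ge0 mu12 mu4; lra.
move=> nE N0 NdE leN2n len lam01 neg t0 tq tF /andP[r0 r1] corr1 rle.
have /andP[rho0 rho1] := rho01; have h1 := mu_ge; have h2 := mu_lt; have w0 := w_gt0.
have s0 := std_dev_gt0 rho01.
have u0 : 0 < 1 - rho by lra.
have kw : 0 < 2 + kappa rho * w by have := mulr_ge0 (kappa_ge0 rho) (ltW w0); lra.
have b0 : 0 < beta by rewrite beta_kappa mulr_gt0.
have A0 : 0 < 1 + w ^+ 2 by have := sqr_ge0 w; lra.
have t20 : 0 < 1 + t ^+ 2 by have := sqr_ge0 t; lra.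
have q0 : 0 < Num.min rho 2^-1 by rewrite lt_min rho0 /= invr_gt0 ltr0n.
have c0 : 0 < corr by lra.
have bt0 : 0 < beta * t by rewrite mulr_gt0.
have NR : 0 < N%:R :> R by rewrite ltr0n.
have nN : (N - n)%N%:R = N%:R - n%:R :> R by rewrite natrB.
have n2N : (n.*2 - N)%N%:R = 2 * n%:R - N%:R :> R by rewrite natrB // -muln2 natrM mulrC.
have sq : (beta * t) ^+ 2 + beta ^+ 2 = beta ^+ 2 * (1 + t ^+ 2) by ring.
rewrite sq.
set lhs := (X in X <= _); set rhs := (X in _ <= X).
have lhs0 : 0 < lhs.
  by rewrite /lhs; repeat first [assumption | exact: expR_gt0 | apply: exprn_gt0
       | apply: divr_gt0 | apply: mulr_gt0].
have rhs0 : 0 < rhs.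
  by rewrite /rhs; repeat first [assumption | exact: expR_gt0 | apply: exprn_gt0
       | apply: mulr_gt0].
rewrite -ler_ln ?posrE //.
have lnlhs : ln lhs = (N%:R - n%:R) * (ln (1 + w ^+ 2) - (ln beta + ln t)) +
   ((2 * n%:R - N%:R) * (ln beta + ln t) + n%:R * (2 * n%:R - N%:R) / N%:R * ln r +
    (N%:R - n%:R) * (2 * ln beta + ln (1 + t ^+ 2))).
  have d0 : 0 < (1 + w ^+ 2) / (beta * t) by exact: divr_gt0.
  have f0 : 0 < beta ^+ 2 * (1 + t ^+ 2) by rewrite mulr_gt0 // exprn_gt0.
  rewrite /lhs !lnM ?posrE; try by repeat first [assumption | exact: expR_gt0 | apply:
      exprn_gt0 | apply: mulr_gt0].
  rewrite !lnXn // expRK.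
  rewrite ln_div ?posrE // !lnM ?posrE ?exprn_gt0 //.
  rewrite -[_ *+ (N - n)]mulr_natl -[_ *+ (n.*2 - N)]mulr_natl nN n2N.
  by rewrite -[X in _ + (_ + _ + X)]mulr_natl nN; ring.
have lnrhs : ln rhs = m%:R * ln corr + d%:R * ln (Num.min rho 2^-1) +
   N%:R * (entropy (mu + delta) + 2 * (mu + delta) * ln w).
  rewrite /rhs !lnM ?posrE; try by repeat first [assumption | exact: expR_gt0 | apply:
      exprn_gt0 | apply: mulr_gt0].
  by rewrite !lnXn // expRK -[ln corr *+ m]mulr_natl -[_ *+ d]mulr_natl.
rewrite lnlhs lnrhs.
have lnb : ln beta = ln w + ln (2 + kappa rho * w) by rewrite beta_kappa lnM ?posrE.
have lnr : ln r <= 0 by rewrite ln_le0.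
have lncorr : 0 <= ln corr by rewrite ln_ge0.
have lnr_le : ln r <= ln sinc + (ln rho - ln (1 - rho)) / 2 + ln corr - ln t.
  have lns : 2 * ln (std_dev rho) = ln rho + ln (1 - rho).
    by rewrite -lnM ?posrE // -(std_dev_sq rho01) lnXn // mulr_natl.
  have -> : ln sinc + (ln rho - ln (1 - rho)) / 2 + ln corr - ln t =
     ln (sinc * (rho / std_dev rho) * corr / t).
    have p1 : 0 < rho / std_dev rho by rewrite divr_gt0.
    have p2 : 0 < sinc * (rho / std_dev rho) by rewrite mulr_gt0.
    have p3 : 0 < sinc * (rho / std_dev rho) * corr by rewrite mulr_gt0.
    rewrite [RHS]ln_div ?posrE // (lnM (x := sinc * _)) ?posrE // (lnM (x :=
        sinc)) ?posrE //.
    by rewrite (ln_div (x := rho)) ?posrE //; lra.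
  rewrite ler_ln ?posrE //; repeat first [assumption | apply: divr_gt0 | apply: mulr_gt0].
set L := ln sinc in lnr_le *.
have Gibbs := entropy_le lam01 (exprn_gt0 2 w0).
rewrite lnXn // in Gibbs; rewrite mulr2n in Gibbs.
set H := entropy (mu + delta) in Gibbs neg *.
have FE : F_term rho mu = (2 * mu - 1) * ln rho + mu * (ln rho - ln (1 - rho))
    + 2 * mu * (4 * mu - 1) * L.
  by rewrite /F_term ln_div ?posrE.
rewrite FE /dual_exponent -/H in neg.
have m0 : 0 < m%:R :> R by rewrite -NdE ltr_wpDr.
(* The exponent [n (2n - N) / N] decreases in [N], so as [ln r <= 0] it may be replaced by its value
   at [N = m]. *)
have e_le : n%:R * (2 * n%:R - N%:R) / N%:R * ln r <= 2 * mu * (4 * mu - 1) * m%:R * ln r.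
  apply: ler_wnM2r => //; rewrite ler_pdivlMr //.
  have -> : 2 * mu * (4 * mu - 1) * m%:R * N%:R = n%:R * ((4 * mu - 1) * N%:R).
    by rewrite nE; ring.
  rewrite ler_wpM2l // nE.
  have NM : N%:R <= m%:R :> R by rewrite -NdE lerDl.
  have -> : 2 * (2 * mu * m%:R) - N%:R =
      (4 * mu - 1) * N%:R + 4 * mu * (m%:R - N%:R) by ring.
  by rewrite lerDl mulr_ge0 ?subr_ge0 // (le_trans ler01).
(* [corr] costs at most [m * ln corr], as [2 * mu * (4 * mu - 1) <= 1]. *)
have e_le2 : 2 * mu * (4 * mu - 1) * m%:R * ln r <=
   2 * mu * (4 * mu - 1) * m%:R * (L + (ln rho - ln (1 - rho)) / 2 - ln t) + m%:R * ln corr.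
  apply: (@le_trans _ _ (2 * mu * (4 * mu - 1) * m%:R * (L +
      (ln rho - ln (1 - rho)) / 2 + ln corr - ln t))).
    by rewrite ler_wpM2l // mulr_ge0 // ltW.
  have : 0 <= (1 - 2 * mu * (4 * mu - 1)) * (m%:R * ln corr).
    by rewrite mulr_ge0 ?mulr_ge0 ?(ltW m0) // subr_ge0.
  lra.
have negm : m%:R * (2 * mu * ln (2 + kappa rho * w) + (1 - 2 * mu) * ln (1 + w ^+ 2) -
       2 * delta * ln w - H +
       ((2 * mu - 1) * ln rho + mu * (ln rho - ln (1 - rho)) +
        2 * mu * (4 * mu - 1) * L)) <= 0.
  by rewrite pmulr_rle0 // ltW.
have tFm : m%:R * ((1 - 2 * mu) * (ln (1 + t ^+ 2) - 2 * (1 - 2 * mu) * ln t)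
        + mu * (4 * mu - 1) * (ln rho - ln (1 - rho)))
    <= m%:R * ((2 * mu - 1) * ln rho + mu * (ln rho - ln (1 - rho))).
  by rewrite ler_pM2l.
have tqd : d%:R * (2 * ln t - ln (1 + t ^+ 2)) <= d%:R * ln (Num.min rho 2^-1)
    by rewrite ler_wpM2l.
(* Having [N = m - d] lowers the right side by [d * (H + 2 * (mu + delta) * ln w)], which is at most
   the [d * ln (1 + w ^+ 2)] saved on the left. *)
have Gd : d%:R * (H + 2 * (mu + delta) * ln w - ln (1 + w ^+ 2)) <= 0.
  by rewrite mulr_ge0_le0 //; lra.
have NE : N%:R = m%:R - d%:R :> R by rewrite -NdE addrK.
have := le_trans e_le e_le2.
rewrite lnb nE NE; set E := _ / _ * ln r; move: E => E Ele.
lra.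
Qed.

Lemma dual_sum_le (p m n N d : nat) (B : 'M['F_p]_(N.+1, n)) (S : 'I_N.+1 -> {set 'F_p})
    (delta : R) : prime p -> (forall i, #|S i|%:R = rho * p%:R) -> is_MDS B ->
  n%:R = 2 * mu * m%:R -> (N.+1 + d = m)%N ->
  0 < mu + delta < 1 ->
  dual_exponent rho mu delta w + F_term rho mu < 0 ->
  \sum_(c : 'rV['F_p]_N.+1 | (c *m B == 0) && (c != 0))
     \prod_i (if c 0 i == 0 then 1 + w ^+ 2 else beta * indic_hat rho (S i) (c 0 i))
  <= N.+1%:R * (((pi / p%:R) / sin (pi / p%:R)) ^+ m * Num.min rho 2^-1 ^+ d *
       expR (N.+1%:R * (entropy (mu + delta) + 2 * (mu + delta) * ln w))).
Proof.
move=> p_pr cardS mdsB nE NdE lam01 neg.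
have [len _] := mdsB.
have /andP[rho0 rho1] := rho01; have h1 := mu_ge; have w0 := w_gt0.
have s0 := std_dev_gt0 rho01.
have p0 : 0 < p%:R :> R by rewrite ltr0n prime_gt0.
have [t [t0 bt G_le tq tF]] := dual_weight_choice rho01 mu_ge mu_lt w_gt0.
have b0 := beta_gt0 rho01 w_gt0.
set corr := pi / p%:R / sin (pi / p%:R).
have h_gt0 : 0 < pi / p%:R :> R by rewrite divr_gt0 ?pi_gt0.
have sin_gt0 : 0 < sin (pi / p%:R) :> R.
  apply: sin_gt0_pi; rewrite h_gt0 ltr_pdivrMr // ltr_pMr ?pi_gt0 //.
  by rewrite ltr1n prime_gt1.
have corr1 : 1 <= corr.
  by rewrite /corr ler_pdivlMr // mul1r; apply: sin_le_id; exact: ltW.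
have leN2n : (N.+1 <= n.*2)%N.
  rewrite -(ler_nat R) -muln2 natrM nE.
  apply: (@le_trans _ _ m%:R); first by rewrite ler_nat -NdE leq_addr.
  have -> : 2 * mu * m%:R * 2 = (4 * mu) * m%:R by ring.
  by rewrite ler_peMl.
pose sb := sinc * (rho / std_dev rho) * corr.
have corr0 : 0 < corr by exact: lt_le_trans ltr01 corr1.
have sb0 : 0 < sb by apply: mulr_gt0 => //; apply: mulr_gt0;
    [exact: sinc_gt0 | exact: divr_gt0].
(* When the cap 1 is active, the elementary bound [min(rho, 1 - rho) / std_dev <= t] replaces the
   arc bound. *)
pose r := Num.min 1 (sb / t).
have r0 : 0 < r by rewrite lt_min ltr01 divr_gt0.
have r1 : r <= 1 by rewrite ge_min lexx.
have Gsup i v : v != 0 -> indic_hat rho (S i) v <= t * r.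
  move=> v0; rewrite /r; case: (leP 1 (sb / t)) => _.
    rewrite mulr1; apply: le_trans G_le.
    rewrite ler_pdivlMr // le_min -!ler_pdivlMr //.
    by rewrite indic_hat_le_rho // indic_hat_le_rhoC.
  rewrite mulrC divfK ?gt_eqF //.
  apply: le_trans (indic_hat_le_sin p_pr rho01 (cardS i) v0) _.
  rewrite /sb /sinc /corr ger0_norm; last first.
    by apply: sin_ge0_pi; rewrite mulr_ge0 ?pi_ge0 ?(ltW rho0) //= ler_piMl ?pi_ge0 // ltW.
  have pi0 := pi_gt0 R.
  rewrite le_eqVlt; apply/orP; left; apply/eqP.
  move: (sin (rho * pi)) (sin (pi / p%:R)) sin_gt0 pi0 => a b b_gt0.
  move: (@pi R) => P P_gt0; field.
  by rewrite !gt_eqF.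
(* [K] is a real power of [r]: the pigeonhole count [n (2n - N.+1) / N.+1] need not be an
   integer. *)
apply: le_trans (sum_dual_le (r := r) (K :=
    expR (n%:R * (n.*2 - N.+1)%N%:R / N.+1%:R * ln r))
   mdsB leN2n (fun i v => indic_hat_ge0 rho (S i) v) _ Gsup _ t0 b0 bt _) _.
- by move=> i; exact: sum_indic_hat_sq.
- by rewrite (ltW r0) r1.
- move=> e He; rewrite -[leLHS]lnK ?posrE ?exprn_gt0 // ler_expR lnXn // -[ln r *+
    e]mulr_natl.
  apply: ler_wnM2r; first exact: ln_le0.
  by rewrite ler_pdivrMr // -!natrM ler_nat mulnC [leqRHS]mulnC // mulnC.
rewrite ler_pM2l //; apply: (@dual_exponent_bound m) => //.
- by rewrite -natrD NdE.
- by rewrite r0.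
- by rewrite /r ge_min lexx orbT.
Qed.

End DualSum.

(** * Binomial coefficients and entropy *)

(** Consecutive binomials have ratio [(N - k) / (k + 1) <= 8]. This makes the normalizations within
    a block comparable. *)
Lemma bin_shift_le N k j : (N <= 8 * k.+1)%N -> ('C(N, k + j) <= 8 ^ j * 'C(N, k))%N.
Proof.
move=> HN; elim: j => [|j IH]; first by rewrite addn0 mul1n.
rewrite addnS expnS -mulnA.
apply: leq_trans (_ : 8 * 'C(N, k + j) <= _)%N; last by rewrite leq_mul2l IH.
rewrite -(leq_pmul2l (isT : 0 < (k + j).+1)%N) mul_bin_left mulnA leq_mul2r.
by apply/orP; right; lia.
Qed.

Section BinomialEntropy.
Variable R : realType.

(** The [N.+1] weights of the binomial law sum to 1, rise up to [l] and fall from [l + 1] on, with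
    at most a factor [1 / (1 - x)] gained in between; so the weight at [l] is at least
    [(1 - x) / N.+1]. The factor [x] pays for replacing [x * N] by [l] in the exponents. *)
Lemma bin_entropy_ge (x : R) (N : nat) : 0 < x < 1 ->
  expR (N%:R * entropy x) * (x * (1 - x)) <= N.+1%:R * 'C(N, Num.trunc (x * N%:R))%:R.
Proof.
move=> /andP[x0 x1]; have y0 : 0 < 1 - x by lra.
have xN0 : 0 <= x * N%:R by rewrite mulr_ge0 ?(ltW x0) ?ler0n.
set l := Num.trunc (x * N%:R).
have /andP[l1 l2] := truncn_itv xN0; rewrite -/l -natr1 in l1 l2.
have lN : (l <= N)%N by rewrite -(ler_nat R) (le_trans l1) // ler_piMl ?ler0n ?(ltW x1).
pose b k := 'C(N, k)%:R * (x ^+ k * (1 - x) ^+ (N - k)) : R.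
have binR k : k.+1%:R * 'C(N, k.+1)%:R = (N - k)%N%:R * 'C(N, k)%:R :> R.
  by rewrite -!natrM mul_bin_left.
have C0 k : 0 <= 'C(N, k)%:R :> R by rewrite ler0n.
have kp (k : nat) : 0 < k%:R + 1 :> R by rewrite natr1 ltr0n.
have bS k : (k < N)%N -> b k = 'C(N, k)%:R * (1 - x) * (x ^+ k * (1 - x) ^+ (N - k.+1)).
  by move=> kN; rewrite /b -(subnSK kN) exprS; ring.
have bS' k : b k.+1 = 'C(N, k.+1)%:R * x * (x ^+ k * (1 - x) ^+ (N - k.+1)).
  by rewrite /b exprS; ring.
have c0 k : 0 <= x ^+ k * (1 - x) ^+ (N - k.+1).
  by rewrite mulr_ge0 // exprn_ge0 // ltW.
have up k : (k < l)%N -> b k <= b k.+1.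
  move=> kl; have kN : (k < N)%N by exact: leq_trans lN.
  rewrite bS // bS' ler_wpM2r // -(ler_pM2l (kp k)).
  have -> : (k%:R + 1) * ('C(N, k.+1)%:R * x) = (N%:R - k%:R) * x * 'C(N, k)%:R.
    by rewrite mulrA natr1 binR natrB 1?ltnW //; ring.
  have kl' : k%:R + 1 <= l%:R :> R by rewrite natr1 ler_nat.
  have -> : (k%:R + 1) * ('C(N, k)%:R * (1 - x)) = (k%:R + 1) * (1 - x) * 'C(N, k)%:R
      by ring.
  by rewrite ler_wpM2r //; nra.
have down k : (l < k)%N -> b k.+1 <= b k.
  move=> lk; have [kN|Nk] := ltnP k N; last first.
    by rewrite {1}/b bin_small // mul0r /b mulr_ge0 // mulr_ge0 // exprn_ge0 // ltW.
  rewrite (bS k) // bS' ler_wpM2r // -(ler_pM2l (kp k)).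
  have -> : (k%:R + 1) * ('C(N, k.+1)%:R * x) = (N%:R - k%:R) * x * 'C(N, k)%:R.
    by rewrite mulrA natr1 binR natrB 1?ltnW //; ring.
  have lk' : l%:R + 1 <= k%:R :> R by rewrite natr1 ler_nat.
  have -> : (k%:R + 1) * ('C(N, k)%:R * (1 - x)) = (k%:R + 1) * (1 - x) * 'C(N, k)%:R
      by ring.
  by rewrite ler_wpM2r //; nra.
have b0 k : 0 <= b k by rewrite /b mulr_ge0 // mulr_ge0 // exprn_ge0 // ltW.
have top : b l.+1 * (1 - x) <= b l.
  have [lN'|Nl] := ltnP l N; last first.
    by rewrite {1}/b bin_small ?mul0r.
  rewrite (bS l) // bS' mulrAC ler_wpM2r // ler_wpM2r ?(ltW y0) //.
  rewrite -(ler_pM2l (kp l)) mulrA natr1 binR natrB 1?ltnW // -natr1.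
  have -> : (N%:R - l%:R) * 'C(N, l)%:R * x = (N%:R - l%:R) * x * 'C(N, l)%:R by ring.
  rewrite ler_wpM2r //.
  have : 0 <= l%:R * x by rewrite mulr_ge0 // ltW.
  lra.
have b_le k : b k * (1 - x) <= b l.
  have [lk|kl] := ltnP l k.
    apply: le_trans top; rewrite ler_wpM2r ?(ltW y0) //.
    rewrite -(subnKC lk); elim: (k - l.+1)%N => [|i IH]; first by rewrite addn0.
    by rewrite addnS (le_trans (down _ _)) // ltn_addr.
  apply: (@le_trans _ _ (b k)); first by rewrite ler_piMr //; lra.
  have : forall i, (i <= l)%N -> b (l - i)%N <= b l.
    elim=> [|i IH] il; first by rewrite subn0.
    apply: le_trans (IH (ltnW il)).
    by rewrite -[in leRHS](subnSK il) up // subnSK //; lia.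
  by move/(_ (l - k)%N (leq_subr _ _)); rewrite subKn.
have sum1 : \sum_(k < N.+1) b k = 1.
  have := exprDn (1 - x) x N; rewrite subrK expr1n => ->.
  by apply: eq_bigr => k _; rewrite /b [_ ^+ k * _]mulrC mulr_natl.
have le1 : 1 - x <= N.+1%:R * b l.
  have -> : 1 - x = (\sum_(k < N.+1) b k) * (1 - x) by rewrite sum1 mul1r.
  rewrite mulr_suml.
  apply: (@le_trans _ _ (\sum_(k < N.+1) b l)); first by apply: ler_sum => k _; exact: b_le.
  by rewrite sumr_const card_ord mulr_natl.
have lnx : ln x <= 0 by rewrite ln_le0 // ltW.
have lny : ln (1 - x) <= 0 by rewrite ln_le0 //; lra.
have bl : b l * x * expR (N%:R * entropy x) <= 'C(N, l)%:R.
  have xE : x = expR (ln x) by rewrite lnK.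
  have yE : 1 - x = expR (ln (1 - x)) by rewrite lnK.
  have -> : b l * x * expR (N%:R * entropy x) = 'C(N, l)%:R *
     expR (l%:R * ln x + (N%:R - l%:R) * ln (1 - x) + ln x + N%:R * entropy x).
    rewrite /b !expRD lnK // -natrB // ![_%:R * ln _]mulrC !expRM_natr ?lnK //.
    by ring.
  rewrite ler_piMr // -[leRHS]expR0 ler_expR /entropy.
  have : (l%:R + 1 - x * N%:R) * ln x <= 0 by rewrite mulr_ge0_le0 //; lra.
  have : (x * N%:R - l%:R) * ln (1 - x) <= 0 by rewrite mulr_ge0_le0 //; lra.
  lra.
have e0 := expR_ge0 (N%:R * entropy x).
apply: (@le_trans _ _ (N.+1%:R * (b l * x * expR (N%:R * entropy x)))).
  have -> : N.+1%:R * (b l * x * expR (N%:R * entropy x)) =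
      expR (N%:R * entropy x) * (x * (N.+1%:R * b l)) by ring.
  by rewrite ler_wpM2l // ler_wpM2l // ltW.
by rewrite ler_wpM2l.
Qed.

(** For [x = pi / p <= 1/2] one has [x / sin x <= 1 + 2 * x <= expR (2 * x)], and
    [2 * x * m <= 8 / c] since [pi <= 4]. The bound [c * m <= p] will come from [MDS_card_field]. *)
Lemma sinc_corr_le (c : R) (m p : nat) : 0 < c -> (8 <= p)%N -> c * m%:R <= p%:R ->
  (pi / p%:R / sin (pi / p%:R)) ^+ m <= expR (8 / c) :> R.
Proof.
move=> c0 p8 cm.
have p0 : 0 < p%:R :> R by rewrite ltr0n (leq_trans _ p8).
have pi4 : pi <= 4 :> R by have := pihalf_lt2 R; lra.
set x := pi / p%:R; have x0 : 0 < x by rewrite divr_gt0 ?pi_gt0.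
have x_half : x <= 2^-1.
  rewrite ler_pdivrMr //; have : 8 <= p%:R :> R by rewrite ler_nat.
  lra.
have sin_ge := sin_ge_quadratic x0.
have sin0 : 0 < sin x by apply: lt_le_trans sin_ge; rewrite mulr_gt0 //; lra.
have corr0 : 0 <= x / sin x by rewrite divr_ge0 // ltW.
have corr_le : x / sin x <= expR (2 * x).
  apply: (@le_trans _ _ (1 + 2 * x)); last exact: expR_ge1Dx.
  rewrite ler_pdivrMr //.
  have : (1 + 2 * x) * (x * (1 - x)) <= (1 + 2 * x) * sin x by rewrite ler_wpM2l //; lra.
  have : 0 <= x * x * (1 - 2 * x).
    by apply: mulr_ge0; [apply: mulr_ge0; exact: ltW | lra].
  lra.
apply: le_trans (lerXn2r m _ _ corr_le) _; rewrite ?nnegrE ?expR_ge0 //.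
rewrite -expRM_natr ler_expR /x ler_pdivlMr //.
have -> : 2 * (pi / p%:R) * m%:R * c = 2 * pi * (c * m%:R) / p%:R by ring.
rewrite ler_pdivrMr //.
apply: (@le_trans _ _ (8 * (c * m%:R))); last by rewrite ler_wpM2l.
by rewrite ler_wpM2r ?mulr_ge0 ?(ltW c0) //; lra.
Qed.

(** [J] of the factors are bounded by [rho], to absorb negative powers of [rho]; the others by 1/2,
    a decay independent of [rho]. *)
Lemma min_half_exp_le (rho : R) J d : 0 < rho -> (J <= d)%N ->
  Num.min rho 2^-1 ^+ d <= 2^-1 ^+ (d - J) * rho ^+ J.
Proof.
move=> r0 le_Jd.
have h0 : 0 < 2^-1 :> R by rewrite invr_gt0.
rewrite -{1}(subnK le_Jd) exprD; apply: ler_pM.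
- by rewrite exprn_ge0 // le_min !ltW.
- by rewrite exprn_ge0 // le_min !ltW.
- by rewrite lerXn2r ?nnegrE ?le_min ?(ltW r0) ?(ltW h0) // ge_min lexx orbT.
- by rewrite lerXn2r ?nnegrE ?le_min ?(ltW r0) ?(ltW h0) // ge_min lexx.
Qed.

End BinomialEntropy.

(** * The test polynomial *)

Section GramError.
Variables (R : realType) (rho mu w delta : R) (p m n N d J : nat).
Variables (B : 'M['F_p]_(N.+1, n)) (S : 'I_N.+1 -> {set 'F_p}).
Hypotheses (rho01 : 0 < rho < 1) (mu_ge : 1 <= 4 * mu) (mu_lt : 2 * mu < 1).
Hypotheses (w_gt0 : 0 < w) (w_le : rho * w ^+ 2 <= 1 - rho).
Hypotheses (delta_ge0 : 0 <= delta) (delta_le : delta <= 1 - rho - mu).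
Hypotheses (p_pr : prime p) (cardS : forall i, #|S i|%:R = rho * p%:R) (mdsB : is_MDS B).
Hypotheses (nE : n%:R = 2 * mu * m%:R) (NdE : (N.+1 + d = m)%N).
Hypothesis neg : dual_exponent rho mu delta w + F_term rho mu < 0.

Let l := Num.trunc ((mu + delta) * N.+1%:R).
Hypotheses (J_le_d : (J.+2 <= d)%N) (N_le : (N.+1 <= 8 * (l - J).+1)%N).

Definition elem_sym_normalized (k : nat) (x : 'cV['F_p]_n) : R :=
  elem_sym (indic_vec rho B S x) k / Num.sqrt 'C(N.+1, k)%:R.

Definition gram (j k : nat) : R :=
  p%:R ^- n * \sum_x elem_sym_normalized j x * elem_sym_normalized k x.

Let lam01 : 0 < mu + delta < 1.
Proof.
by have /andP[? ?] := rho01; have := mu_ge; have := delta_ge0; have := delta_le; lra.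
Qed.

Let l_le : (l <= N.+1)%N.
Proof.
have /andP[l0 l1] := lam01.
have H : 0 <= (mu + delta) * N.+1%:R by rewrite mulr_ge0 // ltW.
have /andP[h _] := truncn_itv H.
by rewrite -(ler_nat R) (le_trans h) // ler_piMl // ltW.
Qed.

(** By [bin_entropy_ge] the entropy factor is at most ['C(N.+1, l)] up to
    [N.+2 / (lam * (1 - lam))], and the normalization is at least this binomial over [8 ^ J]. Of the
    gain from the dropped rows, [J.+1] factors [rho] pay for [w_pow], one pays for [lamlam], and the
    others give the decay. *)
Lemma gram_error j k : (l <= j + J)%N -> (j <= l)%N -> (l <= k + J)%N -> (k <= l)%N ->
  `|gram j k - (j == k)%:R| <=
  4 * 8%:R ^+ J * N.+2%:R ^+ 2 * (pi / p%:R / sin (pi / p%:R)) ^+ m * 2^-1 ^+ (d - J.+2).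
Proof.
move=> lj jl lk kl.
have /andP[r0 r1] := rho01; have /andP[lam0 lam1] := lam01; have w0 := w_gt0.
set lam := mu + delta in lam0 lam1.
have C_gt0 i : (i <= l)%N -> 0 < 'C(N.+1, i)%:R :> R.
  by move=> il; rewrite ltr0n bin_gt0 (leq_trans il).
have sC_gt0 i : (i <= l)%N -> 0 < Num.sqrt ('C(N.+1, i)%:R : R).
  by move=> il; rewrite sqrtr_gt0 C_gt0.
have C_le i : (l <= i + J)%N -> (i <= l)%N -> 'C(N.+1, l)%:R / 8%:R ^+ J <=
    'C(N.+1, i)%:R :> R.
  move=> li il; rewrite ler_pdivrMr ?exprn_gt0 // -natrX -natrM ler_nat mulnC.
  rewrite -{1}(subnKC il); apply: leq_trans (bin_shift_le _ _) _.
    by apply: leq_trans N_le _; rewrite leq_mul2l /= ltnS leq_subLR addnC.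
  by rewrite leq_mul2r leq_pexp2l ?orbT // leq_subLR.
set sj := Num.sqrt ('C(N.+1, j)%:R : R); set sk := Num.sqrt ('C(N.+1, k)%:R : R).
have sj0 : 0 < sj by exact: sC_gt0.
have sk0 : 0 < sk by exact: sC_gt0.
have Cl0 : 0 < 'C(N.+1, l)%:R :> R by exact: C_gt0.
have E0 : 0 < 8%:R ^+ J :> R by rewrite exprn_gt0.
have sjk : 'C(N.+1, l)%:R / 8%:R ^+ J <= sj * sk.
  have X0 : 0 <= 'C(N.+1, l)%:R / 8%:R ^+ J :> R by rewrite divr_ge0 // ltW.
  rewrite -ler_sqr ?nnegrE ?mulr_ge0 ?(ltW sj0) ?(ltW sk0) //.
  rewrite [leRHS]exprMn /sj /sk !sqr_sqrtr // [leLHS]expr2; apply: ler_pM => //;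
      exact: C_le.
have -> : gram j k - (j == k)%:R =
    (p%:R ^- n * (\sum_(x : 'cV['F_p]_n) elem_sym (indic_vec rho B S x) j *
      elem_sym (indic_vec rho B S x) k) - (j == k)%:R * 'C(N.+1, k)%:R) / (sj * sk).
  rewrite mulrBl; congr (_ - _).
    rewrite /gram -mulrA mulr_suml; congr (_ * _); apply: eq_bigr => x _.
    by rewrite /elem_sym_normalized -/sj -/sk invfM; ring.
  case: (eqVneq j k) => [jk|_]; last by rewrite !mul0r.
  have -> : sj = sk by rewrite /sj jk.
  rewrite !mul1r -expr2 /sk sqr_sqrtr // divff // gt_eqF //; exact: C_gt0.
rewrite normrM normfV (gtr0_norm (mulr_gt0 sj0 sk0)) ler_pdivrMr ?mulr_gt0 //.
apply: le_trans (indic_Gram p_pr rho01 B cardS j k w0) _.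
have DS := dual_sum_le rho01 mu_ge mu_lt w_gt0 p_pr cardS mdsB nE NdE lam01 neg.
apply: le_trans (ler_wpM2l _ DS) _; first by rewrite invr_ge0 exprn_ge0 // ltW.
set corr := (pi / p%:R / sin (pi / p%:R)) ^+ m.
have corr0 : 0 <= corr.
  have p0 : 0 < p%:R :> R by rewrite ltr0n prime_gt0.
  rewrite exprn_ge0 // divr_ge0 ?divr_ge0 ?pi_ge0 ?(ltW p0) //.
  apply: sin_ge0_pi; rewrite divr_ge0 ?pi_ge0 ?(ltW p0) //= ler_pdivrMr //.
  by rewrite ler_peMr ?pi_ge0 // ler1n prime_gt0.
have BE := @bin_entropy_ge R lam N.+1 lam01.
rewrite -/l in BE.
set H := expR (N.+1%:R * entropy lam) in BE.
have H0 : 0 < H by exact: expR_gt0.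
have -> : expR (N.+1%:R * (entropy (mu + delta) + 2 * (mu + delta) * ln w)) =
    H * expR (2 * (lam * N.+1%:R) * ln w).
  by rewrite /H -expRD /lam; congr expR; ring.
have q_le := min_half_exp_le r0 J_le_d.
set q := Num.min rho 2^-1 ^+ d in q_le *.
have q0 : 0 <= q by rewrite exprn_ge0 // le_min (ltW r0) /= invr_ge0 ler0n.
(* [j + k] falls short of [2 * lam * N.+1] by at most [2 * J.+1], the rounding in [l] included, and
   [w ^+ 2 <= 1 / rho] by [w_le]. *)
have w_pow : w ^- (j + k) * expR (2 * (lam * N.+1%:R) * ln w) <= rho ^- J.+1.
  have lamN0 : 0 <= lam * N.+1%:R by rewrite mulr_ge0 // ltW.
  have /andP[h1 h2'] := truncn_itv lamN0.
  have h2 : lam * N.+1%:R < l%:R + 1 by rewrite natr1.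
  rewrite -/lam -/l in h1.
  have lnw : 2 * ln w <= - ln rho.
    have -> : 2 * ln w = ln (w ^+ 2) by rewrite lnXn // mulr_natl.
    rewrite -lnV ?posrE // ler_ln ?posrE ?invr_gt0 ?exprn_gt0 //.
    by rewrite -[leRHS]div1r ler_pdivlMr // mulrC; have := w_le; lra.
  have lnr : ln rho <= 0 by rewrite ln_le0 // ltW.
  rewrite -[w in w ^- _]lnK ?posrE // -expRM_natr -expRN -expRD.
  rewrite -[rho in rho ^- _]lnK ?posrE // -expRM_natr -expRN ler_expR.
  have jk_le : (j + k)%:R <= 2 * (lam * N.+1%:R).
    apply: (@le_trans _ _ (l + l)%:R); first by rewrite ler_nat leq_add.
    by rewrite natrD; lra.
  have jk_ge : 2 * (lam * N.+1%:R) <= (j + k)%:R + 2 * J.+1%:R.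
    apply: (@le_trans _ _ (l + l + 2)%:R);
        first by rewrite (natrD _ (l + l) 2) (natrD _ l l); lra.
    by rewrite -natrM -natrD ler_nat; clear -lj lk; lia.
  set x := 2 * (lam * N.+1%:R) in jk_le jk_ge *.
  have : 0 <= (x - (j + k)%:R) * (- ln rho - 2 * ln w) by rewrite mulr_ge0 //; lra.
  have : 0 <= (2 * J.+1%:R + (j + k)%:R - x) * (- ln rho) by rewrite mulr_ge0 //; lra.
  lra.
have rJ0 : 0 < rho ^+ J.+1 by rewrite exprn_gt0.
have mu14 := mu_ge; have d0 := delta_ge0; have d1 := delta_le.
have lamlam : rho / 4 <= lam * (1 - lam).
  have : (1 / 4) * rho <= lam * (1 - lam) by apply: ler_pM => //; rewrite /lam; lra.
  lra.
have N0 : 0 <= N.+1%:R :> R by [].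
have M0 : 0 <= N.+2%:R :> R by [].
have NM : N.+1%:R <= N.+2%:R :> R by rewrite ler_nat.
apply: (@le_trans _ _ (N.+1%:R * (corr * q * H) * rho ^- J.+1)).
  have -> : w ^- (j + k) * (N.+1%:R * (corr * q * (H * expR (2 * (lam * N.+1%:R) *
      ln w)))) =
     N.+1%:R * (corr * q * H) * (w ^- (j + k) * expR (2 * (lam * N.+1%:R) * ln w)) by ring.
  by rewrite ler_wpM2l // !mulr_ge0 // ltW.
set h := 2^-1 ^+ (d - J.+2) in q_le *.
have h0 : 0 <= h by rewrite exprn_ge0 // invr_ge0.
have qr : q * rho ^- J.+1 <= h * rho.
  rewrite ler_pdivrMr //; apply: le_trans q_le _.
  by rewrite -mulrA -exprS.
have Hr : H * (rho / 4) <= N.+2%:R * 'C(N.+1, l)%:R.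
  by apply: le_trans BE; rewrite ler_wpM2l // ltW.
apply: (@le_trans _ _ (N.+1%:R * corr * H * (h * rho))).
  have -> : N.+1%:R * (corr * q * H) * rho ^- J.+1 =
      N.+1%:R * corr * H * (q * rho ^- J.+1) by ring.
  by rewrite ler_wpM2l // !mulr_ge0 // ltW.
have -> : N.+1%:R * corr * H * (h * rho) = 4 * N.+1%:R * corr * h * (H * (rho / 4))
    by field.
apply: (@le_trans _ _ (4 * N.+1%:R * corr * h * (N.+2%:R * 'C(N.+1, l)%:R))).
  by rewrite ler_wpM2l // !mulr_ge0.
apply: (@le_trans _ _ (4 * N.+2%:R * corr * h * (N.+2%:R * 'C(N.+1, l)%:R))).
  rewrite ler_wpM2r ?mulr_ge0 //; do 2 (rewrite ler_wpM2r //).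
  by rewrite ler_wpM2l.
have -> : 4 * N.+2%:R * corr * h * (N.+2%:R * 'C(N.+1, l)%:R) =
  4 * 8%:R ^+ J * N.+2%:R ^+ 2 * corr * h * ('C(N.+1, l)%:R / 8%:R ^+ J).
  by field; rewrite gt_eqF.
by rewrite ler_wpM2l // !mulr_ge0 // ltW.
Qed.

End GramError.

Lemma sum_ord_eq (R : nzSemiRingType) K t :
  \sum_(i < K) (i == t :> nat)%:R = (t < K)%N%:R :> R.
Proof.
case: (ltnP t K) => [tK|Kt].
  rewrite (bigD1 (Ordinal tK)) //= eqxx big1 ?addr0 // => i.
  by rewrite -val_eqE /= => /negbTE ->.
by rewrite big1 // => i _; rewrite (ltn_eqF (leq_trans (ltn_ord i) Kt)).
Qed.

(* Test the multiplication operator f, which is tridiagonal in the almost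
   orthonormal family P, against the sum of the P k over the window. *)
Lemma tridiagonal_max (R : realFieldType) (X : finType) (x0 : X) (f : X -> R)
    (P : nat -> X -> R) (a K : nat) (A c : nat -> R) (A0 c0 eps W : R) :
  let G j k := W * \sum_x P j x * P k x in
  0 <= W -> (forall x, `|f x| <= 1) ->
  (forall k x, (a < k <= a + K.+1)%N ->
     f x * P k x = A k.+1 * P k.+1 x + c k * P k x + A k * P k.-1 x) ->
  (forall j k, (a <= j <= a + K.+2)%N -> (a <= k <= a + K.+2)%N ->
     `|G j k - (j == k)%:R| <= eps) ->
  0 <= A0 ->
  (forall k, (a < k <= a + K.+2)%N -> A0 <= A k <= 2^-1) ->
  (forall k, (a < k <= a + K.+1)%N -> c0 <= c k) ->
  (forall k, (a < k <= a + K.+1)%N -> `|c k| <= 1) ->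
  exists x, 2 * A0 + c0 - K.+1%:R^-1 - 3 * K.+1%:R * eps <= f x.
Proof.
move=> G W0 f1 Prec Gerr A0_ge0 A_bd c_ge c_bd.
pose x := [arg max_(x > x0) f x]%O.
have fmax y : f y <= f x by rewrite /x; case: arg_maxP => // z _; exact.
exists x; set tau := f x in fmax *.
have tau1 : `|tau| <= 1 by exact: f1.
have eps0 : 0 <= eps by apply: le_trans (normr_ge0 _) (Gerr a a _ _);
    rewrite leqnn leq_addr.
(* The block is [a + 1, ..., a + K + 1]. The recurrence also reaches the neighbours [a] and
   [a + K + 2], whose Gram entries with the block are within [eps] of 0. *)
pose idx (i : 'I_K.+1) := (a + i.+1)%N.
have idxP i : (a < idx i <= a + K.+1)%N.
  by rewrite /idx; have := ltn_ord i; clear; lia.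
pose Q y := \sum_(i < K.+1) P (idx i) y.
pose k := K.+1%:R : R.
have k_gt0 : 0 < k by rewrite ltr0n.
have Gge j l : (a <= j <= a + K.+2)%N -> (a <= l <= a + K.+2)%N ->
    (j == l)%:R - eps <= G j l <= (j == l)%:R + eps.
  by move=> ja la; have := Gerr j l ja la; rewrite ler_distl.
have EQ2 : W * (\sum_y Q y ^+ 2) = \sum_(i < K.+1) \sum_(j < K.+1) G (idx i) (idx j).
  rewrite (eq_bigr (fun y => \sum_(i < K.+1) \sum_(j < K.+1) P (idx i) y * P (idx j) y)).
    rewrite exchange_big mulr_sumr; apply: eq_bigr => i _.
    by rewrite exchange_big mulr_sumr; apply: eq_bigr.
  by move=> y _; rewrite expr2 mulr_suml; apply: eq_bigr => i _; rewrite mulr_sumr.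
have EfQ2 : W * (\sum_y f y * Q y ^+ 2) = \sum_(j < K.+1) \sum_(i < K.+1)
    (A (idx j).+1 * G (idx i) (idx j).+1 + c (idx j) * G (idx i) (idx j)
      + A (idx j) * G (idx i) (idx j).-1).
  rewrite (eq_bigr (fun y => \sum_(j < K.+1) \sum_(i < K.+1)
     (A (idx j).+1 * (P (idx i) y * P (idx j).+1 y) +
         c (idx j) * (P (idx i) y * P (idx j) y)
       + A (idx j) * (P (idx i) y * P (idx j).-1 y)))).
    rewrite exchange_big mulr_sumr; apply: eq_bigr => j _.
    rewrite exchange_big mulr_sumr; apply: eq_bigr => i _.
    rewrite !big_split /= -!mulr_sumr /G; ring.
  move=> y _; rewrite expr2 mulrA mulrC {2}/Q mulr_sumr mulr_sumr.
  apply: eq_bigr => j _; rewrite Prec //.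
  rewrite /Q mulr_suml; apply: eq_bigr => i _; ring.
have upper : W * (\sum_y f y * Q y ^+ 2) <= tau * k + k ^+ 2 * eps.
  apply: (@le_trans _ _ (tau * (W * \sum_y Q y ^+ 2))).
    rewrite mulrCA ler_wpM2l // mulr_sumr; apply: ler_sum => y _.
    by rewrite ler_wpM2r ?sqr_ge0.
  rewrite EQ2 mulr_sumr.
  have -> : tau * k + k ^+ 2 * eps = \sum_(i < K.+1) (tau + k * eps).
    by rewrite sumr_const card_ord -mulr_natl -/k; ring.
  apply: ler_sum => i _; rewrite mulr_sumr.
  have -> : tau + k * eps = \sum_(j < K.+1) (tau * (idx i == idx j)%:R + eps).
    rewrite big_split /= sumr_const card_ord -mulr_natl -/k -mulr_sumr.
    rewrite (eq_bigr (fun j : 'I_K.+1 => (j == i :> nat)%:R)).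
      by rewrite sum_ord_eq ltn_ord mulr1.
    by move=> j _; rewrite /idx eqn_add2l eqSS eq_sym.
  apply: ler_sum => j _.
  have /andP[g1 g2] : (idx i == idx j)%:R - eps <= G (idx i) (idx j) <=
      (idx i == idx j)%:R + eps.
    by apply: Gge; [move: (idxP i) | move: (idxP j)]; move: (idx _) => u; clear; lia.
  move: tau1; rewrite ler_norml => /andP[t1 t2]; nra.
have lower : 2 * (k - 1) * A0 + k * c0 - 2 * k ^+ 2 * eps <= W * (\sum_y f y * Q y ^+ 2).
  rewrite EfQ2.
  (* Each of the [k - 1] adjacent pairs in the block is counted twice. The [2 * eps] per entry is
     1/2 + 1 + 1/2, from the bounds on [A] and [c]. *)
  pose D (j : 'I_K.+1) : R := A0 * (j.+1 < K.+1)%N%:R + c0 + A0 * (0 < j)%N%:R.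
  have sumD : \sum_j (D j - 2 * k * eps) = 2 * (k - 1) * A0 + k * c0 - 2 * k ^+ 2 * eps.
    rewrite sumrB sumr_const card_ord -[_ *+ _]mulr_natl -/k !big_split /=.
    rewrite sumr_const card_ord -[c0 *+ _]mulr_natl -/k -!mulr_sumr.
    have -> : \sum_(j < K.+1) (j.+1 < K.+1)%N%:R = k - 1.
      rewrite big_ord_recr /= ltnn addr0 (eq_bigr (fun=> 1)).
        by rewrite sumr_const card_ord /k -natr1 addrK.
      by move=> j _; rewrite ltnS ltn_ord.
    have -> : \sum_(j < K.+1) (0 < j)%N%:R = k - 1.
      rewrite big_ord_recl /= add0r (eq_bigr (fun=> 1)) //.
      by rewrite sumr_const card_ord /k -natr1 addrK.
    ring.
  rewrite -sumD; apply: ler_sum => j _.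
  have -> : D j - 2 * k * eps = \sum_(i < K.+1)
     (A0 * (i == j.+1 :> nat)%:R + c0 * (i == j :> nat)%:R
       + A0 * ((0 < j)%N%:R * (i == j.-1 :> nat)%:R) - 2 * eps).
    rewrite sumrB !big_split /= -!mulr_sumr !sum_ord_eq sumr_const card_ord ltn_ord mulr1.
    rewrite (_ : (j.-1 < K.+1)%N) ?mulr1; last by have := ltn_ord j; clear; lia.
    by rewrite -[eps *+ _]mulr_natl -/k /D; ring.
  apply: ler_sum => i _.
  have iP := idxP i; have jP := idxP j.
  have [j1 [j2 [j3 [j4 [j5 i1]]]]] : (a < (idx j).+1 <= a + K.+2)%N /\ (a < idx j <=
      a + K.+2)%N /\
      (a <= (idx j).+1 <= a + K.+2)%N /\ (a <= idx j <= a + K.+2)%N /\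
      (a <= (idx j).-1 <= a + K.+2)%N /\ (a <= idx i <= a + K.+2)%N.
    by clear -iP jP; move: (idx i) (idx j) iP jP => u v; lia.
  have /andP[a1 a2] := A_bd _ j1.
  have /andP[b1 b2] := A_bd _ j2.
  have c1 := c_ge _ jP.
  have := c_bd _ jP; rewrite ler_norml => /andP[c2 c3].
  have /andP[g1 _] := Gge _ _ i1 j3.
  have /andP[g2 g2'] := Gge _ _ i1 j4.
  have /andP[g3 _] := Gge _ _ i1 j5.
  have e1 : (idx i == (idx j).+1) = (i == j.+1 :> nat) by rewrite /idx; clear;
      apply/eqP/eqP; lia.
  have e2 : (idx i == idx j) = (i == j :> nat) by rewrite /idx; clear; apply/eqP/eqP; lia.
  have e3 : (0 < j)%N%:R * (i == j.-1 :> nat)%:R <= (idx i == (idx j).-1)%:R :> R.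
    rewrite /idx; case: (ltnP 0 j) => j0; last by rewrite mul0r.
    rewrite mul1r ler_nat; case: (i =P j.-1 :> nat) => //= ->.
    by rewrite prednK // addnS /= eqxx.
  rewrite e1 in g1; rewrite e2 in g2 g2'.
  have d1 : 0 <= (i == j.+1 :> nat)%:R :> R by [].
  have d2 : 0 <= (i == j :> nat)%:R :> R by [].
  have d3 : 0 <= (0 < j)%N%:R * (i == j.-1 :> nat)%:R :> R by rewrite mulr_ge0.
  have h1 : A0 * (i == j.+1 :> nat)%:R - 2^-1 * eps <= A (idx j).+1 * G (idx i) (idx j).+1.
    move: (A _) (G _ _) (_ %:R) a1 a2 g1 d1 => aa gg dd; nra.
  have h2 : c0 * (i == j :> nat)%:R - eps <= c (idx j) * G (idx i) (idx j).
    move: (c (idx j)) (G _ _) (_ %:R) c1 c2 c3 g2 g2' d2 => aa gg dd; nra.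
  have h3 : A0 * ((0 < j)%N%:R * (i == j.-1 :> nat)%:R) - 2^-1 * eps <=
      A (idx j) * G (idx i) (idx j).-1.
    move: (A (idx j)) (G _ _) (_ %:R * _) (_ == (idx j).-1)%:R b1 b2 g3 e3 d3 =>
        aa gg dd ee; nra.
  lra.
(* Thus the loss [2 * A0 / k] at the two ends of the block is at most [1 / k]. *)
have A0_half : A0 <= 2^-1.
  have aP : (a < a.+1 <= a + K.+2)%N by clear; lia.
  by have /andP[h1 h2] := A_bd _ aP; exact: le_trans h1 h2.
have main := le_trans lower upper.
rewrite -(ler_pM2l k_gt0) -/k.
have kk : k * k^-1 = 1 by rewrite divff // gt_eqF.
have -> : k * (2 * A0 + c0 - k^-1 - 3 * k * eps) =
    2 * k * A0 + k * c0 - k * k^-1 - 3 * k ^+ 2 * eps by ring.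
rewrite kk; lra.
Qed.

(** Together with [sqrt_bin_down]: dividing by the root of the binomial makes the recurrence of
    [elem_sym_rec] symmetric, with off-diagonal coefficients the roots of [(k + 1) (M - k)]. *)
Lemma sqrt_bin_up (R : rcfType) M k : (k < M)%N ->
  k.+1%:R * Num.sqrt ('C(M, k.+1)%:R : R) =
  Num.sqrt (k.+1%:R * (M - k)%N%:R) * Num.sqrt 'C(M, k)%:R.
Proof.
move=> kM; apply/eqP; rewrite -(@eqrXn2 _ 2) ?mulr_ge0 ?sqrtr_ge0 //.
rewrite !exprMn !sqr_sqrtr ?mulr_ge0 // expr2 -!natrM eqr_nat.
by rewrite -!mulnA mul_bin_left.
Qed.

Lemma sqrt_bin_down (R : rcfType) M k : (k < M)%N ->
  (M - k)%N%:R * Num.sqrt ('C(M, k)%:R : R) =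
  Num.sqrt (k.+1%:R * (M - k)%N%:R) * Num.sqrt 'C(M, k.+1)%:R.
Proof.
move=> kM; apply/eqP; rewrite -(@eqrXn2 _ 2) ?mulr_ge0 ?sqrtr_ge0 //.
rewrite !exprMn !sqr_sqrtr ?mulr_ge0 // expr2 -!natrM eqr_nat.
by apply/eqP; rewrite [RHS]mulnAC mul_bin_left [LHS]mulnAC.
Qed.

(** The form in which the tridiagonal matrix produces it: the mean [rho], the diagonal
    [(1 - 2 * rho) * alpha] and twice the off-diagonal coefficient. *)
Lemma SCL_expand (R : realType) (rho alpha : R) : 0 < rho < 1 -> 0 <= alpha <= 1 - rho ->
  SCL rho alpha = rho + (1 - 2 * rho) * alpha
    + 2 * (std_dev rho * Num.sqrt (alpha * (1 - alpha))).
Proof.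
move=> /andP[r0 r1] /andP[a0 a1].
rewrite /SCL (_ : alpha + rho <= 1); last by lra.
rewrite sqrrD !sqr_sqrtr ?mulr_ge0 //; try lra.
rewrite /std_dev -!sqrtrM ?mulr_ge0 //; try lra.
have -> : alpha * (1 - rho) * (rho * (1 - alpha)) =
    rho * (1 - rho) * (alpha * (1 - alpha)) by ring.
by rewrite -mulr_natl; ring.
Qed.

Lemma sqrtrB_ge (R : rcfType) (x y : R) : 0 <= y -> Num.sqrt x - Num.sqrt y <=
    Num.sqrt (x - y).
Proof.
move=> y0; rewrite lerBlDr.
have [xy|xy] := leP x y.
  by apply: le_trans (ler_wsqrtr xy) _; rewrite lerDr sqrtr_ge0.
rewrite -ler_sqr ?nnegrE ?addr_ge0 ?sqrtr_ge0 //.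
rewrite sqrrD !sqr_sqrtr //; try lra.
have := mulr_ge0 (sqrtr_ge0 (x - y)) (sqrtr_ge0 y); rewrite -mulr_natl; lra.
Qed.

Lemma window_arith l N K : (N.+1 <= 4 * l.+1)%N -> (8 * K.+4 <= N.+1)%N ->
  (K.+2 <= l)%N /\ (N.+1 <= 8 * (l - K.+2).+1)%N.
Proof. lia. Qed.

Section Core.
Variables (R : realType) (rho mu w delta eps : R) (p m n N d K : nat).
Variables (B : 'M['F_p]_(N.+1, n)) (S : 'I_N.+1 -> {set 'F_p}).
Hypotheses (rho01 : 0 < rho < 1) (mu_ge : 1 <= 4 * mu) (mu_lt : 2 * mu < 1).
Hypotheses (w_gt0 : 0 < w) (w_le : rho * w ^+ 2 <= 1 - rho).
Hypotheses (delta_ge0 : 0 <= delta) (delta_le : delta <= 1 - rho - mu).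
Hypotheses (p_pr : prime p) (cardS : forall i, #|S i|%:R = rho * p%:R) (mdsB : is_MDS B).
Hypotheses (nE : n%:R = 2 * mu * m%:R) (NdE : (N.+1 + d = m)%N).
Hypothesis neg : dual_exponent rho mu delta w + F_term rho mu < 0.
Hypotheses (K_le_d : (K.+4 <= d)%N) (N_ge : (8 * K.+4 <= N.+1)%N).

Let M : R := N.+1%:R.
(** Bounds the distance from [k / M] to [mu + delta] for the indices [k] of the coefficients used,
    the rounding of [l] included. *)
Let theta : R := K.+3%:R / M.

Hypothesis eps_ge :
  4 * 8%:R ^+ K.+2 * N.+2%:R ^+ 2 * (pi / p%:R / sin (pi / p%:R)) ^+ m
    * 2^-1 ^+ (d - K.+4) <= eps.

(** [tridiagonal_max] for the satisfaction ratio minus its mean [rho], on the block whose upper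
    neighbour is [l]. The losses [sqrt theta] and [theta] come from the variation of the
    coefficients along the block, [1 / K.+1] from its ends, the last one from the Gram error. *)
Lemma sat_ratio_ge_SCL : exists x : 'cV['F_p]_n,
  SCL rho (mu + delta) - Num.sqrt theta - theta - K.+1%:R^-1 - 3 * K.+1%:R * eps
    <= sat_ratio R B S x.
Proof.
have /andP[r0 r1] := rho01; have mu14 := mu_ge; have d0 := delta_ge0; have d1 := delta_le.
have s0 := std_dev_gt0 rho01; have s2 := std_dev_sq rho01.
set s := std_dev rho in s0 s2.
pose lam := mu + delta.
have lam0 : 0 < lam by rewrite /lam; lra.
have lam1 : 0 < 1 - lam by rewrite /lam; lra.
have lamE : 0 <= lam <= 1 - rho by rewrite ltW //= /lam addrC -lerBrDr.
have lam4 : 1 / 4 <= lam by rewrite /lam; lra.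
have M0 : 0 < M by rewrite /M ltr0n.
pose l := Num.trunc (lam * M).
have lamM0 : 0 <= lam * M by rewrite mulr_ge0 // ltW.
have /andP[l1 l2] := truncn_itv lamM0; rewrite -/l -natr1 in l1 l2.
have lM : (l <= N.+1)%N.
  by rewrite -(ler_nat R) (le_trans l1) // ler_piMl ?(ltW M0) //; lra.
have l4 : (N.+1 <= 4 * l.+1)%N.
  rewrite -(ler_nat R) natrM -natr1 -/M.
  have : 1 / 4 * M <= lam * M by rewrite ler_wpM2r // ltW.
  lra.
pose a := (l - K.+2)%N.
have [Kl a_pos] := window_arith l4 N_ge.
have alE : (a + K.+2 = l)%N by rewrite /a subnK.
have lltM : (l < N.+1)%N.
  by rewrite -(ltr_nat R) (le_lt_trans l1) // -/M gtr_pMl // -subr_gt0.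
pose f (x : 'cV['F_p]_n) := s / M * \sum_i indic_vec rho B S x i.
have fE x : f x = (#|[set i | (B *m x) i 0 \in S i]%SET|%:R / M - rho).
  rewrite /f /indic_vec /indic -mulr_suml sumrB sumr_const card_ord -mulr_natr -/M.
  have -> : \sum_(i < N.+1) ((B *m x) i 0 \in S i)%:R =
     #|[set i | (B *m x) i 0 \in S i]%SET|%:R :> R.
    rewrite -natr_sum -sum1_card [in RHS]big_mkcond; congr (_%:R).
    by apply: eq_bigr => i _; rewrite inE; case: (_ \in _).
  by rewrite -/s; field; rewrite !gt_eqF.
(* [A k] couples the indices [k - 1] and [k], so the second factor is [N.+1 - (k - 1)]. *)
pose A (k : nat) := s / M * Num.sqrt (k%:R * (N.+2 - k)%N%:R).
pose c (k : nat) := (1 - 2 * rho) * k%:R / M.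
have theta0 : 0 < theta by rewrite divr_gt0 // ltr0n.
pose A0 := s * Num.sqrt ((lam - theta) * (1 - lam)).
have s_half : s <= 2^-1.
  rewrite -ler_sqr ?nnegrE ?(ltW s0) ?invr_ge0 // s2.
  by have := sqr_ge0 (rho - 2^-1); lra.
have thM : theta * M = K%:R + 3.
  by rewrite /theta divfK ?gt_eqF // -addn3 natrD.
have kR (k : nat) : (a < k <= a + K.+2)%N -> lam * M - (K%:R + 3) <= k%:R <= lam * M.
  move=> /andP[ak kl].
  have h1 : a%:R + 1 <= k%:R :> R by rewrite natr1 ler_nat.
  have h2 : k%:R <= l%:R :> R by rewrite ler_nat -alE.
  have h3 : a%:R + (K%:R + 2) = l%:R :> R by rewrite -alE natrD -[K.+2]addn2 natrD.
  by apply/andP; split; lra.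
have [||||||||x Hx] := @tridiagonal_max R _ 0 f (elem_sym_normalized rho B S) a K A c A0
   ((1 - 2 * rho) * lam - theta) eps (p%:R ^- n).
- by rewrite invr_ge0 exprn_ge0.
- move=> x; rewrite fE.
  set u := #|_|; have u0 : 0 <= u%:R :> R by [].
  have uM : u%:R <= M by rewrite /M ler_nat -[N.+1 in leqRHS]card_ord max_card.
  have q1 : u%:R / M <= 1 by rewrite ler_pdivrMr // mul1r.
  have q0 : 0 <= u%:R / M by rewrite divr_ge0 // ltW.
  move: (_ / _) q0 q1 => v q0 q1.
  by rewrite ler_norml; apply/andP; split; lra.
- move=> k x /andP[ak kl]; case: k ak kl => // k _ kl.
  have kM : (k.+1 < N.+1)%N.
    by apply: leq_ltn_trans lltM; rewrite -alE (leq_trans kl) // leq_add2l.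
  have rec := @elem_sym_rec R N.+1 (indic_vec rho B S x) ((1 - 2 * rho) / s) k
    (fun i => indic_sq rho01 (S i) _).
  have C_gt0 i : (i <= N.+1)%N -> 0 < Num.sqrt ('C(N.+1, i)%:R : R).
    by move=> iM; rewrite sqrtr_gt0 ltr0n bin_gt0.
  have up := @sqrt_bin_up R N.+1 k.+1 kM.
  have down := @sqrt_bin_down R N.+1 k (ltnW kM).
  have c1 := C_gt0 k.+2 kM; have c2 := C_gt0 k.+1 (ltnW kM).
  have c3 := C_gt0 k (ltnW (ltnW kM)).
  rewrite subSS in up.
  rewrite /f /elem_sym_normalized /A /c /= !subSS -/M.
  move: rec up down c1 c2 c3.
  move: (Num.sqrt 'C(N.+1, k.+2)%:R) (Num.sqrt 'C(N.+1, k.+1)%:R) (Num.sqrt 'C(N.+1, k)%:R).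
  move: (Num.sqrt (k.+2%:R * _)) (Num.sqrt (k.+1%:R * _)).
  move: (\sum_i _) (elem_sym _ k.+2) (elem_sym _ k.+1) (elem_sym _ k) => X e2 e1 e0 q2 q1 b2 b1 b0.
  move=> rec up down c1 c2 c3.
  have hu : k.+2%:R / b1 = q2 / b2 by apply/eqP;
      rewrite eqr_div ?(gt_eqF c1) ?(gt_eqF c2) // up.
  have hd : (N.+1 - k)%N%:R / b1 = q1 / b0 by apply/eqP;
      rewrite eqr_div ?(gt_eqF c3) ?(gt_eqF c2) // down.
  have ss : s * s^-1 = 1 by rewrite divff // gt_eqF.
  transitivity (s / M * ((X * e1) / b1)); first by ring.
  rewrite rec.
  transitivity (s / M * (k.+2%:R / b1 * e2 + (N.+1 - k)%N%:R / b1 * e0)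
     + s * s^-1 * ((1 - 2 * rho) * k.+1%:R / M * (e1 / b1))); first by ring.
  by rewrite hu hd ss; ring.
- move=> j k /andP[aj jl] /andP[ak kl]; apply: le_trans eps_ge.
  apply: (gram_error rho01 mu_ge mu_lt w_gt0 w_le delta_ge0 delta_le p_pr cardS mdsB nE
      NdE neg
     K_le_d a_pos).
  + by rewrite -/M -/lam -/l -alE leq_add2r.
  + by rewrite -/M -/lam -/l -alE.
  + by rewrite -/M -/lam -/l -alE leq_add2r.
  + by rewrite -/M -/lam -/l -alE.
- by rewrite mulr_ge0 ?sqrtr_ge0 // ltW.
- move=> k kP; have /andP[ak kl] := kP; have /andP[k1 k2] := kR k kP.
  have k_gt0 : (0 < k)%N by exact: leq_ltn_trans ak.
  have k_le : (k <= N.+1)%N by rewrite (leq_trans kl) // alE.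
  have kME : (N.+2 - k)%N%:R = M + 1 - k%:R :> R by rewrite natrB ?(leqW k_le) // -natr1.
  have theta_le : theta <= lam.
    rewrite -(ler_pM2r M0) thM.
    have : 8 * (K%:R + 4) <= M by rewrite /M -natrD -natrM ler_nat addn4.
    have : 1 / 4 * M <= lam * M by rewrite ler_wpM2r // ltW.
    lra.
  have kM : k%:R <= M by rewrite ler_nat.
  have k1R : 1 <= k%:R :> R by rewrite ler1n.
  have lamth : 0 <= (lam - theta) * (1 - lam) by rewrite mulr_ge0 ?(ltW lam1) // subr_ge0.
  apply/andP; split.
    rewrite /A0 /A -mulrA ler_pM2l // [leRHS]mulrC ler_pdivlMr //.
    rewrite -{1}(ger0_norm (ltW M0)) -sqrtr_sqr -sqrtrM //; apply: ler_wsqrtr.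
    rewrite kME.
    have -> : (lam - theta) * (1 - lam) * M ^+ 2 =
        (lam * M - theta * M) * (M - lam * M) by ring.
    apply: ler_pM; rewrite ?thM; [rewrite -thM -mulrBl mulr_ge0 ?(ltW M0) // subr_ge0 //
        | | by [] |].
    + have -> : M - lam * M = (1 - lam) * M by ring.
      by rewrite mulr_ge0 // ltW.
    + by move: k2; lra.
  have q_le : Num.sqrt (k%:R * (N.+2 - k)%N%:R) / M <= 1.
    rewrite ler_pdivrMr // mul1r -(ger0_norm (ltW M0)) -sqrtr_sqr; apply: ler_wsqrtr.
    by rewrite kME expr2; apply: ler_pM => //; lra.
  rewrite /A mulrAC -mulrA; apply: le_trans s_half.
  by rewrite ler_piMr // ltW.
- move=> k /andP[ak kl].
  have kP : (a < k <= a + K.+2)%N by rewrite ak (leq_trans kl) // leq_add2l.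
  have /andP[k1 k2] := kR k kP.
  rewrite /c -(ler_pM2r M0) divfK ?gt_eqF // mulrBl thM.
  have : 0 <= (lam * M - k%:R) * (2 * rho) by rewrite mulr_ge0 ?subr_ge0 // mulr_ge0 // ltW.
  have : 0 <= (lam * M - k%:R) * (2 * (1 - rho)).
    by rewrite mulr_ge0 ?subr_ge0 // mulr_ge0 // subr_ge0 ltW.
  move: k1 k2; set y := lam * M; rewrite -[(1 - 2 * rho) * lam * M]mulrA -/y => k1 k2 h1 h2.
  lra.
- move=> k /andP[ak kl].
  have kM : k%:R <= M by rewrite ler_nat (leq_trans (leqW kl)) // -addnS alE.
  have v1 : k%:R / M <= 1 by rewrite ler_pdivrMr // mul1r.
  have v0 : 0 <= k%:R / M by rewrite divr_ge0 // ltW.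
  rewrite /c -mulrA; move: (k%:R / M) v0 v1 => v v0 v1.
  by rewrite ler_norml; apply/andP; split; nra.
exists x; rewrite fE in Hx.
rewrite (SCL_expand rho01 lamE) /sat_ratio -/M -/s.
have sq : Num.sqrt (lam * (1 - lam)) - Num.sqrt theta <=
    Num.sqrt ((lam - theta) * (1 - lam)).
  have -> : (lam - theta) * (1 - lam) = lam * (1 - lam) - theta * (1 - lam) by ring.
  apply: le_trans (sqrtrB_ge _ _); last by rewrite mulr_ge0 ?(ltW theta0) ?(ltW lam1).
  rewrite lerB //; apply: ler_wsqrtr; rewrite ler_piMr ?(ltW theta0) //; lra.
have main : 2 * (s * Num.sqrt (lam * (1 - lam))) - Num.sqrt theta <= 2 * A0.
  have h1 : s * (Num.sqrt (lam * (1 - lam)) - Num.sqrt theta) <= A0 by rewrite ler_pM2l.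
  have h2 : s * Num.sqrt theta <= 2^-1 * Num.sqrt theta by rewrite ler_wpM2r // sqrtr_ge0.
  lra.
apply: le_trans (_ : 2 * A0 + ((1 - 2 * rho) * lam - theta) - K.+1%:R^-1
  - 3 * K.+1%:R * eps + rho <= _); last by rewrite -lerBrDr; exact: Hx.
rewrite -subr_ge0 in main; rewrite -subr_ge0; apply: le_trans main _.
by rewrite le_eqVlt; apply/orP; left; apply/eqP; ring.
Qed.

End Core.

(** * Choice of the parameters and the limit in [m] *)

(** The Gram error is of order [m ^ 2 / 2 ^ d] with [d] proportional to [m]; a cube leaves a factor
    [1 / m]. *)
Lemma cube_le_exp2 d : (d.+1 ^ 3 <= 8 * 2 ^ d)%N.
Proof.
case: d => [|[|[|d]]] //.
elim: d => [|d IH] //; rewrite [in leqRHS]expnS; apply: leq_trans (_ : 2 * d.+4 ^ 3 <= _)%N.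
  have -> : (2 * d.+4 ^ 3 = d.+4.+1 ^ 3 + (d ^ 3 + 9 * d ^ 2 + 21 * d + 3))%N by ring.
  exact: leq_addr.
by rewrite mulnCA leq_mul2l IH.
Qed.

(** Cauchy-Schwarz for the unit vectors with squared entries [alpha, 1 - alpha] and
    [1 - rho, rho]. *)
Lemma SCL_le1 (R : realType) (rho alpha : R) : 0 < rho < 1 -> 0 <= alpha <= 1 - rho ->
  SCL rho alpha <= 1.
Proof.
move=> /andP[r0 r1] /andP[a0 a1].
rewrite /SCL (_ : alpha + rho <= 1); last by lra.
have := sqr_ge0 (Num.sqrt (alpha * rho) - Num.sqrt ((1 - rho) * (1 - alpha))).
rewrite sqrrB sqrrD !sqr_sqrtr ?mulr_ge0 //; try lra.
rewrite -!sqrtrM ?mulr_ge0 //; try lra.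
have -> : alpha * rho * ((1 - rho) * (1 - alpha)) =
    alpha * (1 - rho) * (rho * (1 - alpha)) by ring.
rewrite !mulr2n; lra.
Qed.

Section Witness.
Variables (R : realType) (rho mu delta : R).
Hypotheses (rho01 : 0 < rho < 1) (mu01 : 0 <= 2 * mu < 1).
Hypothesis delta_range : 0 <= delta <= 1 - rho - mu.
Hypothesis neg : (E_term rho mu delta + (F_term rho mu)%:E < 0)%E.

Lemma dual_witness : exists w, [/\ 0 <= w, rho * w ^+ 2 <= 1 - rho,
  delta_of rho mu w = delta & dual_exponent rho mu delta w + F_term rho mu < 0].
Proof.
have [w [w0 w1 Dw]] := delta_of_surj rho01 mu01 delta_range.
exists w; split=> //; rewrite -lte_fin EFinD; apply: le_lt_trans neg.
by rewrite leeD2r // -{1 2}Dw; exact: E_term_ge.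
Qed.

(** [w = 0] forces [delta = 0], where the dual exponent has no term in [ln w]. Moving from 0 to [v]
    raises it by at most [(kappa + 1) * v], which [v] keeps below the gap; the relation
    [delta_of w = delta] is given up in exchange. *)
Lemma dual_witness_pos : exists w, [/\ 0 < w, rho * w ^+ 2 <= 1 - rho &
  dual_exponent rho mu delta w + F_term rho mu < 0].
Proof.
have [w [w0 w1 Dw Nw]] := dual_witness.
have [w_gt0|] := ltP 0 w; first by exists w.
move=> w_le0; have {w0 w_le0} w_eq0 : w = 0 by apply/eqP; rewrite eq_le w_le0 w0.
have delta0 : delta = 0.
  by rewrite -Dw w_eq0 /delta_of expr0n !(mulr0, mul0r) addr0.
have /andP[r0 r1] := rho01; have /andP[m0 m1] := mu01.
have k0 := kappa_ge0 rho.
pose gap := - (dual_exponent rho mu delta 0 + F_term rho mu).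
have gap0 : 0 < gap by rewrite oppr_gt0; move: Nw; rewrite w_eq0.
have s0 := std_dev_gt0 rho01.
pose v := Num.min (Num.min 1 (std_dev rho / rho)) (gap / (2 * (kappa rho + 1))).
have k1 : 0 < 2 * (kappa rho + 1) by lra.
have v0 : 0 < v by rewrite !lt_min ltr01 !divr_gt0.
have [v1 v2 v3] : [/\ v <= 1, v <= std_dev rho / rho & v <= gap / (2 * (kappa rho + 1))].
  by rewrite /v !ge_min !lexx !orbT.
exists v; split=> //.
  have : v ^+ 2 <= (std_dev rho / rho) ^+ 2.
    by rewrite lerXn2r ?nnegrE ?(ltW v0) ?divr_ge0 ?(ltW s0) ?(ltW r0).
  rewrite expr_div_n std_dev_sq //.
  have -> : rho * (1 - rho) / rho ^+ 2 = (1 - rho) / rho by field; rewrite gt_eqF.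
  by rewrite ler_pdivlMr // mulrC.
have kv : 0 <= kappa rho * v by rewrite mulr_ge0 // ltW.
have l1 : ln (2 + kappa rho * v) <= ln 2 + kappa rho * v / 2.
  have -> : 2 + kappa rho * v = 2 * (1 + kappa rho * v / 2) by field.
  rewrite lnM ?posrE //; last by lra.
  by rewrite lerD2l; apply: le_ln1Dx; lra.
have l2 : ln (1 + v ^+ 2) <= v.
  have v2_0 := sqr_ge0 v.
  apply: le_trans (le_ln1Dx _) _; first by lra.
  by rewrite expr2 ler_piMl // ltW.
have v3' : v * (2 * (kappa rho + 1)) <= gap by rewrite -ler_pdivlMr.
rewrite /gap /dual_exponent delta0 !(mulr0, mul0r, subr0, expr0n, addr0) /= ln1 mulr0
    addr0 in v3' gap0.
rewrite /dual_exponent delta0 !(mulr0, mul0r, subr0, addr0).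
have h1 : 2 * mu * ln (2 + kappa rho * v) <= 2 * mu * ln 2 + kappa rho * v / 2.
  have : 2 * mu * ln (2 + kappa rho * v) <= 2 * mu * (ln 2 + kappa rho * v / 2)
      by rewrite ler_wpM2l.
  have : 2 * mu * (kappa rho * v / 2) <= kappa rho * v / 2 by rewrite ler_piMl //; lra.
  lra.
have h2 : (1 - 2 * mu) * ln (1 + v ^+ 2) <= v.
  have ln0 : 0 <= ln (1 + v ^+ 2) by rewrite ln_ge0 // lerDl sqr_ge0.
  by apply: le_trans l2; rewrite ler_piMl //; lra.
have := mulr_gt0 v0 k1.
lra.
Qed.

Lemma rate_ge_quarter : 1 <= 4 * mu.
Proof.
rewrite leNgt; apply/negP => mu14.
have [w [w0 w1 Dw Nw]] := dual_witness.
have /andP[r0 r1] := rho01; have /andP[d0 d1] := delta_range.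
have lam1 : mu + delta_of rho mu w < 1 by rewrite Dw; lra.
by have := small_rate_exponent_ge0 rho01 mu01 mu14 w0 w1 lam1; rewrite Dw leNgt Nw.
Qed.

End Witness.

Lemma sat_ratio_rowsub (R : realType) (p m n N d : nat) (B : 'M['F_p]_(m, n))
    (S : 'I_m -> {set 'F_p}) (g : 'I_N.+1 -> 'I_m) (x : 'cV['F_p]_n) :
  injective g -> (N.+1 + d = m)%N ->
  sat_ratio R (rowsub g B) (fun i => S (g i)) x - d%:R / m%:R <= sat_ratio R B S x.
Proof.
move=> g_inj NdE; rewrite /sat_ratio.
set u := #|_|; set U := #|_|.
have uU : (u <= U)%N.
  rewrite /u -(card_imset _ g_inj); apply: subset_leq_card.
  rewrite sub_imset_pre; apply/fintype.subsetP => i.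
  by rewrite !inE mul_rowsub_mx mxE.
have uN : (u <= N.+1)%N by rewrite -[N.+1 in leqRHS]card_ord max_card.
have N0 : 0 < N.+1%:R :> R by rewrite ltr0n.
have m0 : 0 < m%:R :> R by rewrite ltr0n -NdE.
rewrite ler_pdivlMr // mulrBl divfK ?gt_eqF //.
have -> : u%:R / N.+1%:R * m%:R = u%:R + u%:R / N.+1%:R * d%:R :> R.
  by rewrite -NdE natrD; field; rewrite gt_eqF.
have : u%:R / N.+1%:R * d%:R <= d%:R :> R.
  by rewrite ler_piMl // ler_pdivrMr // mul1r ler_nat.
have : u%:R <= U%:R :> R by rewrite ler_nat.
by move=> h1 h2; rewrite lerBlDr lerD.
Qed.

Section LargeRate.
Variables (R : realType) (mu e eta t : R) (K m : nat).
Hypotheses (mu_ge : 1 <= 4 * mu) (mu_lt : 2 * mu < 1).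
Hypotheses (eta_gt0 : 0 < eta) (eta_e : eta <= e / 8) (eta_mu : eta <= (1 - 2 * mu) / 2).
Hypotheses (t_gt0 : 0 < t) (t_le1 : t <= 1) (t_e : t <= e / 8).
Hypothesis K_ge : K.+1%:R^-1 <= e / 8.
(** In turn, these thresholds give [K.+4 <= d]; [8 * K.+4 <= N.+1] and [2 <= n]; [8 <= p];
    [theta <= t ^+ 2]; and the Gram error. They involve neither [rho] nor [p] nor [delta]. *)
Hypothesis m_ge1 : K%:R + 6 <= eta * m%:R.
Hypothesis m_ge2 : 16 * (K%:R + 4) <= m%:R :> R.
Hypothesis m_ge3 : 8 <= (1 - 2 * mu) * m%:R.
Hypothesis m_ge4 : 2 * (K%:R + 3) <= t ^+ 2 * m%:R.
Hypothesis m_ge5 : 24 * K.+1%:R *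
  (128 * 8%:R ^+ K.+2 * 2 ^+ K.+4 * expR (8 / (1 - 2 * mu))) <= e * eta ^+ 3 * m%:R.

(** In [m_ge5], 128 is the 4 of [gram_error] times 4 from [N.+2 <= 2 * m] squared times 8 from
    [cube_le_exp2]; 24 is 3 times the 8 of [e / 8]. *)
Lemma gram_error_small (N d p : nat) : d = Num.trunc (eta * m%:R) -> (N.+1 + d = m)%N ->
  (K.+4 <= d)%N -> prime p -> (8 <= p)%N -> (1 - 2 * mu) * m%:R <= p%:R ->
  3 * K.+1%:R * (4 * 8%:R ^+ K.+2 * N.+2%:R ^+ 2 * (pi / p%:R / sin (pi / p%:R)) ^+ m
    * 2^-1 ^+ (d - K.+4)) <= e / 8.
Proof.
move=> dE NdE Kd p_pr p8 cm; have h1 := mu_lt; have h5 := m_ge5; have eta0 := eta_gt0.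
have c0 : 0 < 1 - 2 * mu by lra.
have m_gt0 : 0 < m%:R :> R by rewrite ltr0n -NdE.
have corr_le := sinc_corr_le c0 p8 cm.
set corr := (_ ^+ m) in corr_le *; set Cc := expR _ in corr_le h5.
have p0 : 0 < p%:R :> R by rewrite ltr0n prime_gt0.
have corr0 : 0 <= corr.
  rewrite exprn_ge0 // divr_ge0 ?divr_ge0 ?pi_ge0 ?(ltW p0) //.
  apply: sin_ge0_pi; rewrite divr_ge0 ?pi_ge0 ?(ltW p0) //= ler_pdivrMr //.
  by rewrite ler_peMr ?pi_ge0 // ler1n prime_gt0.
have em0 : 0 <= eta * m%:R by rewrite mulr_ge0 // ltW.
have /andP[_ dlt] := truncn_itv em0; rewrite -dE in dlt.
have half_le : 2^-1 ^+ (d - K.+4) * (eta * m%:R) ^+ 3 <= 8 * 2 ^+ K.+4.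
  have -> : 2^-1 ^+ (d - K.+4) = 2 ^+ K.+4 / 2 ^+ d :> R.
    by rewrite exprVn -{2}(subnK Kd) exprD invfM mulrA [RHS]mulrAC divff ?mul1r //
        expf_neq0.
  rewrite mulrAC ler_pdivrMr ?exprn_gt0 // [leRHS]mulrAC mulrC ler_pM2r ?exprn_gt0 //.
  apply: (@le_trans _ _ (d.+1%:R ^+ 3)).
    by rewrite lerXn2r ?nnegrE ?(ltW dlt) ?em0 ?ler0n.
  by rewrite -!natrX -natrM ler_nat cube_le_exp2.
set hp := 2^-1 ^+ _ in half_le *.
have hp0 : 0 <= hp by rewrite exprn_ge0 // invr_ge0.
have N2 : N.+2%:R ^+ 2 <= 4 * m%:R ^+ 2 :> R.
  have -> : 4 * m%:R ^+ 2 = (2 * m%:R) ^+ 2 :> R by ring.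
  rewrite lerXn2r ?nnegrE // -natrM ler_nat -NdE; clear; lia.
have X0 : 0 < (eta * m%:R) ^+ 3 by rewrite exprn_gt0 // mulr_gt0.
rewrite -(ler_pM2r X0).
set E8 := 8%:R ^+ K.+2 in h5 *.
have E80 : 0 <= E8 by rewrite exprn_ge0.
clearbody E8 hp corr.
have k0 : 0 <= K.+1%:R :> R by [].
apply: (@le_trans _ _ (3 * K.+1%:R * (4 * E8 * (4 * m%:R ^+ 2) * Cc * (8 * 2 ^+ K.+4)))).
  have -> : 3 * K.+1%:R * (4 * E8 * N.+2%:R ^+ 2 * corr * hp) * (eta * m%:R) ^+ 3 =
     3 * K.+1%:R * (4 * E8 * N.+2%:R ^+ 2 * corr * (hp * (eta * m%:R) ^+ 3)) by ring.
  rewrite ler_wpM2l ?mulr_ge0 //; apply: ler_pM => //.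
  - by rewrite !mulr_ge0 ?sqr_ge0.
  - by rewrite mulr_ge0 // ltW.
  apply: ler_pM => //; first by rewrite !mulr_ge0 ?sqr_ge0.
  by rewrite ler_wpM2l // mulr_ge0.
have -> : 3 * K.+1%:R * (4 * E8 * (4 * m%:R ^+ 2) * Cc * (8 * 2 ^+ K.+4)) =
   (24 * K.+1%:R * (128 * E8 * 2 ^+ K.+4 * Cc)) * (m%:R ^+ 2 / 8) by field.
have -> : e / 8 * (eta * m%:R) ^+ 3 = (e * eta ^+ 3 * m%:R) * (m%:R ^+ 2 / 8) by ring.
by rewrite ler_wpM2r // divr_ge0 ?sqr_ge0.
Qed.

(** Five errors of at most [e / 8] each: [sqrt theta], [theta], [1 / K.+1], the Gram error and the
    proportion [d / m] of dropped rows. *)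
Lemma large_rate (n p : nat) (rho delta : R) (B : 'M['F_p]_(m, n)) (S : 'I_m ->
    {set 'F_p}) :
  n%:R / m%:R = 2 * mu -> 0 < rho < 1 -> prime p -> is_MDS B ->
  (forall i, #|S i|%:R = rho * p%:R) -> 0 <= delta <= 1 - rho - mu ->
  (E_term rho mu delta + (F_term rho mu)%:E < 0)%E ->
  exists x : 'cV['F_p]_n, SCL rho (mu + delta) - e <= sat_ratio R B S x.
Proof.
move=> nm rho01 p_pr mdsB cardS d01 neg.
have eta0 := eta_gt0; have mu14 := mu_ge; have mu12 := mu_lt.
have m_gt0 : 0 < m%:R :> R.
  by apply: lt_le_trans m_ge2; rewrite mulr_gt0 // addr_ge0_gt0.
have nE : n%:R = 2 * mu * m%:R by rewrite -nm divfK // gt_eqF.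
have mu01 : 0 <= 2 * mu < 1 by rewrite mu12 andbT; lra.
have [w [w0 w1 Nw]] := dual_witness_pos rho01 mu01 d01 neg.
have /andP[d0 d1] := d01.
(* [eta <= (1 - 2 * mu) / 2] leaves at least [n] rows, so the punctured code is still MDS, and at
   least [m / 2] rows because [mu >= 1/4]. *)
pose d := Num.trunc (eta * m%:R).
have em0 : 0 <= eta * m%:R by rewrite mulr_ge0 // ltW.
have /andP[dl dlt] := truncn_itv em0; rewrite -/d in dl dlt.
have Kd : (K.+4 <= d)%N.
  by rewrite truncn_ge_nat // (le_trans _ m_ge1) // -[K.+4]addn4 natrD lerD2l ler_nat.
have d_half : 2 * d%:R <= m%:R :> R.
  have : eta * m%:R <= 4^-1 * m%:R by rewrite ler_wpM2r ?(ltW m_gt0) //; move: eta_mu; lra.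
  by move: dl; lra.
have dm : (d < m)%N by rewrite -(ltr_nat R); move: d_half m_gt0; lra.
have [N NdE] : exists N, (N.+1 + d = m)%N.
  by exists (m - d).-1; rewrite prednK ?subn_gt0 // subnK // ltnW.
have MR : N.+1%:R + d%:R = m%:R :> R by rewrite -natrD NdE.
have nN : (n <= N.+1)%N.
  rewrite -(ler_nat R) nE.
  have : eta * m%:R <= (1 - 2 * mu) / 2 * m%:R by rewrite ler_wpM2r // ltW.
  have : 0 <= (1 - 2 * mu) * m%:R by rewrite mulr_ge0 ?(ltW m_gt0) //; lra.
  by move: dl MR; lra.
have leNm : (N.+1 <= m)%N by rewrite -NdE leq_addr.
pose g (i : 'I_N.+1) := widen_ord leNm i.
have g_inj : injective g by move=> i j /(congr1 val)/= /val_inj.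
have mdsB' := MDS_rowsub g_inj nN mdsB.
have n2 : (2 <= n)%N.
  rewrite -(ler_nat R) nE.
  have : 1 * m%:R <= 4 * mu * m%:R by rewrite ler_wpM2r // ltW.
  have : 64 <= m%:R :> R by apply: le_trans m_ge2; have := ler0n R K; lra.
  lra.
have mp : (m - n <= p)%N by have := MDS_card_field n2 mdsB; rewrite card_Fp.
have nm_le : (n <= m)%N by case: mdsB.
have cm : (1 - 2 * mu) * m%:R <= p%:R.
  apply: (@le_trans _ _ (m - n)%N%:R); last by rewrite ler_nat.
  by rewrite natrB // nE; lra.
have p8 : (8 <= p)%N by rewrite -(ler_nat R) (le_trans m_ge3).
have N_ge : (8 * K.+4 <= N.+1)%N.
  rewrite -(ler_nat R) natrM -[K.+4]addn4 natrD.
  by move: m_ge2 d_half MR; lra.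
have small := gram_error_small (erefl d) NdE Kd p_pr p8 cm.
have [x Hx] := sat_ratio_ge_SCL rho01 mu14 mu12 w0 w1 d0 d1 p_pr (fun i =>
    cardS (g i)) mdsB'
  nE NdE Nw Kd N_ge (lexx _).
exists x; apply: le_trans (sat_ratio_rowsub R B S x g_inj NdE).
have d_le : d%:R / m%:R <= e / 8.
  by apply: le_trans eta_e; rewrite ler_pdivrMr.
set theta := K.+3%:R / N.+1%:R in Hx.
have N0 : 0 < N.+1%:R :> R by rewrite ltr0n.
have theta0 : 0 <= theta by rewrite divr_ge0.
have theta_le : theta <= t ^+ 2.
  rewrite ler_pdivrMr // -[K.+3]addn3 natrD.
  have : t ^+ 2 * m%:R <= t ^+ 2 * (2 * N.+1%:R).
    by rewrite ler_wpM2l ?sqr_ge0 //; move: d_half MR; lra.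
  by move: m_ge4; lra.
have t2 : t ^+ 2 <= t by rewrite expr2 ler_piMl // ltW.
have sq_le : Num.sqrt theta <= t.
  by rewrite -[t]ger0_norm ?(ltW t_gt0) // -sqrtr_sqr ler_wsqrtr.
have e0 : 0 < e by move: t_e t_gt0; lra.
apply: le_trans (lerB Hx d_le); move: small K_ge t_e sq_le theta_le t2.
clear Hx theta0; clearbody theta.
set Z := 3 * K.+1%:R * _; set k1 := K.+1%:R^-1; set sq := Num.sqrt _.
clearbody Z k1 sq; move: (t ^+ 2) => t2' h1 h2 h3 h4 h5 h6.
lra.
Qed.

End LargeRate.

Lemma MDS_square_sat (R : realType) (p n : nat) (B : 'M['F_p]_n) (S : 'I_n -> {set 'F_p}) :
  (0 < n)%N -> is_MDS B -> (forall i, S i != finset.set0) ->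
  exists x : 'cV['F_p]_n, sat_ratio R B S x = 1.
Proof.
move=> n0 [_ mdsB] S0.
have := mdsB id (fun _ _ => id); rewrite mxsub_id row_free_unit => uB.
have pick i : {v | v \in S i} by apply: sigW; exact/set0Pn.
exists (invmx B *m \col_i sval (pick i)).
rewrite /sat_ratio mulKVmx // (_ : [set i | _]%SET = finset.setT).
  by rewrite cardsT card_ord divff // pnatr_eq0 -lt0n.
by apply/setP => i; rewrite !inE mxE; case: (pick i).
Qed.

Theorem theorem1p9 (R : realType) (mu : R) (hmu : 0 <= 2 * mu <= 1)
    (eps : R) (heps : 0 < eps) :
  \forall m \near \oo, forall n : nat, n%:R / m%:R = 2 * mu ->
  forall rho : R, 0 < rho < 1 ->
  forall p : nat, prime p ->
  forall B : 'M['F_p]_(m, n), is_MDS B ->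
  forall S : 'I_m -> {set 'F_p}, (forall i, #|S i|%:R = rho * p%:R) ->
  exists x : 'cV['F_p]_n,
  forall delta : R, 0 <= delta <= 1 - rho - mu ->
  (E_term rho mu delta + (F_term rho mu)%:E < 0)%E ->
  SCL rho (mu + delta) - eps <= sat_ratio R B S x.
Proof.
(* One [x] has to serve all [delta]: a maximizer of the satisfaction ratio does. *)
suff main : \forall m \near \oo, forall n : nat, n%:R / m%:R = 2 * mu ->
    forall rho : R, 0 < rho < 1 -> forall p : nat, prime p ->
    forall B : 'M['F_p]_(m, n), is_MDS B ->
    forall S : 'I_m -> {set 'F_p}, (forall i, #|S i|%:R = rho * p%:R) ->
    forall delta : R, 0 <= delta <= 1 - rho - mu ->
    (E_term rho mu delta + (F_term rho mu)%:E < 0)%E ->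
    exists x : 'cV['F_p]_n, SCL rho (mu + delta) - eps <= sat_ratio R B S x.
  apply: filterS main => m main n nm rho rho01 p p_pr B mdsB S cardS.
  exists [arg max_(x > (0 : 'cV['F_p]_n)) sat_ratio R B S x]%O => delta d01 neg.
  have [x Hx] := main n nm rho rho01 p p_pr B mdsB S cardS delta d01 neg.
  by apply: le_trans Hx _; case: arg_maxP => // y _; exact.
have /andP[mu0 mu1] := hmu.
(* At [2 * mu = 1] the code is the whole space: all constraints can be satisfied, and [SCL_le1]
   concludes. Otherwise [1 - 2 * mu > 0], which the linear lower bound on [p] requires. *)
have [mu_eq|mu_neq] := eqVneq (2 * mu) 1.
  near=> m => n nm rho rho01 p p_pr B mdsB S cardS delta d01 _.
  have m0 : (0 < m)%N by near: m; exact: nbhs_infty_gt.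
  have m_neq0 : m%:R != 0 :> R by rewrite pnatr_eq0 -lt0n.
  have nm' : n = m.
    by apply/eqP; rewrite -(eqr_nat R) -[X in X == _](divfK m_neq0) nm mu_eq mul1r.
  move: B mdsB; rewrite nm' => B mdsB.
  have /andP[r0 r1] := rho01; have /andP[d0 d1] := d01.
  have S0 i : S i != finset.set0.
    rewrite -card_gt0 -(ltr_nat R) cardS mulr_gt0 // ltr0n; exact: prime_gt0.
  have [x xE] := MDS_square_sat R m0 mdsB S0; exists x; rewrite xE.
  rewrite lerBlDr; apply: (@le_trans _ _ 1); last by rewrite lerDl ltW.
  by apply: SCL_le1 => //; apply/andP; split; lra.
have mu_lt : 2 * mu < 1 by rewrite lt_neqAle mu_neq.
have mu01 : 0 <= 2 * mu < 1 by rewrite mu0.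
have [mu_ge|mu_small] := leP 1 (4 * mu); last first.
  near=> m => n nm rho rho01 p p_pr B mdsB S cardS delta d01 neg.
  by have := rate_ge_quarter rho01 mu01 d01 neg; rewrite leNgt mu_small.
pose eta := Num.min (eps / 8) ((1 - 2 * mu) / 2).
have c0 : 0 < 1 - 2 * mu by rewrite subr_gt0.
have eta0 : 0 < eta by rewrite lt_min !divr_gt0.
have [eta1 eta2] : eta <= eps / 8 /\ eta <= (1 - 2 * mu) / 2.
  by rewrite /eta !ge_min !lexx !orbT.
pose t := Num.min 1 (eps / 8).
have t0 : 0 < t by rewrite lt_min ltr01 divr_gt0.
have [t1 t2] : t <= 1 /\ t <= eps / 8 by rewrite /t !ge_min !lexx !orbT.
pose K := Num.bound (8 / eps).
have K_ge : K.+1%:R^-1 <= eps / 8.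
  have hK : 8 / eps < K.+1%:R.
    apply: lt_trans (archi_boundP _) _; first by rewrite divr_ge0 // ltW.
    by rewrite ltr_nat.
  by rewrite -[leRHS]invf_div lef_pV2 ?posrE ?ltr0n ?divr_gt0 // ltW.
have big (a b : R) : 0 < a -> \forall m \near \oo, b <= a * m%:R.
  move=> a0; near=> m; rewrite mulrC -ler_pdivrMr //.
  by near: m; exact: nbhs_infty_ger.
near=> m => n nm rho rho01 p p_pr B mdsB S cardS delta d01 neg.
apply: (@large_rate R mu eps eta t K m) => //.
- by near: m; exact: big.
- by rewrite -[leRHS]mul1r; near: m; exact: big.
- by near: m; exact: big.
- by near: m; apply: big; rewrite exprn_gt0.
- by near: m; apply: big; rewrite mulr_gt0 // exprn_gt0.
Unshelve. all: by end_near.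
Qed.
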